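(* Let $J$ be a $w^*$-closed, 2-sided ideal of $F^\infty$. The map $\Psi:F^\infty/J\to B(\mathcal N_J)$ defined by $$\Psi(\varphi+J)=P_{\mathcal N_J}\varphi(S_1,\dots,S_n)|_{\mathcal N_J}$$ is a completely isometric isomorphism onto $P_{\mathcal N_J}F^\infty|_{\mathcal N_J}$, and a homeomorphism relative to the $w^*$-topology on $F^\infty/J$ and the WOT-topology on $P_{\mathcal N_J}F^\infty|_{\mathcal N_J}$.
   Context: Let $1\le n\le\aleph_0$, $\mathcal H_n$ an $n$-dimensional Hilbert space with orthonormal basis $e_1,\dots,e_n$, and $\mathcal F^2=\bigoplus_{k\ge0}\mathcal H_n^{\otimes k}$ the full Fock space, $\mathcal H_n^{\otimes0}=\mathbb C1$. The left creation operators are $S_i\psi=e_i\otimes\psi$ on $\mathcal F^2$. $F^\infty$ is the WOT-closed subalgebra of $B(\mathcal F^2)$ generated by $S_1,\dots,S_n$ and the identity. An element $\varphi=\varphi(S_1,\dots,S_n)\in F^\infty$ is identified with the vector $\varphi(S_1,\dots,S_n)1\in\mathcal F^2$, and one writes $\varphi\otimes\psi:=\varphi(S_1,\dots,S_n)\psi$ for $\psi\in\mathcal F^2$. $F^\infty$ is $w^*$-closed in $B(\mathcal F^2)=c_1(\mathcal F^2)^*$ (trace duality), with predual $(F^\infty)_*$; the $w^*$ and WOT topologies coincide on $F^\infty$. For a 2-sided ideal $J$ of $F^\infty$: $\mathcal M_J=\overline{\{\varphi\otimes\psi:\varphi\in J,\psi\in\mathcal F^2\}}$ (a closed subspace of $\mathcal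 F^2$), $\mathcal N_J=\mathcal F^2\ominus\mathcal M_J$, and $P_{\mathcal N_J}$ is the orthogonal projection onto $\mathcal N_J$; $P_{\mathcal N_J}F^\infty|_{\mathcal N_J}=\{P_{\mathcal N_J}\varphi|_{\mathcal N_J}:\varphi\in F^\infty\}$. The $w^*$-topology on $F^\infty/J$ comes from $F^\infty/J=({}^\perp J)^*$, where ${}^\perp J=\{f\in(F^\infty)_*: f|_J=0\}$. The operator space structure on $F^\infty/J$ is $M_k(F^\infty/J)=M_k(F^\infty)/M_k(J)$ with the quotient norm. *)

(* Defs.v *)
From HB Require Import structures.
From mathcomp Require Import all_boot all_order all_algebra.
From mathcomp Require Import all_classical all_reals all_analysis.
From mathcomp Require Import complex.
From mathcomp Require Import ring.

Set Implicit Arguments.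
Unset Strict Implicit.
Unset Printing Implicit Defensive.

Import Order.TTheory GRing.Theory Num.Theory.
Import numFieldNormedType.Exports.

Local Open Scope classical_set_scope.
Local Open Scope ring_scope.
Local Open Scope complex_scope.

(* The scalar product is linear in its first argument. *)
HB.mixin Record NormedModule_isInner (R : realType) V
    of NormedModule R[i] V := {
  dot : V -> V -> R[i] ;
  dotC : forall x y, dot x y = Num.conj (dot y x) ;
  dot_linearl : forall a x y z, dot (a *: x + y) z = a * dot x z + dot y z ;
  dot_normE : forall x, dot x x = `|x| ^+ 2
}.

#[short(type="innerType")]
HB.structure Definition InnerProduct (R : realType) :=
  {V of NormedModule R[i] V & NormedModule_isInner R V}.

HB.factory Record Lmodule_isInner (R : realType) V of GRing.Lmodule R[i] V := {
  dot : V -> V -> R[i] ;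
  dotC : forall x y, dot x y = Num.conj (dot y x) ;
  dot_linearl : forall a x y z, dot (a *: x + y) z = a * dot x z + dot y z ;
  dot_ge0 : forall x, 0 <= dot x x ;
  dot_eq0 : forall x, dot x x = 0 -> x = 0
}.

HB.builders Context (R : realType) V of Lmodule_isInner R V.

Let nrm (x : V) : R[i] := sqrtC (dot x x).

Let dotDl x y z : dot (x + y) z = dot x z + dot y z.
Proof. by rewrite -[x]scale1r dot_linearl mul1r scale1r. Qed.

Let dot0l z : dot 0 z = 0.
Proof. by apply: (addrI (dot 0 z)); rewrite -dotDl !addr0. Qed.

Let dotZl a x z : dot (a *: x) z = a * dot x z.
Proof. by rewrite -[_ *: x]addr0 dot_linearl dot0l addr0. Qed.

Let dotDr x y z : dot z (x + y) = dot z x + dot z y.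
Proof. by rewrite dotC dotDl rmorphD /= -!dotC. Qed.

Let dotZr a x z : dot z (a *: x) = Num.conj a * dot z x.
Proof. by rewrite dotC dotZl rmorphM /= -!dotC. Qed.

Let nrmE x : nrm x ^+ 2 = dot x x.
Proof. by rewrite sqrtCK. Qed.

Let nrm_ge0 x : 0 <= nrm x.
Proof. by rewrite sqrtC_ge0 dot_ge0. Qed.

Let CS x y : `|dot x y| <= nrm x * nrm y.
Proof.
have [y0|y0] := eqVneq (dot y y) 0.
  rewrite (dot_eq0 y0) dotC dot0l rmorph0 normr0 mulr_ge0//.
have yy : 0 < dot y y by rewrite lt_def y0 dot_ge0.
rewrite -(@ler_pXn2r _ 2)// ?nnegrE// ?mulr_ge0// exprMn !nrmE.
pose a := - (dot x y / dot y y).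
have := dot_ge0 (a *: y + x).
rewrite dotDl !dotDr !dotZl !dotZr.
have -> : Num.conj a = - (dot y x / dot y y).
  by rewrite rmorphN rmorphM fmorphV /= -!dotC.
rewrite /a; set b := dot y y in y0 yy *.
set d := dot x y; set e := dot y x; set c := dot x x.
rewrite (_ : _ + _ = c - d * e / b); last by field.
by rewrite subr_ge0 ler_pdivrMr// normCK -dotC.
Qed.

Let nrmD x y : nrm (x + y) <= nrm x + nrm y.
Proof.
rewrite -(@ler_pXn2r _ 2)// ?nnegrE ?addr_ge0// sqrrD !nrmE dotDl !dotDr.
have h : dot x y + dot y x <= nrm x * nrm y *+ 2.
  apply: (@le_trans _ _ `|dot x y + dot y x|).
    apply: real_ler_norm; rewrite CrealE rmorphD /= -!dotC addrC//.
  rewrite (le_trans (ler_normD _ _))// mulr2n lerD//.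
  by rewrite mulrC CS.
rewrite (_ : _ + _ = (dot x y + dot y x) + (dot x x + dot y y)); last by ring.
by rewrite [leRHS]addrAC [leRHS]addrC lerD2r.
Qed.

Let nrmZ (a : R[i]) x : nrm (a *: x) = `|a| * nrm x.
Proof.
apply/eqP; rewrite -(@eqrXn2 _ 2)// ?mulr_ge0// exprMn !nrmE normCK.
by rewrite dotZl dotZr mulrA.
Qed.

Let nrm0_eq0 x : nrm x = 0 -> x = 0.
Proof. by move=> n0; apply: dot_eq0; rewrite -nrmE n0 expr0n. Qed.

HB.instance Definition _ :=
  Lmodule_isNormed.Build R[i] V nrmD nrmZ nrm0_eq0.

Let dot_nrmE x : dot x x = `|x| ^+ 2. Proof. by rewrite -nrmE. Qed.

HB.instance Definition _ :=
  NormedModule_isInner.Build R V dotC dot_linearl dot_nrmE.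

HB.end.

Section inner_theory.
Variables (R : realType) (V : innerType R).
Implicit Types (x y z : V) (a : R[i]).

Lemma dotDl x y z : dot (x + y) z = dot x z + dot y z.
Proof. by rewrite -[x]scale1r dot_linearl mul1r scale1r. Qed.

Lemma dot0l z : dot 0 z = 0 :> R[i].
Proof. by apply: (addrI (dot 0 z)); rewrite -dotDl !addr0. Qed.

Lemma dotZl a x z : dot (a *: x) z = a * dot x z.
Proof. by rewrite -[_ *: x]addr0 dot_linearl dot0l addr0. Qed.

Lemma dotDr x y z : dot z (x + y) = dot z x + dot z y.
Proof. by rewrite dotC dotDl rmorphD /= -!dotC. Qed.

Lemma dotZr a x z : dot z (a *: x) = Num.conj a * dot z x.
Proof. by rewrite dotC dotZl rmorphM /= -!dotC. Qed.

End inner_theory.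

Section bounded_operators.
Variables (R : realType) (V : innerType R).

Definition bounded_operator : {pred V -> V} :=
  [pred T | `[< linear T /\
                exists M : R, forall x, `|T x| <= M%:C * `|x| >]].

Lemma bounded_operatorP (T : V -> V) :
  reflect (linear T /\ exists M : R, forall x, `|T x| <= M%:C * `|x|)
          (T \in bounded_operator).
Proof. exact: (iffP (asboolP _)). Qed.

Lemma bounded_operator_submod : submod_closed bounded_operator.
Proof.
split=> [|a S T /bounded_operatorP[Sl [M SM]] /bounded_operatorP[Tl [N TN]]].
  apply/bounded_operatorP; split=> [b x y|].
    by rewrite /= scaler0 addr0.
  by exists 0 => x; rewrite /= normr0 mul0r.
apply/bounded_operatorP; split=> [b x y|].
  rewrite -[LHS]/(a *: S _ + T _) -[RHS]/(b *: (a *: S _ + T _) + (a *: S _ + T _)).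
  by rewrite Sl Tl !scalerDr !scalerA [b * a]mulrC addrACA.
exists (complex.Re `|a| * M + N) => x; rewrite -[X in `|X|]/(a *: S x + T x).
rewrite rmorphD rmorphM mulrDl.
rewrite (le_trans (ler_normD _ _))// lerD// normrZ -mulrA.
exact: ler_wpM2l.
Qed.

HB.instance Definition _ :=
  GRing.isSubmodClosed.Build _ _ bounded_operator bounded_operator_submod.

Record op := Op { op_fun :> V -> V ; _ : op_fun \in bounded_operator }.

HB.instance Definition _ := [isSub for op_fun].
HB.instance Definition _ := [Choice of op by <:].
HB.instance Definition _ := [SubChoice_isSubLmodule of op by <:].
HB.instance Definition _ := isPointed.Build op 0.

Lemma op_linear (T : op) : linear T.
Proof. by case: T => T /= /bounded_operatorP[]. Qed.

Lemma op_bounded (T : op) : exists M : R, forall x, `|T x| <= M%:C * `|x|.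
Proof. by case: T => T /= /bounded_operatorP[]. Qed.

HB.instance Definition _ (T : op) := GRing.isLinear.Build _ _ _ _ T (op_linear T).

Lemma op_ext (S T : op) : S =1 T -> S = T.
Proof. by move=> ST; apply/val_inj/funext. Qed.

Lemma op_id_subproof : idfun \in bounded_operator.
Proof. by apply/bounded_operatorP; split=> //; exists 1 => x; rewrite mul1r. Qed.

Lemma op_comp_subproof (S T : op) : S \o T \in bounded_operator.
Proof.
apply/bounded_operatorP; split=> [b x y|]; first by rewrite /= !linearP.
have [M SM] := op_bounded S; have [N TN] := op_bounded T.
exists (`|M| * N) => x /=; rewrite (le_trans (SM _))//.
rewrite (@le_trans _ _ (`|M|%:C * `|T x|))//.
  by rewrite ler_wpM2r// lecR ler_norm.
by rewrite rmorphM -mulrA ler_wpM2l// lecR.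
Qed.

Definition op_id := Op op_id_subproof.
Definition op_comp (S T : op) := Op (op_comp_subproof S T).

Let compA : associative op_comp. Proof. by move=> S T U; exact/op_ext. Qed.
Let comp1l : left_id op_id op_comp. Proof. by move=> S; exact/op_ext. Qed.
Let comp1r : right_id op_id op_comp. Proof. by move=> S; exact/op_ext. Qed.
Let compDl : left_distributive op_comp +%R.
Proof. by move=> S T U; exact/op_ext. Qed.
Let compDr : right_distributive op_comp +%R.
Proof. by move=> S T U; apply/op_ext => x; rewrite /= linearD. Qed.

HB.instance Definition _ :=
  GRing.Zmodule_isPzRing.Build op compA comp1l comp1r compDl compDr.

Lemma op_oneE x : (1 : op) x = x. Proof. by []. Qed.
Lemma op_mulE (S T : op) x : (S * T) x = S (T x). Proof. by []. Qed.
Lemma op_addE (S T : op) x : (S + T) x = S x + T x. Proof. by []. Qed.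
Lemma op_scaleE (a : R[i]) (T : op) x : (a *: T) x = a *: T x. Proof. by []. Qed.

End bounded_operators.

(* The weakest topology on [E] making every functional in [D] continuous. *)
Definition sigma_topology (R : realType) (E : choiceType)
    (D : set (E -> R[i])) : Type :=
  initial_topology (fun x : E => (fun f : D => val f x) : {ptws D -> R[i]^o}).

HB.instance Definition _ (R : realType) (E : choiceType) (D : set (E -> R[i])) :=
  Topological.on (sigma_topology D).
HB.instance Definition _ (R : realType) (E : pointedType) (D : set (E -> R[i])) :=
  Pointed.on (sigma_topology D).

Definition wot (R : realType) (V : innerType R) : topologicalType :=
  sigma_topology [set f : op V -> R[i] |
                   exists x y : V, f = (fun T : op V => dot (T x) y)].

Section orthogonal_complement.
Variables (R : realType) (V : innerType R) (A : set V).

Definition orthocomp : {pred V} :=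
  [pred x | `[< forall y, A y -> dot x y = 0 >]].

Lemma orthocompP x :
  reflect (forall y, A y -> dot x y = 0) (x \in orthocomp).
Proof. exact: asboolP. Qed.

Lemma orthocomp_submod : submod_closed orthocomp.
Proof.
split=> [|a x y /orthocompP xA /orthocompP yA].
  by apply/orthocompP => y _; rewrite dot0l.
by apply/orthocompP => z Az; rewrite dot_linearl xA// yA// mulr0 addr0.
Qed.

HB.instance Definition _ :=
  GRing.isSubmodClosed.Build _ _ orthocomp orthocomp_submod.

Record perp := Perp { perp_val :> V ; _ : perp_val \in orthocomp }.

HB.instance Definition _ := [isSub for perp_val].
HB.instance Definition _ := [Choice of perp by <:].
HB.instance Definition _ := [SubChoice_isSubLmodule of perp by <:].

Let perp_dot (x y : perp) := dot (val x) (val y).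
Let perp_dotC x y : perp_dot x y = Num.conj (perp_dot y x).
Proof. exact: dotC. Qed.
Let perp_dot_linearl a x y z :
  perp_dot (a *: x + y) z = a * perp_dot x z + perp_dot y z.
Proof. exact: dot_linearl. Qed.
Let perp_dot_ge0 x : 0 <= perp_dot x x.
Proof. by rewrite /perp_dot dot_normE exprn_ge0. Qed.
Let perp_dot_eq0 x : perp_dot x x = 0 -> x = 0.
Proof.
move=> /eqP; rewrite /perp_dot dot_normE sqrf_eq0 normr_eq0 => /eqP x0.
exact: val_inj.
Qed.

HB.instance Definition _ := Lmodule_isInner.Build R perp
  perp_dotC perp_dot_linearl perp_dot_ge0 perp_dot_eq0.

End orthogonal_complement.

(* The orthogonal projection onto [N], by its defining property.  The default
   value 0 is irrelevant: it is only used for orthogonal complements in a space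
   of square-summable functions, where the projection exists and is unique. *)
Definition orthoproj (R : realType) (V : innerType R) (N : {pred V}) (x : V) : V :=
  xget 0 [set y | y \in N /\ forall z, z \in N -> dot (x - y) z = 0].

Section unordered_sums.
Variables (R : realType) (X : choiceType).

Definition nrm (z : R[i]) : R := complex.Re `|z|.

Lemma nrmE (z : R[i]) : (nrm z)%:C = `|z|.
Proof. by rewrite RRe_real// normr_real. Qed.

Lemma nrm_ge0 z : 0 <= nrm z. Proof. rewrite -lecR nrmE; exact: normr_ge0. Qed.

Lemma nrm0 : nrm 0 = 0. Proof. by rewrite /nrm normr0. Qed.

Lemma nrmD y z : nrm (y + z) <= nrm y + nrm z.
Proof. by rewrite -lecR rmorphD/= !nrmE ler_normD. Qed.

Lemma nrmM y z : nrm (y * z) = nrm y * nrm z.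
Proof. by apply/complexI; rewrite rmorphM/= !nrmE normrM. Qed.

Lemma nrmJ z : nrm (Num.conj z) = nrm z.
Proof. by apply/complexI; rewrite !nrmE norm_conjC. Qed.

Lemma Re_le_nrm z : `|complex.Re z| <= nrm z.
Proof. by rewrite -lecR nrmE normc_ge_Re. Qed.

Lemma Im_le_nrm z : `|complex.Im z| <= nrm z.
Proof.
have := Re_le_nrm (z * 'i); rewrite ReiNIm normrN nrmM.
suff -> : nrm 'i = 1 by rewrite mulr1.
by rewrite /nrm normc_def /= expr0n expr1n add0r sqrtr1.
Qed.

(* Unordered sum of an absolutely summable family. *)
Definition rsum (f : X -> R) : R :=
  fine (\esum_(x in setT) (EFin \o f)^\+ x - \esum_(x in setT) (EFin \o f)^\- x).

Definition csum (f : X -> R[i]) : R[i] :=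
  rsum (fun x => complex.Re (f x)) +i* rsum (fun x => complex.Im (f x)).

Definition csummable (f : X -> R[i]) :=
  summable setT (fun x => (nrm (f x))%:E).

Let rsummable (f : X -> R) := summable setT (EFin \o f).

Lemma le_summable (f g : X -> R) :
  (forall x, `|f x| <= `|g x|) -> rsummable g -> rsummable f.
Proof.
move=> fg; rewrite /rsummable /summable; apply: le_lt_trans.
by apply: le_esum => x _ /=; rewrite lee_fin.
Qed.

Lemma rsumB (g h : X -> R) : (forall x, 0 <= g x) -> (forall x, 0 <= h x) ->
  rsummable g -> rsummable h ->
  rsum (fun x => g x - h x) =
  fine (\esum_(x in setT) (g x)%:E) - fine (\esum_(x in setT) (h x)%:E).
Proof.
move=> g0 h0 sg sh; rewrite /rsum.
have := @esumB R X setT (EFin \o g) (EFin \o h) sg sh.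
move=> -> //=; try by move=> *; rewrite lee_fin.
rewrite fineB//.
- by move: sg; rewrite /rsummable summableE; under eq_esum do rewrite /= ger0_norm//.
- by move: sh; rewrite /rsummable summableE; under eq_esum do rewrite /= ger0_norm//.
Qed.

Lemma rsummableD (f g : X -> R) : rsummable f -> rsummable g ->
  rsummable (fun x => f x + g x).
Proof. exact: summableD. Qed.

Lemma rsummableN (f : X -> R) : rsummable f -> rsummable (fun x => - f x).
Proof. by rewrite /rsummable (summableN setT (EFin \o f)). Qed.

Lemma esumZ_ge0 (r : R) (f : X -> R) : 0 <= r -> (forall x, 0 <= f x) ->
  \esum_(x in setT) (r * f x)%:E = (r%:E * \esum_(x in setT) (f x)%:E)%E.
Proof.
move=> r0 f0; rewrite /esum -ereal_supZl//; last first.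
  by apply/set0P; exists 0%E, set0 => //; rewrite fsbig_set0.
congr ereal_sup; rewrite image_comp; apply: eq_imagel => A [finA _] /=.
by rewrite ge0_mule_fsumr// => x; rewrite lee_fin.
Qed.

Lemma rsummableZ (r : R) (f : X -> R) : rsummable f ->
  rsummable (fun x => r * f x).
Proof.
rewrite /rsummable /summable => sf.
under eq_esum do rewrite /= normrM.
by rewrite esumZ_ge0// lte_mul_pinfty.
Qed.

Let esum_fin (g : X -> R) : (forall x, 0 <= g x) -> rsummable g ->
  \esum_(x in setT) (g x)%:E \is a fin_num.
Proof.
move=> g0; rewrite /rsummable summableE; under eq_esum do rewrite /= ger0_norm//.
by [].
Qed.

Let pos (f : X -> R) x := Num.max (f x) 0.
Let neg (f : X -> R) x := Num.max (- f x) 0.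
Let posneg f x : f x = pos f x - neg f x.
Proof.
rewrite /pos /neg; have [f0|f0] := leP (f x) 0.
  by rewrite max_l ?oppr_ge0// sub0r opprK.
by rewrite max_r ?subr0// oppr_le0 ltW.
Qed.
Let pos_ge0 f x : 0 <= pos f x. Proof. by rewrite le_max lexx orbT. Qed.
Let neg_ge0 f x : 0 <= neg f x. Proof. by rewrite le_max lexx orbT. Qed.
Let pos_sum f : rsummable f -> rsummable (pos f).
Proof.
apply: le_summable => x.
by rewrite ger0_norm// ge_max normr_ge0 ler_norm.
Qed.
Let neg_sum f : rsummable f -> rsummable (neg f).
Proof.
apply: le_summable => x.
by rewrite ger0_norm// ge_max normr_ge0 -normrN ler_norm.
Qed.

Let rsumE f : rsummable f ->
  rsum f = fine (\esum_(x in setT) (pos f x)%:E) - fine (\esum_(x in setT) (neg f x)%:E).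
Proof.
move=> sf; rewrite -rsumB; [|exact: pos_ge0|exact: neg_ge0|exact: pos_sum|exact: neg_sum].
by congr rsum; apply/funext => x; exact: posneg.
Qed.

Let fine_esumD (g h : X -> R) : (forall x, 0 <= g x) -> (forall x, 0 <= h x) ->
  rsummable g -> rsummable h ->
  fine (\esum_(x in setT) (g x + h x)%:E) =
  fine (\esum_(x in setT) (g x)%:E) + fine (\esum_(x in setT) (h x)%:E).
Proof.
move=> g0 h0 sg sh; rewrite -fineD ?esum_fin//; congr fine.
by under eq_esum do rewrite EFinD; rewrite esumD// => x _; rewrite lee_fin.
Qed.

Lemma rsumD (f g : X -> R) : rsummable f -> rsummable g ->
  rsum (fun x => f x + g x) = rsum f + rsum g.
Proof.
move=> sf sg.
have -> : (fun x => f x + g x) =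
          (fun x => (pos f x + pos g x) - (neg f x + neg g x)).
  by apply/funext => x; rewrite {1}(posneg f) {1}(posneg g) opprD addrACA.
have pf := pos_sum sf; have nf := neg_sum sf.
have pg := pos_sum sg; have ng := neg_sum sg.
rewrite rsumB; [|by move=> x; rewrite addr_ge0|by move=> x; rewrite addr_ge0
                |exact: rsummableD|exact: rsummableD].
rewrite (fine_esumD (pos_ge0 f) (pos_ge0 g) pf pg).
rewrite (fine_esumD (neg_ge0 f) (neg_ge0 g) nf ng).
by rewrite (rsumE sf) (rsumE sg) opprD addrACA.
Qed.

Lemma rsumN (f : X -> R) : rsummable f -> rsum (fun x => - f x) = - rsum f.
Proof.
move=> sf; have -> : (fun x => - f x) = (fun x => neg f x - pos f x).
  by apply/funext => x; rewrite {1}(posneg f) opprB.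
have pf := pos_sum sf; have nf := neg_sum sf.
by rewrite rsumB// (rsumE sf) opprB.
Qed.

Lemma rsumZ (r : R) (f : X -> R) : rsummable f ->
  rsum (fun x => r * f x) = r * rsum f.
Proof.
suff rsumpZ : forall s g, 0 <= s -> rsummable g ->
    rsum (fun x => s * g x) = s * rsum g.
  move=> sf; have [r0|/ltW r0] := leP 0 r; first exact: rsumpZ.
  rewrite -[r in RHS]opprK mulNr -rsumpZ ?oppr_ge0// -rsumN; last exact: rsummableZ.
  by congr rsum; apply/funext => x; rewrite mulNr opprK.
move=> s g s0 sg.
have -> : (fun x => s * g x) = (fun x => s * pos g x - s * neg g x).
  by apply/funext => x; rewrite {1}(posneg g) mulrBr.
have pg := pos_sum sg; have ng := neg_sum sg.
rewrite rsumB; [|by move=> x; rewrite mulr_ge0|by move=> x; rewrite mulr_ge0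
                |exact: rsummableZ|exact: rsummableZ].
by rewrite !esumZ_ge0// !fineM ?esum_fin// (rsumE sg) mulrBr.
Qed.

Lemma rsum_ge0E (f : X -> R) : (forall x, 0 <= f x) -> rsummable f ->
  rsum f = fine (\esum_(x in setT) (f x)%:E).
Proof.
move=> f0 sf; have sz : rsummable (fun=> 0).
  by apply: le_summable sf => x; rewrite normr0.
rewrite -[RHS]subr0 -[X in _ - X](_ : fine (\esum_(x in [set: X]) 0%:E) = 0); last first.
  by rewrite esum1.
by rewrite -(rsumB f0 _ sf sz)//; congr rsum; apply/funext => x; rewrite subr0.
Qed.

Lemma csummable_Re f : csummable f -> rsummable (fun x => complex.Re (f x)).
Proof. by apply: le_summable => x; rewrite (ger0_norm (nrm_ge0 _)) Re_le_nrm. Qed.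

Lemma csummable_Im f : csummable f -> rsummable (fun x => complex.Im (f x)).
Proof. by apply: le_summable => x; rewrite (ger0_norm (nrm_ge0 _)) Im_le_nrm. Qed.

Lemma csumD f g : csummable f -> csummable g ->
  csum (fun x => f x + g x) = csum f + csum g.
Proof.
move=> sf sg; rewrite /csum -[RHS]/(_ +i* _); congr (_ +i* _).
  rewrite -(rsumD (csummable_Re sf) (csummable_Re sg)).
  by congr rsum; apply/funext => x; rewrite raddfD.
rewrite -(rsumD (csummable_Im sf) (csummable_Im sg)).
by congr rsum; apply/funext => x; rewrite raddfD.
Qed.

Lemma csumZ a f : csummable f -> csum (fun x => a * f x) = a * csum f.
Proof.
move=> sf; have sr := csummable_Re sf; have si := csummable_Im sf.
case: a => a b; rewrite /csum -[RHS]/(_ +i* _); congr (_ +i* _).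
  have sa := rsummableZ a sr; have sb := rsummableZ b si.
  rewrite -(rsumZ a sr) -(rsumZ b si) -(rsumN sb) -(rsumD sa (rsummableN sb)).
  by congr rsum; apply/funext => x; case: (f x).
rewrite -(rsumZ a si) -(rsumZ b sr) -(rsumD (rsummableZ a si) (rsummableZ b sr)).
by congr rsum; apply/funext => x; case: (f x).
Qed.

Lemma csumJ f : csummable f ->
  csum (fun x => Num.conj (f x)) = Num.conj (csum f).
Proof.
move=> sf; have sr := csummable_Re sf; have si := csummable_Im sf.
rewrite /csum -[RHS]/(_ -i* _); congr (_ +i* _).
  by congr rsum; apply/funext => x; case: (f x).
rewrite -rsumN//.
by congr rsum; apply/funext => x; case: (f x).
Qed.

End unordered_sums.

Section l2.
Variables (R : realType) (X : choiceType).

Definition square_summable : {pred X -> R[i]} :=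
  [pred f | (\esum_(x in [set: X]) (nrm (f x) ^+ 2)%:E < +oo)%E].

Lemma square_summableE (f : X -> R[i]) :
  (f \in square_summable) = summable setT (fun x => (nrm (f x) ^+ 2)%:E).
Proof.
rewrite inE /= /summable; congr (_ < _)%E.
by apply: eq_esum => x _; rewrite /= ger0_norm// sqr_ge0.
Qed.

Lemma square_summableM f g : f \in square_summable -> g \in square_summable ->
  csummable (fun x => f x * Num.conj (g x)).
Proof.
rewrite !square_summableE => sf sg.
apply: (@le_summable R X _ (fun x => nrm (f x) ^+ 2 + nrm (g x) ^+ 2)).
  move=> x; rewrite nrmM nrmJ !ger0_norm ?mulr_ge0 ?addr_ge0 ?sqr_ge0 ?nrm_ge0//.
  have := sqr_ge0 (nrm (f x) - nrm (g x)).
  rewrite sqrrB addrAC subr_ge0; apply: le_trans.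
  by rewrite mulr2n lerDl mulr_ge0 ?nrm_ge0.
exact: rsummableD.
Qed.

Lemma square_summable_submod : submod_closed square_summable.
Proof.
split=> [|a f g].
  rewrite inE /= esum1// => x _.
  by rewrite -[X in nrm X]/(0 : R[i]) nrm0 expr0n.
rewrite !square_summableE => sf sg.
apply: (@le_summable R X _
  (fun x => 2 * (nrm a ^+ 2 * nrm (f x) ^+ 2) + 2 * nrm (g x) ^+ 2)).
  move=> x; rewrite !ger0_norm ?addr_ge0 ?mulr_ge0 ?nrm_ge0//.
  rewrite -[X in nrm X]/(a * f x + g x).
  rewrite (@le_trans _ _ ((nrm a * nrm (f x) + nrm (g x)) ^+ 2))//.
    by rewrite ler_pXn2r ?nnegrE ?addr_ge0 ?mulr_ge0 ?nrm_ge0// -nrmM nrmD.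
  set u := nrm a; set v := nrm (f x); set w := nrm (g x).
  have := sqr_ge0 (u * v - w).
  rewrite -subr_ge0 => h; rewrite -subr_ge0.
  by rewrite (_ : _ - _ = (u * v - w) ^+ 2); [exact: sqr_ge0|ring].
exact: (rsummableD (rsummableZ 2 (rsummableZ (nrm a ^+ 2) sf)) (rsummableZ 2 sg)).
Qed.

HB.instance Definition _ :=
  GRing.isSubmodClosed.Build _ _ square_summable square_summable_submod.

Record l2 := L2 { l2_fun :> X -> R[i] ; _ : l2_fun \in square_summable }.

HB.instance Definition _ := [isSub for l2_fun].
HB.instance Definition _ := [Choice of l2 by <:].
HB.instance Definition _ := [SubChoice_isSubLmodule of l2 by <:].

Definition l2_dot (f g : l2) : R[i] := csum (fun x => f x * Num.conj (g x)).

Let l2_summable (f g : l2) : csummable (fun x => f x * Num.conj (g x)).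
Proof. by apply: square_summableM; exact: valP. Qed.

Let l2_dotC f g : l2_dot f g = Num.conj (l2_dot g f).
Proof.
rewrite /l2_dot -csumJ//; congr csum; apply/funext => x.
by rewrite rmorphM /= conjCK mulrC.
Qed.

Let l2_dot_linearl a f g h : l2_dot (a *: f + g) h = a * l2_dot f h + l2_dot g h.
Proof.
rewrite /l2_dot -csumZ// -csumD//; last first.
  have := l2_summable (a *: f) h; rewrite /csummable.
  by congr summable; apply/funext => x; rewrite -mulrA.
by congr csum; apply/funext => x; rewrite mulrA -mulrDl.
Qed.

Lemma l2_dotE f : l2_dot f f =
  (fine (\esum_(x in [set: X]) (nrm (f x) ^+ 2)%:E))%:C.
Proof.
have E x : f x * Num.conj (f x) = (nrm (f x) ^+ 2)%:C.
  by rewrite -normCK -nrmE rmorphXn.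
rewrite /l2_dot /csum; congr (_ +i* _).
  rewrite -rsum_ge0E; last 2 first.
  - by move=> x; exact: sqr_ge0.
  - by rewrite -square_summableE; exact: valP.
  by congr rsum; apply/funext => x; rewrite E.
rewrite (_ : (fun x => _) = (fun=> 0)); last by apply/funext => x; rewrite E.
rewrite rsum_ge0E//; first by rewrite esum1.
by rewrite /summable esum1// => x _; rewrite /= normr0.
Qed.

Let l2_dot_ge0 f : 0 <= l2_dot f f.
Proof.
rewrite l2_dotE lecR fine_ge0// esum_ge0// => x _.
by rewrite lee_fin sqr_ge0.
Qed.

Let l2_dot_eq0 f : l2_dot f f = 0 -> f = 0.
Proof.
rewrite l2_dotE => -[] f0; apply/val_inj/funext => x /=.
have sf : (\esum_(x in [set: X]) (nrm (f x) ^+ 2)%:E < +oo)%E by exact: (valP f).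
have f0' : (\esum_(x in [set: X]) (nrm (f x) ^+ 2)%:E = 0)%E.
  rewrite -[LHS]fineK ?f0// ge0_fin_numE//.
  by apply: esum_ge0 => y _; rewrite lee_fin sqr_ge0.
have : ((nrm (f x) ^+ 2)%:E <= 0)%E.
  rewrite -f0'; rewrite -(@esum_set1 R X x (fun x => (nrm (f x) ^+ 2)%:E)).
    by apply: esum_ge; exists [set x]; rewrite ?esum_set1 ?fsbig_set1 ?lee_fin ?sqr_ge0//.
  by rewrite lee_fin sqr_ge0.
rewrite lee_fin => h; have := sqr_ge0 (nrm (f x)) => h'.
have /eqP : nrm (f x) ^+ 2 = 0 by apply/eqP; rewrite eq_le h h'.
rewrite sqrf_eq0 => /eqP n0; apply/eqP; rewrite -normr_eq0 -nrmE n0//.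
Qed.

HB.instance Definition _ :=
  Lmodule_isInner.Build R l2 l2_dotC l2_dot_linearl l2_dot_ge0 l2_dot_eq0.

End l2.

Section l2_basis.
Variables (R : realType) (X : choiceType).

Lemma l2_normE (f : l2 R X) :
  `|f| ^+ 2 = (fine (\esum_(x in [set: X]) (nrm (f x) ^+ 2)%:E))%:C.
Proof. by rewrite -dot_normE; exact: l2_dotE. Qed.

Lemma l2_basis_subproof (w : X) :
  (fun x => (x == w)%:R) \in @square_summable R X.
Proof.
rewrite inE /=; rewrite (_ : esum _ _ = 1%E) ?ltry//.
rewrite -[RHS](@esum_set1 R X w (fun=> 1%E))// [RHS]esum_mkcond.
apply: eq_esum => x _; rewrite classical_sets.in_set1.
case: eqP => _ /=; last by rewrite nrm0 expr0n.
by rewrite /nrm normr1 expr1n.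
Qed.

Definition l2_basis (w : X) : l2 R X := L2 (l2_basis_subproof w).

(* [P] is the positive square root |T| of T^* T, and |T| has finite trace. *)
Definition trace_class (T : op (l2 R X)) : Prop :=
  exists P : op (l2 R X),
    [/\ forall x, 0 <= dot (P x) x,
        forall x y, dot (P (P x)) y = dot (T x) (T y) &
        (\esum_(w in [set: X])
           (complex.Re (dot (P (l2_basis w)) (l2_basis w)))%:E < +oo)%E].

Definition op_trace (T : op (l2 R X)) : R[i] :=
  csum (fun w => dot (T (l2_basis w)) (l2_basis w)).

End l2_basis.

Section fock.
Variables (R : realType) (I : choiceType).

(* If (e_i)_(i : I) is an orthonormal basis of H, the elementary tensors
   e_(i_1) (x) ... (x) e_(i_k) form one of the k-th Hilbert tensor power of H,
   so that the words over I index an orthonormal basis of the full Fock space;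
   the empty word is the vacuum vector. *)
Definition fock : innerType R := l2 R (seq I).

Section creation.
Variable i : I.

Let shift (psi : seq I -> R[i]) (w : seq I) : R[i] :=
  if w is j :: v then (j == i)%:R * psi v else 0.

Let esum_shift psi :
  \esum_(w in [set: seq I]) (nrm (shift psi w) ^+ 2)%:E =
  \esum_(w in [set: seq I]) (nrm (psi w) ^+ 2)%:E.
Proof.
have nrm0 : nrm (0 : R[i]) = 0 by rewrite /nrm normr0.
transitivity (\esum_(w in [set i :: v | v in [set: seq I]])
                 (nrm (shift psi w) ^+ 2)%:E).
  rewrite [RHS]esum_mkcond; apply: eq_esum => w _.
  case: ifPn => //; rewrite notin_setE; case: w => [|j v] /=.
    by rewrite nrm0 expr0n.
  case: eqP => [-> []|_ _]; first by exists v.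
  by rewrite mul0r nrm0 expr0n.
rewrite esum_image; last by move=> v w _ _ [].
by apply: eq_esum => v _; rewrite /= eqxx mul1r.
Qed.

Let shift_in (psi : fock) : shift psi \in @square_summable R (seq I).
Proof. by rewrite inE /= esum_shift; exact: (valP psi). Qed.

Let creation_fun (psi : fock) : fock := L2 (shift_in psi).

Let creation_bounded : creation_fun \in @bounded_operator R fock.
Proof.
apply/bounded_operatorP; split=> [a x y|].
  apply/val_inj/funext => -[|j v].
    by rewrite -[RHS]/(a * 0 + 0) mulr0 addr0.
  rewrite -[LHS]/(_ * (a * x v + y v)) -[RHS]/(a * (_ * x v) + _ * y v).
  by rewrite mulrDr mulrCA.
exists 1 => x; rewrite mul1r -(@ler_pXn2r _ 2) ?nnegrE//.
by rewrite !l2_normE esum_shift.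
Qed.

(* psi |-> e_i (x) psi *)
Definition creation : op fock := Op creation_bounded.

Lemma creationE (psi : fock) (w : seq I) : (creation psi : fock) w =
  if w is j :: v then (j == i)%:R * (psi : fock) v else 0.
Proof. by []. Qed.

End creation.
End fock.
Arguments creation {R I} i.

(* The operator norm of T on the Hilbert sum of k copies of V. *)
Definition mxnorm (R : realType) (V : innerType R) k (T : 'M[op V]_k) : R :=
  let norm (x : 'I_k -> V) := Num.sqrt (\sum_j complex.Re `|x j| ^+ 2) in
  sup [set norm (fun i => \sum_j T i j (x j)) | x in
        [set x : 'I_k -> V | norm x <= 1]].

Section analytic_toeplitz.
Variables (R : realType) (I : choiceType).
Local Notation F2 := (fock R I).

Definition subalgebra (V : innerType R) (A : set (op V)) : Prop :=
  [/\ A 1,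
      forall (a : R[i]) S T, A S -> A T -> A (a *: S + T) &
      forall S T, A S -> A T -> A (S * T)].

(* The WOT-closed subalgebra generated by the identity and the creation
   operators. *)
Definition in_Finf : {pred op F2} :=
  [pred T | `[< forall A : set (op F2), subalgebra A ->
                closed (A : set (wot F2)) ->
                (forall i, A (creation i)) -> A T >]].

Lemma in_FinfP (T : op F2) :
  reflect (forall A : set (op F2), subalgebra A -> closed (A : set (wot F2)) ->
             (forall i, A (creation i)) -> A T) (T \in in_Finf).
Proof. exact: asboolP. Qed.

Lemma in_Finf_linear : submod_closed in_Finf.
Proof.
split=> [|a S T /in_FinfP SF /in_FinfP TF].
  apply/in_FinfP => A [A1 AZ AM] _ _.
  by have := AZ (-1) _ _ A1 A1; rewrite scaleN1r addNr.
apply/in_FinfP => A Aalg Acl AS; have [_ AZ _] := Aalg.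
by apply: AZ; [exact: SF|exact: TF].
Qed.

Lemma in_Finf_mul : mulr_closed in_Finf.
Proof.
split=> [|S T /in_FinfP SF /in_FinfP TF].
  by apply/in_FinfP => A [].
apply/in_FinfP => A Aalg Acl AS; have [_ _ AM] := Aalg.
by apply: AM; [exact: SF|exact: TF].
Qed.

HB.instance Definition _ := GRing.isSubmodClosed.Build _ _ in_Finf in_Finf_linear.
HB.instance Definition _ := GRing.isMulClosed.Build _ in_Finf in_Finf_mul.

Record Finf := MkFinf { Finf_val :> op F2 ; _ : Finf_val \in in_Finf }.

HB.instance Definition _ := [isSub for Finf_val].
HB.instance Definition _ := [Choice of Finf by <:].
HB.instance Definition _ := [SubChoice_isSubLmodule of Finf by <:].
HB.instance Definition _ :=
  GRing.SubZmodule_isSubPzRing.Build _ _ Finf (subringClosedP _).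

(* The functionals induced on Finf by the trace duality B(F2) = c_1(F2)^*, so
   that Finf_wstar is the topology inherited from the w*-topology of B(F2). *)
Definition predual : set (Finf -> R[i]) :=
  [set f | exists2 T : op F2, trace_class T &
             f = (fun phi : Finf => op_trace (val phi * T))].

Definition Finf_wstar : topologicalType := sigma_topology predual.

(* To be used for a [J] closed under addition and opposite; stability under
   scalars follows, as the scalar operators belong to Finf. *)
Definition two_sided_ideal (J : {pred Finf}) : Prop :=
  forall a phi : Finf, phi \in J -> (a * phi \in J) && (phi * a \in J).

End analytic_toeplitz.

Section quotient_algebra.
Variables (R : realType) (I : choiceType) (J : zmodClosed (Finf R I)).
Local Notation F2 := (fock R I).

Definition MJ : set F2 :=
  closure [set xi | exists2 phi : Finf R I, phi \in J &
                      exists psi : F2, xi = val phi psi].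

Definition NJ : innerType R := perp MJ.

(* [T] is the restriction of P_N phi to N, for N = NJ. *)
Definition is_compression (phi : op F2) (T : op NJ) : Prop :=
  forall x : NJ, val (T x) = orthoproj (orthocomp MJ) (phi (val x)).

Definition compressions : set (op NJ) :=
  [set T | exists phi : Finf R I, is_compression (val phi) T].

(* The quotient as an additive group; \pi is compatible with the scaling and
   the product of Finf as soon as [J] is a two-sided ideal. *)
Definition quotFinf : zmodType := Quotient.quot J.

Definition qpi (phi : Finf R I) : quotFinf := (\pi_(Quotient.quot J) phi)%qT.

Definition preannihilator : set (Finf R I -> R[i]) :=
  [set f | predual f /\ forall phi : Finf R I, phi \in J -> f phi = 0].

Definition quotient_wstar : topologicalType :=
  sigma_topology [set g : quotFinf -> R[i] |
                   exists2 f, preannihilator f & f = g \o qpi].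

(* The quotient norm of M_k(Finf) / M_k(J). *)
Definition quotient_mxnorm k (q : 'M[quotFinf]_k) : R :=
  inf [set mxnorm (map_mx val phi) | phi in
        [set phi : 'M[Finf R I]_k | map_mx qpi phi = q]].

End quotient_algebra.
Arguments compressions {R I} J _.

Definition homeomorphism_onto (S T : topologicalType) (f : S -> T) (B : set T) :=
  [/\ set_bij setT B f, continuous f &
      exists2 g : T -> S, cancel f g & {within B, continuous g}].

(* Main.v *)
(** Let [x] be a vector of an ampliation [F2 (x) l2] of the full Fock space.  As in
Beurling's theorem, the closed subspace spanned by the left multiples of [x] is
the range of an isometry [V] of [F2] that commutes with left multiplications, and
[x = V v] with [v] cyclic.  Hence [phi x = V (phi v)] for every [phi] in [Finf], and
what is obvious for cyclic vectors transfers to [x].  In this way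
- the commutant of the right creation operators is contained in [Finf];
- a w*-closed ideal [J] contains every [theta] with range in [MJ]: a trace class
  operator provides a vector [x] (through a Cholesky factorization of its modulus),
  and [theta v] is a limit of vectors [phi v] with [phi] in [J];
- a w*-continuous functional vanishing on [J] has the form
  [phi |-> <phi v, z> = <Psi phi (P_N v), z>] with [z] in [N], so that the topologies
  of the quotient and of its image are defined by the same functionals.
The matrix norms agree by commutant lifting: the adjoint of a compression, defined
on the coinvariant space [N^k], extends with the same norm to an operator that
commutes with the adjoints of the right creation operators; the adjoint of this
extension has its entries in [Finf] and differs from the given representative by
a matrix over [J]. *)

From HB Require Import structures.
Require Import Defs.
From mathcomp Require Import all_boot all_order all_algebra.
From mathcomp Require Import all_classical all_reals all_analysis.
From mathcomp Require Import complex.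
From mathcomp Require Import ring lra.

Set Implicit Arguments.
Unset Strict Implicit.
Unset Printing Implicit Defensive.

Import Order.TTheory GRing.Theory Num.Theory.
Import numFieldNormedType.Exports.

Local Open Scope classical_set_scope.
Local Open Scope ring_scope.
Local Open Scope complex_scope.

(** * Inner product spaces *)

(** Three obstacles shape the proof. A basic w*-neighbourhood involves finitely many trace class
    operators, each with infinitely many test vectors; all of these are packed into one vector of an
    ampliation, so that a single approximation at a single cyclic vector controls every functional
    at once. The intertwining behind this is algebra: elements of [Finf] act by left convolution of
    functions on words, the isometry [V] by right convolution, and each coefficient of a convolution
    is a finite sum, so that associativity involves no convergence. The modulus of a trace class
    operator T is given only as a positive P with P^2 = T^* T. Instead of diagonalizing P, Gaussian
    elimination along an enumeration of the words, which exists because the alphabet is countable,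
    writes T as a sum of rank one operators. Finally, the projection theorem and the one-step
    extension of commutant lifting are two instances of one lemma, which extends a contraction by
    one vector with respect to a real form that may be indefinite. Zorn's lemma takes care of the
    iteration of such steps. *)

Section inner_basics.
Variables (R : realType) (V : innerType R).
Implicit Types (x y z : V) (a : R[i]) (t : R).

Definition hn x : R := complex.Re `|x|.
Definition rdot x y : R := complex.Re (dot x y).

Lemma hnE x : (hn x)%:C = `|x|.
Proof. by rewrite /hn RRe_real// normr_real. Qed.

Lemma hn_ge0 x : 0 <= hn x. Proof. by rewrite -lecR hnE normr_ge0. Qed.

Lemma hn0 : hn 0 = 0. Proof. by rewrite /hn normr0. Qed.

Lemma hn_eq0 x : hn x = 0 -> x = 0.
Proof. by move=> x0; apply/eqP; rewrite -normr_eq0 -hnE x0. Qed.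

Lemma hnD x y : hn (x + y) <= hn x + hn y.
Proof. by rewrite -lecR rmorphD/= !hnE ler_normD. Qed.

Lemma hnN x : hn (- x) = hn x. Proof. by rewrite /hn normrN. Qed.

Lemma hnB x y : hn (x - y) = hn (y - x).
Proof. by rewrite -hnN opprB. Qed.

Lemma hnZ a x : hn (a *: x) = nrm a * hn x.
Proof. by apply/complexI; rewrite rmorphM/= !hnE nrmE normrZ. Qed.

Lemma nrm_real t : nrm t%:C = `|t|.
Proof. by rewrite /nrm normc_def /= expr0n addr0 sqrtr_sqr. Qed.

Lemma hn_sqr x : hn x ^+ 2 = rdot x x.
Proof. by rewrite /rdot dot_normE -hnE -rmorphXn. Qed.

Lemma dot_hn x : dot x x = (hn x ^+ 2)%:C.
Proof. by rewrite dot_normE -hnE rmorphXn. Qed.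

Lemma dot0r x : dot x 0 = 0 :> R[i].
Proof. by rewrite dotC dot0l rmorph0. Qed.

Lemma dotNl x y : dot (- x) y = - dot x y.
Proof. by rewrite -scaleN1r dotZl mulN1r. Qed.

Lemma dotNr x y : dot x (- y) = - dot x y.
Proof. by rewrite dotC dotNl rmorphN /= -dotC. Qed.

Lemma dotBl x y z : dot (x - y) z = dot x z - dot y z.
Proof. by rewrite dotDl dotNl. Qed.

Lemma dotBr x y z : dot z (x - y) = dot z x - dot z y.
Proof. by rewrite dotDr dotNr. Qed.

Lemma rdotC x y : rdot x y = rdot y x.
Proof. by rewrite /rdot dotC; case: (dot y x). Qed.

Lemma rdotDl x y z : rdot (x + y) z = rdot x z + rdot y z.
Proof. by rewrite /rdot dotDl raddfD. Qed.

Lemma rdotZl t x z : rdot (t%:C *: x) z = t * rdot x z.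
Proof. by rewrite /rdot dotZl; case: (dot x z) => u v; rewrite /= mul0r subr0. Qed.

Lemma rdotDr x y z : rdot z (x + y) = rdot z x + rdot z y.
Proof. by rewrite ![rdot z _]rdotC rdotDl. Qed.

Lemma rdotZr t x z : rdot z (t%:C *: x) = t * rdot z x.
Proof. by rewrite ![rdot z _]rdotC rdotZl. Qed.

Lemma rdotNl x z : rdot (- x) z = - rdot x z.
Proof. by rewrite /rdot dotNl raddfN. Qed.

Lemma rdotNr x z : rdot z (- x) = - rdot z x.
Proof. by rewrite ![rdot z _]rdotC rdotNl. Qed.

Lemma rdotBl x y z : rdot (x - y) z = rdot x z - rdot y z.
Proof. by rewrite rdotDl rdotNl. Qed.

Lemma rdotBr x y z : rdot z (x - y) = rdot z x - rdot z y.
Proof. by rewrite rdotDr rdotNr. Qed.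

Lemma dot_eq0_pythag x y : dot x y = 0 ->
  hn (x + y) ^+ 2 = hn x ^+ 2 + hn y ^+ 2.
Proof.
move=> xy; rewrite !hn_sqr rdotDl !rdotDr [rdot y x]rdotC.
by rewrite /rdot xy /= addr0 add0r.
Qed.

Lemma rdot_CS x y : rdot x y <= hn x * hn y.
Proof.
have [y0|y0] := eqVneq (hn y) 0.
  by rewrite (hn_eq0 y0) hn0 mulr0 /rdot dot0r.
have yp : 0 < hn y by rewrite lt_def y0 hn_ge0.
have [x0|x0] := eqVneq (hn x) 0.
  by rewrite (hn_eq0 x0) hn0 mul0r /rdot dot0l.
have xp : 0 < hn x by rewrite lt_def x0 hn_ge0.
have := sqr_ge0 (hn ((hn y)%:C *: x - (hn x)%:C *: y)).
rewrite hn_sqr rdotBl !rdotBr !rdotZl !rdotZr -!hn_sqr [rdot y x]rdotC => h.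
have : 0 <= 2 * (hn x * hn y) * (hn x * hn y - rdot x y) by apply: le_trans h _; nra.
by rewrite pmulr_rge0 ?subr_ge0// !mulr_gt0.
Qed.

Lemma nrm_dot x y : nrm (dot x y) <= hn x * hn y.
Proof.
have [d0|d0] := eqVneq (dot x y) 0.
  by rewrite d0 nrm0 mulr_ge0 ?hn_ge0.
have n0 : `|dot x y| != 0 by rewrite normr_eq0.
pose a : R[i] := Num.conj (dot x y) / `|dot x y|.
have na : nrm a = 1.
  by apply: complexI; rewrite nrmE /a normrM normfV norm_conjC normr_id divff.
have := rdot_CS (a *: x) y; rewrite hnZ na mul1r; apply: le_trans.
rewrite /rdot dotZl /a mulrAC [Num.conj _ * _]mulrC -normCK expr2 mulfK//.
Qed.

Lemma dot_ext x y : (forall z, dot x z = dot y z) -> x = y.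
Proof.
move=> h; apply/eqP; rewrite -subr_eq0; apply/eqP/hn_eq0/eqP.
by rewrite -sqrf_eq0 hn_sqr /rdot dotBl h subrr.
Qed.

(** Completeness is a separate predicate since [innerType] does not include it. *)
Definition complete_inner := forall u : nat -> V,
  (forall e : R, 0 < e -> exists N, forall n m, (N <= n)%N -> (N <= m)%N ->
     hn (u n - u m) < e) ->
  exists l, forall e : R, 0 < e -> exists N, forall n, (N <= n)%N -> hn (u n - l) < e.

Lemma closure_hnP (A : set V) x :
  closure A x <-> forall e : R, 0 < e -> exists2 y, A y & hn (x - y) < e.
Proof.
split=> [cx e e0|h U /nbhs_ballP[e /= e0 eU]].
  have /cx[y [Ay]] : nbhs x (ball x e%:C).
    by apply: nbhsx_ballx; rewrite ltcR.
  by rewrite -ball_normE /= -hnE ltcR => xy; exists y.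
have eE : (complex.Re e)%:C = e by rewrite RRe_real// gtr0_real.
have e0' : 0 < complex.Re e by rewrite -ltcR eE.
have [y Ay xy] := h _ e0'; exists y; split=> //; apply: eU.
by rewrite -ball_normE /= -hnE -eE ltcR.
Qed.

End inner_basics.

(** * Extension of a contraction by one vector *)

Section extension.
Variables (R : realType) (V : lmodType R[i]) (W : innerType R).
Hypothesis Wc : complete_inner W.
(** The form is only real bilinear and may be indefinite: nonnegativity is asked on the domain of
    [E] (through [EB]) and on the differences [y - v] with [v] in this domain. It will be the real
    scalar product for the projection theorem, and a defect form for commutant lifting. *)
Variables (B : V -> V -> R).
Hypothesis BC : forall x y, B x y = B y x.
Hypothesis BD : forall x y z, B (x + y) z = B x z + B y z.
Hypothesis BZ : forall (t : R) x z, B (t%:C *: x) z = t * B x z.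
Variable E : set (V * W).
Hypothesis E0 : E 0.
Hypothesis EZ : forall (a : R[i]) u v, E u -> E v -> E (a *: u + v).
Hypothesis EB : forall v z, E (v, z) -> hn z ^+ 2 <= B v v.
Variable y : V.
Hypothesis yB : forall v z, E (v, z) -> 0 <= B (y - v) (y - v).

Let BDr x u v : B x (u + v) = B x u + B x v.
Proof. by rewrite BC BD !(BC x). Qed.
Let BZr (t : R) x z : B z (t%:C *: x) = t * B z x.
Proof. by rewrite BC BZ (BC z). Qed.
Let BN x z : B (- x) z = - B x z.
Proof. by rewrite -scaleN1r (_ : -1 = (-1)%:C) ?BZ ?mulN1r// rmorphN1. Qed.
Let BNr x z : B z (- x) = - B z x.
Proof. by rewrite BC BN BC. Qed.

(* Values along a minimizing sequence for the distance from [y] to the domain of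
   [E] form a Cauchy sequence, whose limit extends the contraction [E] to [y]. *)
Lemma contraction_extension : exists e : W,
  (forall eps : R, 0 < eps -> exists u, E u /\ hn (e - u.2) < eps) /\
  forall v z, E (v, z) -> hn (e - z) ^+ 2 <= B (y - v) (y - v).
Proof.
pose S := [set B (y - u.1) (y - u.1) | u in E].
have S0 : S !=set0 by exists (B (y - 0) (y - 0)); exists 0.
have lS : lbound S 0 by move=> _ [[v z] Ev] <-; exact: yB Ev.
have hS : has_inf S by split=> //; exists 0.
pose d := inf S.
have dS u : E u -> d <= B (y - u.1) (y - u.1).
  by move=> Eu; apply: ge_inf; [exists 0|exists u].
have EBB u v : E u -> E v -> E (u - v).
  by move=> Eu Ev; rewrite addrC -scaleN1r; exact: EZ.
have /choice[u Hu] (n : nat) : exists u, E u /\ B (y - u.1) (y - u.1) < d + n.+1%:R^-1.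
  have [|_ [w Ew <-] wlt] := @inf_adherent _ S n.+1%:R^-1 _ hS.
    by rewrite invr_gt0.
  by exists w.
have Eu n : E (u n) by have [] := Hu n.
have ud n : B (y - (u n).1) (y - (u n).1) < d + n.+1%:R^-1 by have [] := Hu n.
(* The convex combination of [v] and [w] stays in [E], so its distance form is at least [d]. The
   value [t = 1/2] yields the Cauchy property, a smaller [t] the final estimate. *)
have conv (t : R) v w : E v -> E w -> t * (1 - t) * B (v.1 - w.1) (v.1 - w.1) <=
    (1 - t) * B (y - v.1) (y - v.1) + t * B (y - w.1) (y - w.1) - d.
  move=> Ev Ew.
  have Ec : E ((1 - t)%:C *: v + (t%:C *: w + 0)) by apply: EZ => //; exact: EZ.
  have := dS _ Ec; rewrite addr0 /=; set b := B (y - (_ + _)) _ => db.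
  suff -> : t * (1 - t) * B (v.1 - w.1) (v.1 - w.1) =
    (1 - t) * B (y - v.1) (y - v.1) + t * B (y - w.1) (y - w.1) - b by lra.
  rewrite /b !(BD, BDr, BN, BNr, BZ, BZr) [B w.1 v.1]BC [B v.1 y]BC [B w.1 y]BC.
  by ring.
have zC n m : hn ((u n).2 - (u m).2) ^+ 2 <= 2 * (n.+1%:R^-1 + m.+1%:R^-1).
  have := EB (v := (u n).1 - (u m).1) (z := (u n).2 - (u m).2).
  rewrite -[(_, _)]/(u n - u m) => /(_ (EBB _ _ (Eu n) (Eu m))) /le_trans; apply.
  have := conv (2^-1) _ _ (Eu n) (Eu m).
  have := ud n; have := ud m.
  set r := n.+1%:R^-1; set r' := m.+1%:R^-1; rewrite /=.
  set b := B _ _; set b' := B _ _; set b'' := B _ _ => h1 h2 h3.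
  have : 0 <= r by rewrite invr_ge0.
  have : 0 <= r' by rewrite invr_ge0.
  move: h1 h2 h3; lra.
have invlt (e : R) : 0 < e -> exists N, forall n, (N <= n)%N -> n.+1%:R^-1 < e.
  move=> e0; exists (Num.bound e^-1) => n Nn.
  rewrite invf_plt ?posrE// (lt_le_trans (archi_boundP _))//.
    by rewrite invr_ge0 ltW.
  by rewrite ler_nat (leq_trans Nn).
have [e He] : exists l, forall e : R, 0 < e ->
    exists N, forall n, (N <= n)%N -> hn ((u n).2 - l) < e.
  apply: Wc => e e0.
  have e4 : 0 < e ^+ 2 / 4 by rewrite divr_gt0// exprn_gt0.
  have [N HN] := invlt _ e4; exists N => n m Nn Nm.
  rewrite -(@ltr_pXn2r _ 2)// ?nnegrE ?hn_ge0// ?ltW//.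
  apply: le_lt_trans (zC n m) _.
  have := HN _ Nn; have := HN _ Nm.
  by set r := n.+1%:R^-1; set r' := m.+1%:R^-1; lra.
exists e; split=> [eps eps0|v z Evz].
  by have [N HN] := He _ eps0; exists (u N); split=> //; rewrite hnB; exact: HN.
have c0 := yB Evz; set c := B _ _ in c0 *; set a := hn _.
have a0 : 0 <= a := hn_ge0 _.
rewrite leNgt; apply/negP => ca.
have ap : 0 < a.
  by rewrite lt_def a0 andbT; apply/eqP => a00; move: ca; rewrite a00 expr0n ltNge c0.
(* If [c < a ^+ 2], going from [u n] a fraction [t] of the way towards [(v, z)] would bring the form
   below its infimum [d]. This [t] puts [(1 - t) * a ^+ 2] halfway between [c] and [a ^+ 2]. *)
pose t := (a ^+ 2 - c) / (2 * a ^+ 2).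
have a2 : 0 < a ^+ 2 by rewrite exprn_gt0.
have t0 : 0 < t by rewrite /t divr_gt0 ?subr_gt0// mulr_gt0.
have ta : (1 - t) * a ^+ 2 = (a ^+ 2 + c) / 2 by rewrite /t; field; rewrite gt_eqF.
have t1 : 0 < 1 - t by rewrite -(pmulr_lgt0 _ a2) ta divr_gt0//; lra.
(* The replacement of [e] by [(u n).2] and the lack of minimality of [u n] cost at most
   [eta * (1 + 2 * a)], a quarter of [a ^+ 2 - c], while half of it is available. *)
pose eta := (a ^+ 2 - c) / (4 * (1 + 2 * a)).
have eta0 : 0 < eta by rewrite /eta divr_gt0 ?subr_gt0// mulr_gt0//; lra.
have etaE : eta * (4 * (1 + 2 * a)) = a ^+ 2 - c.
  by rewrite /eta divfK// gt_eqF// mulr_gt0//; lra.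
have [N1 HN1] := He _ eta0.
have [N2 HN2] := invlt _ (mulr_gt0 eta0 t0).
pose n := maxn N1 N2.
have h1 := HN1 n (leq_maxl _ _); have h2 := HN2 n (leq_maxr _ _).
have b0 := hn_ge0 ((u n).2 - z).
set b := hn _ in b0.
have ab : a - eta <= b.
  rewrite lerBlDr /a /b (_ : e - z = ((u n).2 - z) + (e - (u n).2)); last first.
    by rewrite [RHS]addrC addrA subrK.
  by rewrite (le_trans (hnD _ _))// lerD2l hnB ltW.
have hb : t * (1 - t) * b ^+ 2 <= t * eta + t * c.
  have EE := conv t _ _ (Eu n) Evz.
  have hq : b ^+ 2 <= B ((u n).1 - v) ((u n).1 - v).
    by apply: EB; exact: (EBB _ _ (Eu n) Evz).
  have d0 : d <= c by exact: (dS _ Evz).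
  have := ler_wpM2l (ltW (mulr_gt0 t0 t1)) hq.
  move/le_trans; apply; apply: le_trans EE _ => /=.
  have und := ud n; have dun := dS _ (Eu n); rewrite -/c.
  set r := n.+1%:R^-1 in h2 und; set w := B _ _ in und dun *.
  have : (1 - t) * w <= (1 - t) * (d + r) by rewrite ler_wpM2l// ltW.
  have r0 : 0 <= r by rewrite /r invr_ge0.
  have d00 : 0 <= d by apply: lb_le_inf.
  nra.
have {}hb : (1 - t) * b ^+ 2 <= eta + c by rewrite -(ler_pM2l t0) mulrDr mulrA.
have b2 : a ^+ 2 - 2 * a * eta <= b ^+ 2.
  have [h|h] := leP (a - eta) 0.
    apply: (@le_trans _ _ 0); last exact: sqr_ge0.
    by nra.
  have : (a - eta) ^+ 2 <= b ^+ 2 by rewrite ler_pXn2r ?nnegrE// ltW.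
  apply: le_trans; rewrite sqrrB -subr_ge0.
  rewrite (_ : _ - _ = eta ^+ 2); last by ring.
  exact: sqr_ge0.
have : (1 - t) * (a ^+ 2 - 2 * a * eta) <= eta + c.
  by apply: le_trans hb; rewrite ler_wpM2l// ltW.
nra.
Qed.

End extension.

(** * Square-summable families *)

Section esum_seq.
Variables (R : realType) (X : choiceType).

Lemma sum_le_esum (f : X -> R) s : (forall x, 0 <= f x) -> uniq s ->
  ((\sum_(x <- s) f x)%:E <= \esum_(x in [set: X]) (f x)%:E)%E.
Proof.
move=> f0 us; apply: esum_ge; exists [set` s]; first by split.
by rewrite -fsbig_seq// sumEFin.
Qed.

Lemma esum_le_seq (f : X -> R) (M : R) : (forall x, 0 <= f x) ->
  (forall s, uniq s -> \sum_(x <- s) f x <= M) ->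
  (\esum_(x in [set: X]) (f x)%:E <= M%:E)%E.
Proof.
move=> f0 fM; apply: ge_ereal_sup => _ [A [finA _] <-].
by rewrite fsbig_finite//= sumEFin lee_fin fM.
Qed.

End esum_seq.

Section l2_theory.
Variables (R : realType) (X : choiceType).
Implicit Types (x y z : l2 R X) (s : seq X).

Lemma square_summable_seq (f : X -> R[i]) (M : R) :
  (forall s, uniq s -> \sum_(b <- s) nrm (f b) ^+ 2 <= M) ->
  f \in @square_summable R X.
Proof.
move=> fM; rewrite inE /=; apply: (@le_lt_trans _ _ M%:E); last exact: ltry.
by apply: esum_le_seq => // b; exact: sqr_ge0.
Qed.

Lemma esum_hn x : \esum_(b in [set: X]) (nrm (x b) ^+ 2)%:E = (hn x ^+ 2)%:E.
Proof.
have -> : hn x ^+ 2 = fine (\esum_(b in [set: X]) (nrm (x b) ^+ 2)%:E).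
  by apply/complexI; rewrite -l2_normE rmorphXn /= hnE.
rewrite fineK// ge0_fin_numE; first exact: (valP x).
by apply: esum_ge0 => b _; rewrite lee_fin sqr_ge0.
Qed.

Lemma sum_le_hn x s : uniq s -> \sum_(b <- s) nrm (x b) ^+ 2 <= hn x ^+ 2.
Proof.
move=> us; rewrite -lee_fin -esum_hn.
by apply: (@sum_le_esum _ _ (fun b => nrm (x b) ^+ 2)) => // b; rewrite sqr_ge0.
Qed.

Lemma hn_sqr_le x (M : R) :
  (forall s, uniq s -> \sum_(b <- s) nrm (x b) ^+ 2 <= M) -> hn x ^+ 2 <= M.
Proof.
move=> xM; rewrite -lee_fin -esum_hn.
by apply: (@esum_le_seq _ _ (fun b => nrm (x b) ^+ 2)) => // b; rewrite sqr_ge0.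
Qed.

Lemma hn_le x (M : R) : 0 <= M ->
  (forall s, uniq s -> \sum_(b <- s) nrm (x b) ^+ 2 <= M ^+ 2) -> hn x <= M.
Proof.
move=> M0 xM; rewrite -(@ler_pXn2r _ 2)// ?nnegrE ?hn_ge0//.
exact: hn_sqr_le.
Qed.

Lemma nrm_le_hn x b : nrm (x b) <= hn x.
Proof.
rewrite -(@ler_pXn2r _ 2)// ?nnegrE ?hn_ge0 ?nrm_ge0//.
by have := @sum_le_hn x [:: b] isT; rewrite big_seq1.
Qed.

Lemma l2_ext x y : x =1 y -> x = y.
Proof. by move=> xy; apply/val_inj/funext. Qed.

Lemma l2_addE x y b : (x + y : l2 R X) b = x b + y b. Proof. by []. Qed.
Lemma l2_subE x y b : (x - y : l2 R X) b = x b - y b. Proof. by []. Qed.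
Lemma l2_scaleE a x b : (a *: x : l2 R X) b = a * x b. Proof. by []. Qed.
Lemma l2_zeroE b : (0 : l2 R X) b = 0. Proof. by []. Qed.
Lemma l2_sumE (J : Type) (r : seq J) (F : J -> l2 R X) b :
  (\sum_(j <- r) F j) b = \sum_(j <- r) F j b.
Proof. by elim/big_rec2: _ => // j u v _ <-. Qed.

Lemma l2_basisE (a b : X) : l2_basis R a b = (b == a)%:R. Proof. by []. Qed.

Lemma csum_single (a : X) (c : R[i]) : csum (fun d => (d == a)%:R * c) = c.
Proof.
have rs (t : R) : rsum (fun d => (d == a)%:R * t) = t.
  have sm (u : R) : 0 <= u -> \esum_(d in [set: X]) ((d == a)%:R * u)%:E = u%:E.
    move=> u0; rewrite -[RHS](@esum_set1 R X a (fun=> u%:E)) ?lee_fin//.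
    rewrite [RHS]esum_mkcond; apply: eq_esum => d _.
    by rewrite classical_sets.in_set1; case: eqP => _; rewrite ?mul1r ?mul0r.
  have ss (u : R) : 0 <= u -> summable [set: X] (EFin \o (fun d => (d == a)%:R * u)).
    move=> u0; rewrite /summable.
    under eq_esum do rewrite /= ger0_norm ?mulr_ge0//.
    by rewrite sm// ltry.
  have [t0|t0] := leP 0 t.
    by rewrite rsum_ge0E ?sm//; [move=> d; rewrite mulr_ge0|exact: ss].
  have nt0 : 0 <= - t by rewrite oppr_ge0 ltW.
  rewrite -[in LHS](opprK t).
  under [X in rsum X]eq_fun do rewrite mulrN.
  rewrite rsumN; last exact: ss.
  rewrite rsum_ge0E ?sm ?opprK//; [by move=> d; rewrite mulr_ge0|exact: ss].
case: c => p q; rewrite /csum; congr (_ +i* _).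
  rewrite -[RHS]rs; congr rsum; apply/funext => d.
  by case: (d == a); rewrite ?mul1r ?mul0r.
rewrite -[RHS]rs; congr rsum; apply/funext => d.
by case: (d == a); rewrite ?mul1r ?mul0r.
Qed.

Lemma dot_csum x y : dot x y = csum (fun b => x b * Num.conj (y b)).
Proof. by []. Qed.

Lemma dot_basis x b : dot x (l2_basis R b) = x b.
Proof.
rewrite dot_csum -[RHS](csum_single b).
congr csum; apply/funext => a; rewrite l2_basisE.
by case: eqP => [->|_]; rewrite ?rmorph1 ?rmorph0 ?mulr1 ?mul1r ?mulr0 ?mul0r.
Qed.

Lemma basis_dot x b : dot (l2_basis R b) x = Num.conj (x b).
Proof. by rewrite dotC dot_basis. Qed.

Lemma hn_basis (b : X) : hn (l2_basis R b) = 1.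
Proof.
apply/eqP; rewrite -(@eqrXn2 _ 2) ?hn_ge0// expr1n hn_sqr /rdot dot_basis.
by rewrite l2_basisE eqxx.
Qed.

Lemma hn_finite (c : X -> R[i]) s : uniq s ->
  hn (\sum_(b <- s) c b *: l2_basis R b : l2 R X) ^+ 2 = \sum_(b <- s) nrm (c b) ^+ 2.
Proof.
elim: s => [_|b s IH /= /andP[bs us]]; first by rewrite !big_nil hn0 expr0n.
rewrite !big_cons dot_eq0_pythag ?IH// ?hnZ ?hn_basis ?mulr1//.
rewrite dotZl basis_dot l2_sumE big1_seq ?rmorph0 ?mulr0// => d /andP[_ ds].
rewrite -[LHS]/(c d * (b == d)%:R).
by case: eqP bs => [->|_ _]; rewrite ?ds ?mulr0.
Qed.

Lemma real_complete (u : nat -> R) :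
  (forall e : R, 0 < e -> exists N, forall n m, (N <= n)%N -> (N <= m)%N ->
     `|u n - u m| < e) ->
  exists l, forall e : R, 0 < e -> exists N, forall n, (N <= n)%N -> `|u n - l| < e.
Proof.
move=> uC; have : cvg (u @ \oo).
  suff : cauchy_ex (u @ \oo) by move=> /cauchy_exP /cauchy_cvg.
  move=> e e0; have [N HN] := uC e e0; exists (u N).
  by rewrite /fmapE -ball_normE; exists N => // n /= Nn; exact: HN.
move=> /cvg_ex[l /cvgrPdist_lt ul]; exists l => e e0.
have [N _ HN] := ul e e0; exists N => n Nn; rewrite distrC; exact: HN.
Qed.

Lemma complex_complete (u : nat -> R[i]) :
  (forall e : R, 0 < e -> exists N, forall n m, (N <= n)%N -> (N <= m)%N ->
     nrm (u n - u m) < e) ->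
  exists l, forall e : R, 0 < e -> exists N, forall n, (N <= n)%N -> nrm (u n - l) < e.
Proof.
move=> uC.
have [|p Hp] := @real_complete (fun n => complex.Re (u n)).
  move=> e /uC[N HN]; exists N => n m Nn Nm; rewrite -raddfB.
  exact: le_lt_trans (Re_le_nrm _) (HN _ _ Nn Nm).
have [|q Hq] := @real_complete (fun n => complex.Im (u n)).
  move=> e /uC[N HN]; exists N => n m Nn Nm; rewrite -raddfB.
  exact: le_lt_trans (Im_le_nrm _) (HN _ _ Nn Nm).
exists (p +i* q) => e e0.
have e2 : 0 < e / 2 by rewrite divr_gt0.
have [N1 H1] := Hp _ e2; have [N2 H2] := Hq _ e2.
exists (maxn N1 N2) => n; rewrite geq_max => /andP[/H1 h1 /H2 h2].
have -> : u n - (p +i* q) =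
    (complex.Re (u n) - p)%:C + 'i * (complex.Im (u n) - q)%:C.
  by case: (u n) => a b; rewrite -complexiE; simpc.
apply: le_lt_trans (nrmD _ _) _; rewrite nrmM !nrm_real.
have -> : nrm ('i : R[i]) = 1 by rewrite /nrm normCi.
by rewrite mul1r (splitr e) ltrD.
Qed.

Lemma l2_complete : complete_inner (l2 R X).
Proof.
move=> u uC.
have /choice[f Hf] (b : X) : exists l, forall e : R, 0 < e ->
    exists N, forall n, (N <= n)%N -> nrm (u n b - l) < e.
  apply: (complex_complete (u := fun n => u n b)) => e /uC[N HN].
  exists N => n m Nn Nm; apply: le_lt_trans (HN _ _ Nn Nm).
  by rewrite -l2_subE nrm_le_hn.
have lim s : uniq s -> forall e : R, 0 < e -> exists N, forall n, (N <= n)%N ->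
    \sum_(b <- s) nrm (u n b - f b) ^+ 2 < e.
  elim: s => [_ e e0|b s IH /= /andP[_ us] e e0].
    by exists 0%N => n _; rewrite big_nil.
  have e2 : 0 < e / 2 by rewrite divr_gt0.
  have [N1 H1] := IH us _ e2.
  have m0 : 0 < Num.min 1 (e / 2) by rewrite lt_min ltr01 e2.
  have [N2 H2] := Hf b _ m0.
  exists (maxn N1 N2) => n; rewrite geq_max => /andP[/H1 h1 /H2].
  rewrite lt_min => /andP[h2 h3]; rewrite big_cons (splitr e) ltrD//.
  apply: le_lt_trans h3; rewrite expr2 -[leRHS]mul1r.
  by rewrite ler_wpM2r ?nrm_ge0// ltW.
(* The index [N] must not depend on the finite set [s]. The Cauchy property bounds [u n - u m]
   uniformly in [s]; only the auxiliary [m], which leaves no trace in the result, is chosen after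
   [s]. *)
have tail (e : R) : 0 < e -> exists N, forall n, (N <= n)%N -> forall s, uniq s ->
    \sum_(b <- s) nrm (u n b - f b) ^+ 2 <= e ^+ 2.
  move=> e0; have e2 : 0 < e / 2 by rewrite divr_gt0.
  have [N HN] := uC _ e2; exists N => n Nn s us.
  have e4 : 0 < e ^+ 2 / 4 by rewrite divr_gt0// exprn_gt0.
  have [M HM] := lim s us _ e4.
  pose m := maxn N M.
  have h1 := HM m (leq_maxr _ _).
  have h2 := HN n m Nn (leq_maxl _ _).
  have h3 : \sum_(b <- s) nrm (u n b - u m b) ^+ 2 <= e ^+ 2 / 4.
    apply: le_trans (sum_le_hn (u n - u m) us) _.
    rewrite (_ : e ^+ 2 / 4 = (e / 2) ^+ 2); last by field.
    by rewrite ler_pXn2r// ?nnegrE ?hn_ge0// ltW.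
  apply: (@le_trans _ _ (\sum_(b <- s) (2 * nrm (u n b - u m b) ^+ 2 +
                                      2 * nrm (u m b - f b) ^+ 2))).
    apply: ler_sum => b _.
    have h : nrm (u n b - f b) <= nrm (u n b - u m b) + nrm (u m b - f b).
      by rewrite (le_trans _ (nrmD _ _))// addrA subrK.
    have := nrm_ge0 (u n b - f b).
    set p := nrm _ in h *; set q := nrm _ in h *; set r := nrm _ in h *.
    by move=> p0; have := sqr_ge0 (q - r); nra.
  by rewrite big_split /= -!mulr_sumr; lra.
have [N1 HN1] := tail 1 ltr01.
have fl : (fun b => u N1 b - f b) \in @square_summable R X.
  by apply: (@square_summable_seq _ (1 ^+ 2)) => s us; exact: HN1.
(* Only the difference between [u N1] and the pointwise limit [f] is known to be square summable so
   far; hence [f] is recovered by subtraction. *)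
exists (u N1 - L2 fl) => e e0.
have e2 : 0 < e / 2 by rewrite divr_gt0.
have [N HN] := tail _ e2; exists N => n Nn.
apply: (@le_lt_trans _ _ (e / 2)); last by rewrite ltr_pdivrMr// ltr_pMr// ltr1n.
apply: hn_le (ltW e2) _ => s us.
have := HN n Nn s us; congr (_ <= _); apply: eq_bigr => b _.
by rewrite !l2_subE /= subKr.
Qed.

End l2_theory.

(* Unfolding scalar products during unification is very costly, hence the opaque
   and locked definitions. *)
Opaque l2_dot.

(** * Projections and adjoints *)

Section linear_functions.
Variables (R : realType) (V W : lmodType R[i]) (f : V -> W).
Hypothesis fl : linear f.

Lemma lin_0 : f 0 = 0.
Proof. by have := fl (-1) 0 0; rewrite scaler0 addr0 scaleN1r addNr. Qed.
Lemma lin_D u v : f (u + v) = f u + f v.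
Proof. by rewrite -[u]scale1r fl !scale1r. Qed.
Lemma lin_Z a u : f (a *: u) = a *: f u.
Proof. by rewrite -[a *: u]addr0 fl lin_0 addr0. Qed.
Lemma lin_N u : f (- u) = - f u.
Proof. by rewrite -scaleN1r lin_Z scaleN1r. Qed.
Lemma lin_B u v : f (u - v) = f u - f v.
Proof. by rewrite lin_D lin_N. Qed.
Lemma lin_sum (J : Type) (r : seq J) (F : J -> V) :
  f (\sum_(j <- r) F j) = \sum_(j <- r) f (F j).
Proof. by elim/big_rec2: _ => [|j u v _ <-]; rewrite ?lin_0// lin_D. Qed.

End linear_functions.

Section projection.
Variables (R : realType) (W : innerType R).
Implicit Types (x y z e : W).

Definition lin_subspace (V : lmodType R[i]) (M : set V) : Prop :=
  M 0 /\ forall (a : R[i]) u v, M u -> M v -> M (a *: u + v).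

Lemma lin_subspaceB (V : lmodType R[i]) (M : set V) u v :
  lin_subspace M -> M u -> M v -> M (u - v).
Proof. by move=> [_ MZ] Mu Mv; rewrite addrC -scaleN1r; exact: MZ. Qed.

Lemma lin_subspaceZ (V : lmodType R[i]) (M : set V) a u :
  lin_subspace M -> M u -> M (a *: u).
Proof. by move=> [M0 MZ] Mu; rewrite -[_ *: _]addr0; exact: MZ. Qed.

Lemma closure_dot0 (M : set W) z e :
  (forall m, M m -> dot z m = 0) -> closure M e -> dot z e = 0.
Proof.
move=> zM /closure_hnP Me; apply/eqP; rewrite -normr_eq0 -nrmE.
rewrite -[0]/(0%:C) (inj_eq (@complexI _)) eq_le nrm_ge0 andbT leNgt; apply/negP => d0.
have h0 : 0 < hn z + 1 by rewrite ltr_wpDl// hn_ge0.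
have [m Mm em] := Me _ (divr_gt0 d0 h0).
have : nrm (dot z e) < nrm (dot z e).
  rewrite -{1}[e](subrK m) dotDr (zM m Mm) addr0.
  apply: le_lt_trans (nrm_dot _ _) _.
  rewrite ltr_pdivlMr// in em; apply: le_lt_trans em.
  by rewrite mulrC ler_wpM2l ?hn_ge0// lerDl.
by rewrite ltxx.
Qed.

(** The quadratic terms in [t] cancel, which leaves an affine function of [t] that is bounded below;
    its slope is zero. The value of [t] used in the proof would make this function equal to -1. *)
Lemma rdot_min0 (w m : W) :
  (forall t : R, hn (t%:C *: m) <= hn (w + t%:C *: m)) -> rdot w m = 0 :> R.
Proof.
move=> em; set r := rdot _ _.
have h (t : R) : 0 <= hn w ^+ 2 + 2 * t * r.
  have := em t.
  rewrite -(@ler_pXn2r _ 2)// ?nnegrE ?hn_ge0// !hn_sqr rdotDl !rdotDr.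
  by rewrite [rdot (t%:C *: m) w]rdotC !rdotZl !rdotZr -/r; lra.
have [//|r0] := eqVneq r 0.
have := h (- (hn w ^+ 2 + 1) / (2 * r)).
have -> : 2 * (- (hn w ^+ 2 + 1) / (2 * r)) * r = - (hn w ^+ 2 + 1).
  by field.
by move=> ?; lra.
Qed.

Hypothesis Wc : complete_inner W.

(** The identity of [M] is a contraction, which extends to [y]; its value [e] is in the closure of
    [M] and no farther than [y] from any [z] in [M]. Letting [z] approach [e - m] gives
    [hn m <= hn (y - e + m)], and [rdot_min0] applies. The vector ['i *: m] takes care of the
    imaginary part. *)
Lemma projection (M : set W) y : lin_subspace M ->
  exists e, closure M e /\ forall m, M m -> dot (y - e) m = 0.
Proof.
move=> Msub; have [M0 MZ] := Msub.
have [||||e [He eP]] := @contraction_extension R W W Wc (@rdot R W) (@rdotC R W)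
   (@rdotDl R W) (@rdotZl R W) [set u | u.1 = u.2 /\ M u.1] _ _ _ y _.
- by split.
- by move=> a [u1 u2] [v1 v2] [/= -> Mu] [/= -> Mv]; split=> //; exact: MZ.
- by move=> v z [/= <- _]; rewrite hn_sqr.
- by move=> v z _; rewrite -hn_sqr sqr_ge0.
have eM : closure M e.
  apply/closure_hnP => eps /He[[u1 u2] [[/= -> Mu]] h].
  by exists u2.
have ez z : M z -> hn (e - z) <= hn (y - z).
  move=> Mz; rewrite -(@ler_pXn2r _ 2)// ?nnegrE ?hn_ge0// [leRHS]hn_sqr.
  by apply: eP; split.
have em m : M m -> hn m <= hn ((y - e) + m).
  move=> Mm; apply/ler_addgt0Pr => eps eps0.
  have e2 : 0 < eps / 2 by rewrite divr_gt0.
  have /closure_hnP/(_ _ e2)[z Mz ez2] := eM.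
  have h : hn (e - (z - m)) <= hn (y - (z - m)) by apply: ez; exact: lin_subspaceB.
  have h1 : hn m <= hn (e - (z - m)) + hn (e - z).
    have -> : e - (z - m) = m + (e - z) by rewrite opprB addrCA.
    by rewrite -{1}[m](addrK (e - z)) (le_trans (hnD _ _))// hnN.
  have h2 : hn (y - (z - m)) <= hn (y - e + m) + hn (e - z).
    have -> : y - (z - m) = y - e + m + (e - z).
      by rewrite opprB addrCA [y - e + m]addrC -addrA subrKA.
    exact: hnD.
  by rewrite (splitr eps); lra.
have re0 m : M m -> rdot (y - e) m = 0.
  by move=> Mm; apply: rdot_min0 => t; apply: em; exact: lin_subspaceZ.
exists e; split=> // m Mm.
have := re0 _ (lin_subspaceZ 'i Msub Mm); have := re0 _ Mm.
rewrite /rdot dotZr; case: (dot _ _) => a b /= ->.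
by rewrite !mul0r !sub0r mulN1r opprK => ->.
Qed.

Lemma closure_orthoP (M : set W) y : lin_subspace M ->
  (forall z, (forall m, M m -> dot z m = 0) -> dot z y = 0) -> closure M y.
Proof.
move=> Msub h; have [e [Me ye]] := projection y Msub.
suff -> : y = e by [].
apply/eqP; rewrite -subr_eq0; apply/eqP/hn_eq0/eqP; rewrite -sqrf_eq0 hn_sqr.
by rewrite /rdot dotBr (h _ ye) (closure_dot0 ye Me) subr0.
Qed.

End projection.

Section bounded.
Variables (R : realType).

Definition bounded_linear (V W : innerType R) (T : V -> W) (M : R) :=
  linear T /\ forall x, hn (T x) <= M * hn x.

Lemma op_bounded_linear (V : innerType R) (T : op V) :
  exists2 M, 0 <= M & bounded_linear T M.
Proof.
have [M TM] := op_bounded T; exists `|M| => //.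
split=> [|x]; first exact: op_linear.
rewrite -lecR rmorphM /= !hnE; apply: le_trans (TM x) _.
by rewrite ler_wpM2r// lecR ler_norm.
Qed.

Lemma bounded_linear_op (V : innerType R) (T : V -> V) M :
  bounded_linear T M -> T \in @bounded_operator R V.
Proof.
move=> [Tl TM]; apply/bounded_operatorP; split=> //; exists M => x.
by rewrite -!hnE -rmorphM lecR.
Qed.

Variables (X : choiceType).

Lemma functional_ext0 (l : l2 R X -> R[i]) (M : R) :
  (forall a u v, l (a *: u + v) = a * l u + l v) ->
  (forall u, nrm (l u) <= M * hn u) ->
  (forall b, l (l2_basis R b) = 0) -> forall u, l u = 0.
Proof.
move=> ll lM l0 u.
have lz : l 0 = 0.
  by apply: (addIr (l 0)); rewrite add0r -{3}[0](addr0) -{1}[l 0]mul1r -ll scale1r.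
have Msub : lin_subspace [set u | l u = 0].
  by split=> // a v w /= v0 w0; rewrite ll v0 w0 mulr0 addr0.
have : closure [set u | l u = 0] u.
  apply: (closure_orthoP (@l2_complete R X) Msub) => z zM.
  suff -> : z = 0 by rewrite dot0l.
  by apply/l2_ext => b; rewrite l2_zeroE -dot_basis zM.
move=> /closure_hnP h.
apply/eqP; rewrite -normr_eq0 -nrmE.
rewrite -[0]/(0%:C) (inj_eq (@complexI _)) eq_le nrm_ge0 andbT leNgt; apply/negP => d0.
have M0 : 0 < `|M| + 1 by rewrite ltr_wpDl.
have [m /= Mm um] := h _ (divr_gt0 d0 M0).
have : nrm (l u) < nrm (l u); last by rewrite ltxx.
have lE : l u = l (u - m) by rewrite -{1}[u](subrK m) -[u - m]scale1r ll Mm addr0 mul1r scale1r.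
rewrite {1}lE; apply: le_lt_trans (lM _) _.
rewrite ltr_pdivlMr// in um; apply: le_lt_trans um.
rewrite mulrC ler_wpM2l ?hn_ge0// (le_trans (ler_norm _))// lerDl//.
Qed.

Lemma functional_ext (l l' : l2 R X -> R[i]) (M M' : R) :
  (forall a u v, l (a *: u + v) = a * l u + l v) ->
  (forall u, nrm (l u) <= M * hn u) ->
  (forall a u v, l' (a *: u + v) = a * l' u + l' v) ->
  (forall u, nrm (l' u) <= M' * hn u) ->
  (forall b, l (l2_basis R b) = l' (l2_basis R b)) -> l =1 l'.
Proof.
move=> ll lM ll' lM' bE u; apply/eqP; rewrite -subr_eq0; apply/eqP.
apply: (@functional_ext0 (fun u => l u - l' u) (M + M')) => [a v w|v|b].
- by rewrite ll ll' mulrBr opprD addrACA.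
- rewrite (le_trans (nrmD _ _))// mulrDl lerD// /nrm normrN; exact: lM'.
- by rewrite bE subrr.
Qed.

End bounded.

HB.lock Definition mkl2 (R : realType) (Y : choiceType) (f : Y -> R[i]) : l2 R Y :=
  insubd 0 f.
HB.lock Definition frame_coef (R : realType) (X : choiceType) (V : innerType R) (f : X -> V)
    (z : V) : l2 R X :=
  mkl2 (fun b => dot z (f b)).

Section frames.
Variables (R : realType) (X : choiceType) (V : innerType R).
Implicit Types (x z : V) (s : seq X) (f : X -> V).

Lemma mkl2E (Y : choiceType) (f : Y -> R[i]) :
  f \in @square_summable R Y -> mkl2 f =1 f.
Proof. by move=> fs y; rewrite mkl2.unlock /insubd insubT. Qed.

Lemma dot_suml (I : Type) (r : seq I) (F : I -> V) z :
  dot (\sum_(i <- r) F i) z = \sum_(i <- r) dot (F i) z :> R[i].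
Proof. by elim/big_rec2: _ => [|i u v _ <-]; rewrite ?dot0l// dotDl. Qed.

Lemma ler_sqr_hn (W : innerType R) (x : W) (M : R) : hn x <= M -> hn x ^+ 2 <= M ^+ 2.
Proof. by move=> h; rewrite ler_pXn2r// nnegrE ?hn_ge0// (le_trans (hn_ge0 x)). Qed.

(** The synthesis map sending the basis vector [b] to [f b] has norm at most [M] on finite
    combinations. Its adjoint is [frame_coef f], so operators can be given by their values on a
    basis without defining infinite sums of vectors. *)
Definition upper_frame f (M : R) := forall (c : X -> R[i]) s, uniq s ->
  hn (\sum_(b <- s) c b *: f b) ^+ 2 <= M ^+ 2 * \sum_(b <- s) nrm (c b) ^+ 2.

Variables (f : X -> V) (M : R).
Hypothesis fM : upper_frame f M.

(** The sum [S] equals the scalar product of [u] and [z], where [u] is the combination of the [f b]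
    with the same coefficients. Cauchy-Schwarz and the frame bound give
    [S ^+ 2 <= M ^+ 2 * S * hn z ^+ 2], and one factor [S] cancels. *)
Lemma bessel z s : uniq s -> \sum_(b <- s) nrm (dot z (f b)) ^+ 2 <= (M * hn z) ^+ 2.
Proof.
move=> us; set S := \sum_(_ <- _) _.
have [->|S0] := eqVneq S 0; first exact: sqr_ge0.
have Sge0 : 0 <= S by apply: sumr_ge0 => b _; rewrite sqr_ge0.
have Sp : 0 < S by rewrite lt_def S0.
pose u : V := \sum_(b <- s) dot z (f b) *: f b.
have uS : hn u ^+ 2 <= M ^+ 2 * S by exact: fM.
have SE : S%:C = dot u z.
  rewrite dot_suml raddf_sum; apply: eq_bigr => b _ /=.
  by rewrite dotZl [dot _ z]dotC -normCK -nrmE rmorphXn.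
have SC : S <= hn u * hn z.
  by have := nrm_dot u z; rewrite -SE nrm_real ger0_norm.
have : S ^+ 2 <= M ^+ 2 * S * hn z ^+ 2.
  apply: (@le_trans _ _ ((hn u * hn z) ^+ 2)).
    by rewrite ler_pXn2r// nnegrE mulr_ge0 ?hn_ge0.
  by rewrite exprMn ler_wpM2r// sqr_ge0.
by rewrite mulrAC expr2 ler_pM2r// -exprMn.
Qed.

Lemma frame_coefE z b : frame_coef f z b = dot z (f b).
Proof.
rewrite frame_coef.unlock mkl2E//; apply: (@square_summable_seq _ _ _ ((M * hn z) ^+ 2)) => s us.
exact: bessel.
Qed.

Lemma hn_frame_coef z : 0 <= M -> hn (frame_coef f z) <= M * hn z.
Proof.
move=> M0; apply: hn_le => [|s us]; first by rewrite mulr_ge0// hn_ge0.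
by under eq_bigr do rewrite frame_coefE; exact: bessel.
Qed.

Lemma frame_coef_bounded : 0 <= M -> bounded_linear (frame_coef f) M.
Proof.
move=> M0; split=> [a x y|x]; last exact: hn_frame_coef.
by apply/l2_ext => b; rewrite l2_addE l2_scaleE !frame_coefE dot_linearl.
Qed.

End frames.

Section adjoint.
Variables (R : realType) (X X' : choiceType).
Implicit Types (T : l2 R X -> l2 R X').

Definition adj T : l2 R X' -> l2 R X := frame_coef (T \o @l2_basis R X).

Variables (T : l2 R X -> l2 R X') (M : R).
Hypothesis TM : bounded_linear T M.

Let Tlin : linear T. Proof. by have [] := TM. Qed.

Let T_frame : upper_frame (T \o @l2_basis R X) M.
Proof.
move=> c s us /=; have -> : \sum_(b <- s) c b *: T (l2_basis R b) =
    T (\sum_(b <- s) c b *: l2_basis R b).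
  by rewrite (lin_sum Tlin); apply: eq_bigr => b _; rewrite (lin_Z Tlin).
by rewrite -(hn_finite c us) -exprMn ler_sqr_hn//; have [_] := TM.
Qed.

Lemma adjE z b : adj T z b = dot z (T (l2_basis R b)).
Proof. exact: (frame_coefE T_frame). Qed.

Lemma adj_le z : 0 <= M -> hn (adj T z) <= M * hn z.
Proof. exact: (hn_frame_coef T_frame). Qed.

Lemma adj_bounded : 0 <= M -> bounded_linear (adj T) M.
Proof.
move=> M0; split=> [a x y|x]; last exact: adj_le.
by apply/l2_ext => b; rewrite l2_addE l2_scaleE !adjE dot_linearl.
Qed.

Lemma adjP x z : dot (T x) z = dot x (adj T z).
Proof.
have h : forall u, nrm (dot (T u) z) <= (M * hn z) * hn u.
  move=> u; rewrite (le_trans (nrm_dot _ _))// mulrAC ler_wpM2r ?hn_ge0//.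
  by have [_] := TM.
apply: (functional_ext (l := fun u => dot (T u) z) (l' := fun u => dot u (adj T z))
   (M := M * hn z) (M' := hn (adj T z))) => //.
- by move=> a u v; rewrite Tlin dot_linearl.
- by move=> a u v; rewrite dot_linearl.
- by move=> u; rewrite mulrC nrm_dot.
- by move=> b; rewrite basis_dot adjE [LHS]dotC.
Qed.

Lemma adjPr x z : dot z (T x) = dot (adj T z) x.
Proof. by rewrite dotC adjP -dotC. Qed.

End adjoint.

HB.lock Definition pull (R : realType) (X X' : choiceType) (f : X' -> X) (x : l2 R X) :
  l2 R X' := mkl2 (x \o f).

Section pullback.
Variables (R : realType) (X X' : choiceType) (g : X' -> X).
Hypothesis g_inj : injective g.
Implicit Types (x y : l2 R X) (z : l2 R X').

(** For an injective map this adjoint is extension by zero, an isometry. Left and right creation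
    operators, words of them and the inclusions of summands are all of this form. *)
Definition push (f : X' -> X) : l2 R X' -> l2 R X := adj (pull f).

Let pull_sum x (s : seq X') : uniq s ->
  \sum_(b <- s) nrm ((x \o g) b) ^+ 2 <= hn x ^+ 2.
Proof.
move=> us; rewrite -(big_map g xpredT (fun b => nrm (x b) ^+ 2)).
by apply: sum_le_hn; rewrite map_inj_uniq.
Qed.

Lemma pullE x v : pull g x v = x (g v).
Proof.
by rewrite pull.unlock mkl2E//; apply: (@square_summable_seq _ _ _ (hn x ^+ 2)); exact: pull_sum.
Qed.

Lemma hn_pull x : hn (pull g x) <= hn x.
Proof.
apply: hn_le (hn_ge0 _) _ => s us; under eq_bigr do rewrite pullE.
exact: pull_sum.
Qed.

Lemma pull_linear : linear (pull g : l2 R X -> l2 R X').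
Proof.
by move=> a x y; apply/l2_ext => v; rewrite l2_addE l2_scaleE !pullE l2_addE l2_scaleE.
Qed.

Lemma pull_bounded : bounded_linear (pull g : l2 R X -> l2 R X') 1.
Proof. by split=> [|x]; [exact: pull_linear|rewrite mul1r hn_pull]. Qed.

Lemma push_bounded : bounded_linear (push g) 1.
Proof. by apply: adj_bounded; [exact: pull_bounded|]. Qed.

Lemma push_linear : linear (push g). Proof. by have [] := push_bounded. Qed.

Lemma pull_dot x z : dot (pull g x) z = dot x (push g z).
Proof. exact: (adjP pull_bounded). Qed.

Lemma push_dot x z : dot (push g z) x = dot z (pull g x).
Proof. by rewrite dotC -pull_dot -dotC. Qed.

Lemma pull_basis v : pull g (l2_basis R (g v)) = l2_basis R v.
Proof. by apply/l2_ext => u; rewrite pullE !l2_basisE (inj_eq g_inj). Qed.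

Lemma pull_basis_out u : (forall v, g v != u) -> pull g (l2_basis R u) = 0 :> l2 R X'.
Proof.
by move=> gu; apply/l2_ext => v; rewrite pullE l2_basisE (negPf (gu v)).
Qed.

Lemma pushE z v : push g z (g v) = z v.
Proof. by rewrite -dot_basis push_dot pull_basis dot_basis. Qed.

Lemma push_out z u : (forall v, g v != u) -> push g z u = 0.
Proof. by move=> gu; rewrite -dot_basis push_dot pull_basis_out// dot0r. Qed.

Lemma pushK z : pull g (push g z) = z.
Proof. by apply/l2_ext => v; rewrite pullE pushE. Qed.

Lemma dot_push z z' : dot (push g z) (push g z') = dot z z'.
Proof. by rewrite push_dot pushK. Qed.

Lemma hn_push z : hn (push g z) = hn z.
Proof.
by apply/eqP; rewrite -(@eqrXn2 _ 2) ?hn_ge0// !hn_sqr /rdot dot_push.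
Qed.

Lemma push_basis v : push g (l2_basis R v) = l2_basis R (g v).
Proof.
by apply: dot_ext => z; rewrite push_dot !basis_dot pullE.
Qed.

End pullback.

(** * Hilbert sums of copies of [l2] *)

Section families.
Variables (R : realType) (Y X : choiceType).
Implicit Types (x : l2 R (Y * X)%type) (z : Y -> l2 R X).

Lemma pair_inj (y : Y) : injective (fun v : X => (y, v)).
Proof. by move=> u v []. Qed.

(** A Hilbert sum of copies of [l2 R X] indexed by [Y] is encoded as [l2] over the product, so that
    no separate theory of sums is required; [slice] and [glue] pass between a vector and its family
    of components. *)
Definition slice (y : Y) x : l2 R X := pull (pair y) x.
Definition glue z : l2 R (Y * X)%type := mkl2 (fun p => z p.1 p.2).

Lemma sliceE y x v : slice y x v = x (y, v).
Proof. by rewrite /slice pullE//; exact: pair_inj. Qed.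

Lemma slice_linear y : linear (slice y).
Proof. exact/pull_linear/pair_inj. Qed.

Lemma hn_slice y x : hn (slice y x) <= hn x.
Proof. exact/hn_pull/pair_inj. Qed.

Let esum_pair (f : Y * X -> R[i]) :
  \esum_(p in [set: Y * X]) (nrm (f p) ^+ 2)%:E =
  \esum_(y in [set: Y]) \esum_(v in [set: X]) (nrm (f (y, v)) ^+ 2)%:E.
Proof.
rewrite esum_esum; last by move=> *; rewrite lee_fin sqr_ge0.
rewrite (_ : _ `*`` _ = setT); last by apply/seteqP; split=> // -[].
by apply: eq_esum => -[].
Qed.

Lemma esum_hn_slice x :
  \esum_(y in [set: Y]) (hn (slice y x) ^+ 2)%:E = (hn x ^+ 2)%:E.
Proof.
rewrite -esum_hn esum_pair; apply: eq_esum => y _.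
by rewrite -esum_hn; apply: eq_esum => v _; rewrite sliceE.
Qed.

Lemma sum_hn_slice x (s : seq Y) : uniq s ->
  \sum_(y <- s) hn (slice y x) ^+ 2 <= hn x ^+ 2.
Proof.
move=> us; rewrite -lee_fin -esum_hn_slice.
by apply: (@sum_le_esum _ _ (fun y => hn (slice y x) ^+ 2)) => // y; rewrite sqr_ge0.
Qed.

Lemma glue_summable z (M : R) :
  (forall s, uniq s -> \sum_(y <- s) hn (z y) ^+ 2 <= M) ->
  (fun p => z p.1 p.2) \in @square_summable R (Y * X)%type.
Proof.
move=> zM; rewrite inE /= esum_pair.
apply: (@le_lt_trans _ _ M%:E); last exact: ltry.
under eq_esum do rewrite /= esum_hn.
by apply: (@esum_le_seq _ _ (fun y => hn (z y) ^+ 2)) => // y; rewrite sqr_ge0.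
Qed.

Lemma glueE z (M : R) :
  (forall s, uniq s -> \sum_(y <- s) hn (z y) ^+ 2 <= M) ->
  forall p, glue z p = z p.1 p.2.
Proof. by move=> zM p; rewrite /glue mkl2E//; exact: glue_summable zM. Qed.

Lemma slice_glue z (M : R) :
  (forall s, uniq s -> \sum_(y <- s) hn (z y) ^+ 2 <= M) ->
  forall y, slice y (glue z) = z y.
Proof. by move=> zM y; apply/l2_ext => v; rewrite sliceE (glueE zM). Qed.

Lemma hn_glue z (M : R) :
  (forall s, uniq s -> \sum_(y <- s) hn (z y) ^+ 2 <= M) -> hn (glue z) ^+ 2 <= M.
Proof.
move=> zM; rewrite -lee_fin -esum_hn_slice.
under eq_esum do rewrite (slice_glue zM).
by apply: (@esum_le_seq _ _ (fun y => hn (z y) ^+ 2)) => // y; rewrite sqr_ge0.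
Qed.

Lemma slice_ext x x' : (forall y, slice y x = slice y x') -> x = x'.
Proof. by move=> h; apply/l2_ext => -[y v]; rewrite -!sliceE h. Qed.

End families.

Section fin_families.
Variables (R : realType) (k : nat) (X : choiceType).

Lemma fin_family_bound (z : 'I_k -> l2 R X) s : uniq s ->
  \sum_(y <- s) hn (z y) ^+ 2 <= \sum_y hn (z y) ^+ 2.
Proof.
move=> us; rewrite big_uniq//=.
rewrite [leRHS](bigID (fun y => y \in s)) /= lerDl.
by apply: sumr_ge0 => y _; rewrite sqr_ge0.
Qed.

Lemma slice_glue_fin (z : 'I_k -> l2 R X) y : slice y (glue z) = z y.
Proof. by rewrite (slice_glue (@fin_family_bound z)). Qed.

Lemma hn_slices_fin (x : l2 R ('I_k * X)%type) :
  hn x ^+ 2 = \sum_y hn (slice y x) ^+ 2.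
Proof.
apply/eqP; rewrite eq_le; apply/andP; split; last first.
  by rewrite -big_enum /= sum_hn_slice// enum_uniq.
have -> : x = glue (fun y => slice y x).
  by apply: slice_ext => y; rewrite slice_glue_fin.
under eq_bigr do rewrite slice_glue_fin.
exact: hn_glue (@fin_family_bound _).
Qed.

End fin_families.

(** * Beurling factorization on the Fock space *)

Section convolution.
Variables (R : realType) (I : choiceType).
Implicit Types (f g h : seq I -> R[i]).

(** The sum of [f u * g v] over the factorizations [c = u ++ v]: the coefficient at [c] of a product
    of formal power series in noncommuting variables. It is finite, hence meaningful for arbitrary
    [f] and [g]. *)
Fixpoint conv f g (c : seq I) : R[i] :=
  if c is i :: c' then f [::] * g c + conv (fun u => f (i :: u)) g c'
  else f [::] * g [::].

Lemma conv_ext f f' g c : f =1 f' -> conv f g c = conv f' g c.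
Proof.
elim: c f f' => [|i c IH] f f' ff' /=; rewrite ff'//.
by congr (_ + _); apply: IH => u; exact: ff'.
Qed.

Lemma conv_extr f g g' c : g =1 g' -> conv f g c = conv f g' c.
Proof. by move=> gg'; elim: c f => [|i c IH] f /=; rewrite gg' ?IH. Qed.

Lemma conv_linearl a f f' g c :
  conv (fun u => a * f u + f' u) g c = a * conv f g c + conv f' g c.
Proof.
elim: c f f' => [|i c IH] f f' /=; first by ring.
by rewrite IH; ring.
Qed.

Lemma conv_linearr a f g g' c :
  conv f (fun u => a * g u + g' u) c = a * conv f g c + conv f g' c.
Proof.
elim: c f => [|i c IH] f /=; first by ring.
by rewrite IH; ring.
Qed.

Lemma conv0l g c : conv (fun=> 0) g c = 0.
Proof. by elim: c => [|i c IH] /=; rewrite ?IH mul0r ?addr0. Qed.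

Lemma conv0r f c : conv f (fun=> 0) c = 0.
Proof. by elim: c f => [|i c IH] f /=; rewrite ?IH mulr0 ?addr0. Qed.

Lemma conv_assoc f g h c : conv (conv f g) h c = conv f (conv g h) c.
Proof.
elim: c f g => [|i c IH] f g /=; first by rewrite mulrA.
rewrite conv_linearl IH mulrDr !mulrA -!addrA; congr (_ + _).
Qed.

(** Continuity in the left factor of one coefficient is what allows identities between convolutions
    to be checked on basis vectors only. *)
Lemma conv_bounded (g : seq I -> R[i]) c :
  exists M : R, forall a : l2 R (seq I), nrm (conv a g c) <= M * hn a.
Proof.
elim: c => [|i c [M IH]].
  exists (nrm (g [::])) => a /=.
  by rewrite nrmM mulrC ler_wpM2l ?nrm_ge0// nrm_le_hn.
exists (nrm (g (i :: c)) + `|M|) => a /=.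
rewrite (le_trans (nrmD _ _))// mulrDl lerD//.
  by rewrite nrmM mulrC ler_wpM2l ?nrm_ge0// nrm_le_hn.
have ci : injective (cons i) by move=> u v [].
rewrite (@conv_ext _ (pull (cons i) a)); last by move=> u; rewrite pullE.
apply: le_trans (IH _) _.
apply: (@le_trans _ _ (`|M| * hn (pull (cons i) a))).
  by rewrite ler_wpM2r ?hn_ge0// ler_norm.
by rewrite ler_wpM2l// hn_pull.
Qed.

End convolution.

Section words.
Variables (R : realType) (Y I : choiceType).
Local Notation H := (l2 R (Y * seq I)%type).
Implicit Types (x z : H) (w u c : seq I).

Definition left_word w (p : Y * seq I) : Y * seq I := (p.1, w ++ p.2).

Lemma left_word_inj w : injective (left_word w).
Proof.
by move=> [y u] [y' u'] [] -> /eqP; rewrite eqseq_cat// eqxx => /eqP ->.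
Qed.

Local Hint Resolve left_word_inj : core.

Definition word_create w : H -> H := push (left_word w).
Definition word_annihilate w : H -> H := pull (left_word w).

Lemma word_create_dot w x z : dot (word_create w x) z = dot x (word_annihilate w z).
Proof. exact/push_dot/left_word_inj. Qed.

Lemma word_annihilate_dot w x z : dot (word_annihilate w x) z = dot x (word_create w z).
Proof. exact/pull_dot/left_word_inj. Qed.

Lemma word_annihilate_cat w w' x :
  word_annihilate (w ++ w') x = word_annihilate w' (word_annihilate w x).
Proof.
apply/l2_ext => p; rewrite !pullE//.
by rewrite /left_word /= catA.
Qed.

Lemma word_create_cat w w' x : word_create (w ++ w') x = word_create w (word_create w' x).
Proof. by apply: dot_ext => z; rewrite !word_create_dot word_annihilate_cat. Qed.

Lemma word_annihilate0 x : word_annihilate [::] x = x.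
Proof.
by apply/l2_ext => -[y u]; rewrite pullE.
Qed.

Lemma word_create0 x : word_create [::] x = x.
Proof. by apply: dot_ext => z; rewrite word_create_dot word_annihilate0. Qed.

Lemma word_createE w x y u : word_create w x (y, w ++ u) = x (y, u).
Proof. by rewrite -[(y, w ++ u)]/(left_word w (y, u)) pushE. Qed.

Lemma word_create_nil i w x y : word_create (i :: w) x (y, [::]) = 0.
Proof. by rewrite push_out// => -[y' v]; rewrite xpair_eqE andbF. Qed.

Lemma word_create_neq i j w x y u : i != j -> word_create (i :: w) x (y, j :: u) = 0.
Proof.
move=> ij; rewrite push_out//.
by move=> -[y' v]; apply: contra ij => /eqP[_ ->].
Qed.

Lemma word_create_eq i w x y u : word_create (i :: w) x (y, i :: u) = word_create w x (y, u).
Proof. by rewrite -cat1s word_create_cat -[i :: u]/([:: i] ++ u) word_createE. Qed.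

Lemma dot_word_create w x z : dot (word_create w x) (word_create w z) = dot x z.
Proof. exact/dot_push/left_word_inj. Qed.

Lemma dot_word_create_neq i j w u x z : i != j ->
  dot (word_create (i :: w) x) (word_create (j :: u) z) = 0.
Proof.
move=> ij; rewrite -[i :: w]cat1s word_create_cat word_create_dot.
rewrite (_ : word_annihilate _ _ = 0) ?dot0r//.
apply/l2_ext => -[y v]; rewrite pullE//.
rewrite /left_word /= word_create_neq ?l2_zeroE//; by rewrite eq_sym.
Qed.

Lemma dot_word_create_cons i w u x z :
  dot (word_create (i :: w) x) (word_create (i :: u) z) = dot (word_create w x) (word_create u z).
Proof. by rewrite -[i :: w]cat1s -[i :: u]cat1s !word_create_cat dot_word_create. Qed.

Lemma word_create_conv w x y c :
  word_create w x (y, c) = conv (fun b => (b == w)%:R) (fun b => x (y, b)) c.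
Proof.
elim: w c => [|j w IH] [|i c].
- by rewrite word_create0 /= mul1r.
- by rewrite word_create0 /= mul1r conv0l addr0.
- by rewrite word_create_nil /= mul0r.
- rewrite /= mul0r add0r; have [->|ij] := eqVneq j i.
    by rewrite word_create_eq IH; apply: conv_ext => u; rewrite eqseq_cons eqxx.
  rewrite word_create_neq// (@conv_ext _ _ _ (fun=> 0)) ?conv0l// => u.
  by rewrite eqseq_cons eq_sym (negPf ij).
Qed.

Section wandering.
Variable x : H.
Hypothesis x0 : x != 0.

(** [N] is the orthogonal complement of the left invariant subspace generated by [x], and [N0] that
    of the span of the proper shifts of [x]. The projection [e0] of [x] on [N0] is the wandering
    vector. *)
Let N0 : set H := [set z | forall w, w != [::] -> dot z (word_create w x) = 0].
Let N : set H := [set z | forall w, dot z (word_create w x) = 0].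

Let dot_sym0 (z z' : H) : dot z z' = 0 -> dot z' z = 0.
Proof. by move=> h; rewrite dotC h rmorph0. Qed.

Let wandering_part : exists e0 : H, N0 e0 /\ forall z, N0 z -> dot (x - e0) z = 0.
Proof.
pose M0 := [set v : H | forall z, N0 z -> dot v z = 0].
have Msub : lin_subspace M0.
  split; first by move=> z _; rewrite dot0l.
  move=> a u v uM vM z zN.
  by rewrite dot_linearl (uM z zN) (vM z zN) mulr0 addr0.
have [e [Me eP]] := projection (@l2_complete R _) x Msub.
have M0e : M0 e.
  by move=> z zN; apply/dot_sym0/(closure_dot0 _ Me) => m Mm; exact/dot_sym0/Mm.
exists (x - e); split=> [w w0|z zN]; last by rewrite subKr M0e.
by apply: eP => z zN; exact/dot_sym0/zN.
Qed.

Let N_unshift z w : N z -> N (word_annihilate w z).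
Proof. by move=> zN u; rewrite word_annihilate_dot -word_create_cat zN. Qed.

Let N0_unshift z w : w != [::] -> N0 z -> N (word_annihilate w z).
Proof.
move=> w0 zN u; rewrite word_annihilate_dot -word_create_cat zN//.
by case: w w0.
Qed.

Let NN0 z : N z -> N0 z. Proof. by move=> zN w _. Qed.

Section with_e0.
Variable e0 : H.
Hypotheses (e0N : N0 e0) (e0P : forall z, N0 z -> dot (x - e0) z = 0).

Let e0P' z : N0 z -> dot z e0 = dot z (word_create [::] x).
Proof.
move=> zN; rewrite word_create0; have /dot_sym0 := e0P zN; rewrite dotBr => /eqP.
by rewrite subr_eq0 => /eqP ->.
Qed.

Let N_e0 z u : N z -> dot z (word_create u e0) = 0.
Proof.
move=> zN; have uN := N_unshift u zN.
by rewrite -word_annihilate_dot (e0P' (NN0 uN)); exact: uN.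
Qed.

Let e0_ortho w : w != [::] -> dot e0 (word_create w e0) = 0.
Proof.
move=> w0; have wN := N0_unshift w0 e0N.
by rewrite -word_annihilate_dot (e0P' (NN0 wN)); exact: wN.
Qed.

Let dot_e0 w u : dot (word_create w e0) (word_create u e0) = (w == u)%:R * dot e0 e0.
Proof.
elim: w u => [|i w IH] [|j u].
- by rewrite dot_word_create mul1r.
- by rewrite word_create0 e0_ortho// mul0r.
- by rewrite word_create0 dot_sym0 ?mul0r// e0_ortho.
- rewrite eqseq_cons; have [->|ij] := eqVneq i j; first by rewrite dot_word_create_cons IH.
  by rewrite dot_word_create_neq// mul0r.
Qed.

Let K : set H := [set z | forall n, N n -> dot n z = 0].

(** [N0] is the sum of [N] and the line of [e0]: subtracting a suitable multiple of [e0] from [n]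
    makes it orthogonal to [x] itself. *)
Let K_N0 z n : K z -> dot e0 z = 0 -> N0 n -> dot n z = 0.
Proof.
move=> zK ze nN.
pose l := dot n (word_create [::] x) / dot e0 e0.
have lE : l * dot e0 e0 = dot n (word_create [::] x).
  (* The case [e0 = 0] cannot be excluded yet: that [e0] is nonzero will be deduced from this
     lemma. *)
  rewrite /l; have [e00|ne0] := eqVneq (dot e0 e0) 0; last by rewrite divfK.
  rewrite e00 mulr0 -e0P'//; apply/esym.
  suff -> : e0 = 0 by rewrite dot0r.
  by apply/eqP; rewrite -normr_eq0 -sqrf_eq0 -dot_normE e00.
have : N (n - l *: e0).
  move=> w; rewrite dotBl dotZl; have [->|w0] := eqVneq w [::].
    by rewrite -(e0P' e0N) lE subrr.
  by rewrite nN// e0N// mulr0 subr0.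
by move=> /zK; rewrite dotBl dotZl ze mulr0 subr0.
Qed.

(** The translates of [e0] span [K]. Basis vectors at the empty word belong to [N0], which kills
    these coefficients of [z]; the annihilation of one letter preserves both hypotheses, so an
    induction on the word reaches every coefficient. Finiteness of words plays the part of purity in
    the Wold decomposition. *)
Let K_eq0 z : K z -> (forall u, dot (word_create u e0) z = 0) -> z = 0.
Proof.
move=> zK ze; apply/l2_ext => -[y w]; rewrite l2_zeroE.
elim: w z zK ze => [|i w IH] z zK ze.
  rewrite -dot_basis dot_sym0//; apply: K_N0 => //; first by rewrite -(word_create0 e0) ze.
  by move=> [//|i w] _; rewrite basis_dot word_create_nil rmorph0.
rewrite -[RHS](IH (word_annihilate [:: i] z)).
- by rewrite /word_annihilate pullE.
- move=> n nN; rewrite -word_create_dot; apply: K_N0 => //.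
    by rewrite -(word_create0 e0) ze.
  move=> [//|j u] _; have [<-|ij] := eqVneq i j.
    by rewrite dot_word_create_cons word_create0 nN.
  by rewrite dot_word_create_neq.
- by move=> u; rewrite -word_create_dot -word_create_cat ze.
Qed.

Let e0_neq0 : e0 != 0.
Proof.
apply: contra x0 => /eqP e00; apply/eqP/K_eq0 => [n nN|u].
  by have := nN [::]; rewrite word_create0.
have -> : word_create u e0 = 0; last by rewrite dot0l.
by apply: hn_eq0; rewrite hn_push ?e00 ?hn0.
Qed.

Let t : R := (hn e0)^-1.
Let e : H := t%:C *: e0.
Let f u := word_create u e.

Let word_createZ u a z : word_create u (a *: z) = a *: word_create u z.
Proof. by apply: dot_ext => z'; rewrite word_create_dot !dotZl word_create_dot. Qed.

Let hne0 : hn e0 != 0.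
Proof. by apply: contra e0_neq0 => /eqP /hn_eq0 ->. Qed.

Let f_ortho w u : dot (f w) (f u) = (w == u)%:R.
Proof.
rewrite /f !word_createZ dotZl dotZr dot_e0 dot_hn /t.
case: eqP => _; rewrite ?mul0r ?mulr0// mul1r.
rewrite (_ : Num.conj _ = (hn e0)^-1%:C); last first.
  by rewrite -[LHS]/(_ -i* _) oppr0.
rewrite -!rmorphM /= (_ : _ * _ = 1)//.
by rewrite mulrA expr2 mulrACA mulVf// mulr1.
Qed.

Let f_frame : upper_frame f 1.
Proof.
move=> c s us; rewrite expr1n mul1r.
elim: s us => [_|b s IH /= /andP[bs us]]; first by rewrite !big_nil hn0 expr0n.
rewrite !big_cons dot_eq0_pythag; last first.
  rewrite dotZl dotC dot_suml big1_seq ?rmorph0 ?mulr0// => d /andP[_ ds].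
  by rewrite dotZl f_ortho; case: eqP bs => [<-|_ _]; rewrite ?ds ?mulr0.
rewrite lerD ?IH// hnZ (_ : hn (f b) = 1) ?mulr1//.
apply/eqP; rewrite -(@eqrXn2 _ 2) ?hn_ge0// expr1n hn_sqr /rdot f_ortho eqxx//.
Qed.

Let A : H -> l2 R (seq I) := frame_coef f.
Let AE z u : A z u = dot z (f u). Proof. exact: (frame_coefE f_frame). Qed.
Let A_bounded : bounded_linear A 1. Proof. exact: frame_coef_bounded. Qed.
Let V : l2 R (seq I) -> H := adj A.
Let VP z a : dot (A z) a = dot z (V a). Proof. exact: (adjP A_bounded). Qed.
Let V_bounded : bounded_linear V 1. Proof. exact: (adj_bounded A_bounded). Qed.
Let V_basis u : V (l2_basis R u) = f u.
Proof. by apply: dot_ext => z; rewrite dotC -VP dot_basis AE -dotC. Qed.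
Let AV a : A (V a) = a.
Proof.
apply/l2_ext => u; rewrite AE dotC -VP (_ : A (f u) = l2_basis R u).
  by rewrite -dotC dot_basis.
by apply/l2_ext => v; rewrite AE f_ortho l2_basisE eq_sym.
Qed.
Let hn_V a : hn (V a) = hn a.
Proof. by apply/eqP; rewrite -(@eqrXn2 _ 2) ?hn_ge0// !hn_sqr /rdot -VP AV. Qed.
Let VA : x = V (A x).
Proof.
apply/eqP; rewrite -subr_eq0; apply/eqP/K_eq0 => [n nN|u].
  have := nN [::]; rewrite word_create0 dotBr => ->.
  rewrite -VP (_ : A n = 0) ?dot0l ?subrr//.
  by apply/l2_ext => u; rewrite AE /f word_createZ dotZr N_e0// mulr0.
have -> : word_create u e0 = (hn e0)%:C *: f u.
  by rewrite /f word_createZ scalerA -rmorphM /= /t divff// scale1r.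
rewrite dotZl dotBr -VP (_ : A (f u) = l2_basis R u); last first.
  by apply/l2_ext => v; rewrite AE f_ortho l2_basisE eq_sym.
by rewrite basis_dot AE [dot (f u) x]dotC subrr mulr0.
Qed.

Let V_shift w a : V (push (cat w) a) = word_create w (V a).
Proof.
have cw : injective (cat w) by move=> u v /eqP; rewrite eqseq_cat// eqxx => /eqP.
have AE' z : A (word_annihilate w z) = pull (cat w) (A z).
  by apply/l2_ext => u; rewrite (pullE cw) !AE word_annihilate_dot -word_create_cat.
apply: dot_ext => z; rewrite dotC -VP [RHS]dotC -word_annihilate_dot -VP AE'.
by congr (Num.conj _); rewrite (pull_dot cw (A z) a).
Qed.

Lemma wandering_model_aux :
  exists (V : l2 R (seq I) -> H) (v : l2 R (seq I)) (g : Y -> seq I -> R[i]),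
  [/\ linear V, forall a, hn (V a) = hn a, x = V v,
      forall a y c, V a (y, c) = conv a (g y) c &
      forall a, (forall w, dot a (push (cat w) v) = 0) -> a = 0].
Proof.
exists V, (A x), (fun y c => e (y, c)); split=> //.
- by have [] := V_bounded.
- move=> a y c; have [M HM] := conv_bounded (fun c => e (y, c)) c.
  (* For a fixed coefficient both sides are bounded functionals of [a]; on a basis vector [V] gives
     a translate of [e], that is, a convolution with a point mass. *)
  apply: (functional_ext (l := fun a => V a (y, c))
    (l' := fun a : l2 R (seq I) => conv a (fun c => e (y, c)) c) (M := 1) (M' := M)) => //.
  + by move=> b u v; have [-> _] := V_bounded.
  + by move=> u; rewrite mul1r (le_trans (nrm_le_hn _ _))// hn_V.
  + by move=> b u v; rewrite -conv_linearl; apply: conv_ext.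
  + by move=> b; rewrite V_basis /f word_create_conv; apply: conv_ext.
(* If [a] is orthogonal to the shifts of [A x], then [V a] is orthogonal to those of [x], hence to
   every translate of [e], and [A (V a)] vanishes. *)
- move=> a ha; rewrite -[a]AV.
  have VN : N (V a).
    by move=> w; rewrite VA -V_shift -VP AV ha.
  by apply/l2_ext => u; rewrite AE /f word_createZ dotZr N_e0// mulr0.
Qed.

End with_e0.

(* Beurling factorization of [x]: the closed invariant subspace it generates is
   the range of an isometry [V] that commutes with left multiplications, and
   [x = V v] with [v] cyclic for these. *)
Lemma wandering_model :
  exists (V : l2 R (seq I) -> H) (v : l2 R (seq I)) (g : Y -> seq I -> R[i]),
  [/\ linear V, forall a, hn (V a) = hn a, x = V v,
      forall a y c, V a (y, c) = conv a (g y) c &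
      forall a, (forall w, dot a (push (cat w) v) = 0) -> a = 0].
Proof.
by have [e0 [e0N e0P]] := wandering_part; exact: (wandering_model_aux e0N e0P).
Qed.

End wandering.

End words.

(** * Weak topologies *)

Section sigma_topology_theory.
Variables (R : realType) (E : choiceType) (D : set (E -> R[i])).

Lemma sigma_cvg (F : set_system E) (x : E) : Filter F ->
  (forall f, D f -> forall e : R, 0 < e -> F [set y | nrm (f x - f y) < e]) ->
  F --> (x : sigma_topology D).
Proof.
move=> FF Df A [B [[C Cop <-] /= Cx] sBA]; apply: filterS sBA _.
pose Phi := fun y : E => (fun f : D => val f y) : {ptws D -> R[i]^o}.
suff h : Phi @ F --> Phi x.
  by have : (Phi @ F) C by apply: h; exact: open_nbhs_nbhs.
apply/cvg_sup => f A' [B' [[C' C'op <-] /= C'x] sB'A'].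
rewrite nbhs_filterE; apply: filterS sB'A' _.
have : nbhs (val f x : R[i]^o) C' by exact: open_nbhs_nbhs.
move=> /nbhs_ballP[e /= e0 eC'].
have eE : (complex.Re e)%:C = e by rewrite RRe_real// gtr0_real.
have e0' : 0 < complex.Re e by rewrite -ltcR eE.
have fD : D (val f) by exact: set_valP.
apply: filterS (Df _ fD _ e0') => y /= fxy; apply: eC'.
by rewrite -ball_normE /= -nrmE -eE ltcR.
Qed.

Lemma sigma_nbhs (x : E) (f : E -> R[i]) (e : R) : D f -> 0 < e ->
  nbhs (x : sigma_topology D) [set y | nrm (f x - f y) < e].
Proof.
move=> fD e0.
pose Phi := fun y : E => (fun f : D => val f y) : {ptws D -> R[i]^o}.
have fm : f \in D by exact/mem_set.
pose f' : D := exist _ f fm.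
have pc : nbhs (Phi x) [set h : {ptws D -> R[i]^o} | nrm (f x - h f') < e].
  have cv : nbhs (Phi x) --> (Phi x : {ptws D -> R[i]^o}) by [].
  move/cvg_sup : cv => /(_ f'); apply.
  exists [set h | nrm (f x - h f') < e]; split=> //; last first.
    by rewrite /= subrr nrm0.
  exists [set z : R[i]^o | nrm (f x - z) < e] => //.
  rewrite (_ : [set _ | _] = ball (f x : R[i]^o) e%:C); first exact: ball_open.
  by apply/seteqP; split=> z; rewrite -ball_normE /= -nrmE ltcR.
exact: (@initial_continuous _ _ Phi x _ pc).
Qed.

Lemma sigma_closureP (A : set E) (x : E) : closure (A : set (sigma_topology D)) x <->
  forall n (F : 'I_n -> E -> R[i]) (e : R), (forall m, D (F m)) -> 0 < e ->
    exists2 a, A a & forall m, nrm (F m x - F m a) < e.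
Proof.
split=> [Ax n F e FD e0|h U Ux].
  have : nbhs (x : sigma_topology D) [set y | forall m, nrm (F m x - F m y) < e].
    by apply: (@filter_forall E 'I_n (fun m => [set y | nrm (F m x - F m y) < e])
      (nbhs (x : sigma_topology D))) => m; exact: sigma_nbhs.
  by move=> /Ax[a [Aa aF]]; exists a.
(* The filter of the basic neighbourhoods of [x]. It converges to [x] by [sigma_cvg], so [U]
   contains a basic neighbourhood. *)
pose G : set_system E := [set V | exists n (F : 'I_n -> E -> R[i]) (e : R),
  [/\ forall m, D (F m), 0 < e & forall a, (forall m, nrm (F m x - F m a) < e) -> V a]].
have GF : Filter G.
  split.
  - by exists 0%N, (fun=> fun=> 0), 1; split=> // -[].
  - move=> P Q [n [F [e [FD e0 FP]]]] [n' [F' [e' [FD' e0' FP']]]].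
    exists (n + n')%N, (fun m : 'I_(n + n') =>
      match fintype.split m with inl i => F i | inr j => F' j end),
      (Num.min e e').
    split=> [m||a ha]; first by case: fintype.split.
      by rewrite lt_min e0.
    split; [apply: FP => m|apply: FP' => m].
      have := ha (lshift n' m); rewrite (unsplitK (inl m)).
      by rewrite lt_min => /andP[].
    have := ha (rshift n m); rewrite (unsplitK (inr m)).
    by rewrite lt_min => /andP[].
  - move=> P Q PQ [n [F [e [FD e0 FP]]]]; exists n, F, e; split=> // a /FP.
    exact: PQ.
have : G U.
  apply: (@sigma_cvg G x GF _ _ Ux) => f fD e e0.
  by exists 1%N, (fun=> f), e; split=> // a /(_ ord0).
by move=> [n [F [e [FD e0 FU]]]]; have [a Aa /FU Ua] := h n F e FD e0; exists a.
Qed.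

Lemma sigma_functional_continuous (f : E -> R[i]) : D f ->
  continuous (f : sigma_topology D -> R[i]^o).
Proof.
move=> fD x A /nbhs_ballP[e /= e0 eA].
have eE : (complex.Re e)%:C = e by rewrite RRe_real// gtr0_real.
have e0' : 0 < complex.Re e by rewrite -ltcR eE.
apply: filterS (@sigma_nbhs x f _ fD e0') => y /= fxy; apply: eA.
by rewrite -ball_normE /= -nrmE -eE ltcR.
Qed.

Lemma sigma_continuous (T : topologicalType) (g : T -> E) :
  (forall f, D f -> continuous (f \o g : T -> R[i]^o)) ->
  continuous (g : T -> sigma_topology D).
Proof.
move=> fg t; apply: sigma_cvg => f fD e e0.
apply: (fg f fD t [set z : R[i]^o | nrm (f (g t) - z) < e]).
apply/nbhs_ballP; exists e%:C; first by rewrite /= ltcR.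
by move=> z; rewrite -ball_normE /= -nrmE ltcR.
Qed.

End sigma_topology_theory.

(** * The commutant of the right creation operators *)

Section right_commutant.
Variables (R : realType) (I : choiceType).
Local Notation F2 := (l2 R (seq I)).
Implicit Types (x y z : F2) (T : F2 -> F2) (b c u : seq I) (f g : seq I -> R[i]).

Definition vacuum : F2 := l2_basis R [::].
Definition rcreate (i : I) : F2 -> F2 := push (fun u : seq I => rcons u i).
Definition right_commuting T := forall i x, T (rcreate i x) = rcreate i (T x).
Definition is_conv T := forall y c, T y c = conv (T vacuum) y c.

Lemma cons_inj (i : I) : injective (cons i). Proof. by move=> u v []. Qed.

Lemma cat_inj (w : seq I) : injective (cat w).
Proof. by move=> u v /eqP; rewrite eqseq_cat// eqxx => /eqP. Qed.

Lemma conv_rcons f g c j : conv f g (rcons c j) =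
  conv f (fun u => g (rcons u j)) c + f (rcons c j) * g [::].
Proof.
elim: c f => [|i c IH] f /=; first by [].
by rewrite IH addrA.
Qed.

Lemma conv_vacuumr f c : conv f vacuum c = f c.
Proof.
elim: c f => [|i c IH] f /=; first by rewrite mulr1.
by rewrite IH mulr0 add0r.
Qed.

Lemma conv_boundedr f c :
  exists M : R, forall a : F2, nrm (conv f a c) <= M * hn a.
Proof.
elim: c f => [|i c IH] f.
  exists (nrm (f [::])) => a /=.
  by rewrite nrmM ler_wpM2l ?nrm_ge0// nrm_le_hn.
have [M HM] := IH (fun u => f (i :: u)).
exists (nrm (f [::]) + M) => a /=.
rewrite (le_trans (nrmD _ _))// mulrDl lerD//.
by rewrite nrmM ler_wpM2l ?nrm_ge0// nrm_le_hn.
Qed.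

Lemma rcreate_rcons i x c j : rcreate i x (rcons c j) = (i == j)%:R * x c.
Proof.
have [<-|ij] := eqVneq i j.
  by rewrite mul1r /rcreate (pushE (@rcons_injl I i) x c).
rewrite mul0r /rcreate (push_out (@rcons_injl I i))// => u.
by rewrite eqseq_rcons (negPf ij) andbF.
Qed.

Lemma rcreate_nil i x : rcreate i x [::] = 0.
Proof.
rewrite /rcreate (push_out (@rcons_injl I i))// => u.
by rewrite -size_eq0 size_rcons.
Qed.

(** Basis vectors arise from the vacuum by right creations, which [T] commutes with; hence [T] is
    determined by its value at the vacuum. *)
Lemma right_commuting_conv T M : bounded_linear T M -> right_commuting T -> is_conv T.
Proof.
move=> [Tl TM] Tr y c; have [M' HM'] := conv_boundedr (T vacuum) c.
apply: (functional_ext (l := fun y => T y c) (l' := fun y => conv (T vacuum) y c)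
  (M := M) (M' := M')) => //.
- by move=> a u v; rewrite Tl.
- by move=> u; rewrite (le_trans (nrm_le_hn _ _)).
- by move=> a u v; rewrite -conv_linearr.
move=> b {y M' HM'}; elim/last_ind: b c => [|b i IH] c; first by rewrite conv_vacuumr.
have -> : l2_basis R (rcons b i) = rcreate i (l2_basis R b).
  by rewrite /rcreate (push_basis R (@rcons_injl I i)).
rewrite Tr; elim/last_ind: c => [|c j _].
  by rewrite rcreate_nil /= rcreate_nil mulr0.
rewrite conv_rcons !rcreate_rcons rcreate_nil mulr0 addr0 {}IH.
have E u : rcreate i (l2_basis R b) (rcons u j) = (i == j)%:R * l2_basis R b u + 0.
  by rewrite rcreate_rcons addr0.
by rewrite (conv_extr _ _ E) conv_linearr conv0r addr0.
Qed.

(* The isometry [V] of [wandering_model] acts by right convolutions, so it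
   intertwines all left convolution operators. *)
Lemma model_intertwine (Y : choiceType) (x : l2 R (Y * seq I)%type)
    (V : F2 -> l2 R (Y * seq I)%type) (v : F2) (g : Y -> seq I -> R[i]) (U : F2 -> F2) (j : Y) :
  x = V v -> (forall a j c, V a (j, c) = conv a (g j) c) -> is_conv U ->
  slice j (V (U v)) = U (slice j x).
Proof.
move=> xV Vconv Uc; apply/l2_ext => u; rewrite sliceE Vconv Uc.
rewrite (@conv_ext _ _ _ (conv (U vacuum) v)); last by move=> b; rewrite Uc.
by rewrite conv_assoc; apply: conv_extr => b; rewrite sliceE xV Vconv.
Qed.

(** Writing [x = V v], the family of errors on the components of [x] is the image under [V] of the
    error at [v]. As [V] is isometric, approximating [T] at one cyclic vector approximates it on the
    whole family with the same bound. The factorization requires [x] nonzero, so the zero family is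
    treated apart. *)
Lemma approx_family (Y : choiceType) (x : l2 R (Y * seq I)%type)
    (T : F2 -> F2) (C : set (F2 -> F2)) :
  is_conv T -> (forall S, C S -> is_conv S) -> C !=set0 ->
  (forall S, C S -> T 0 - S 0 = 0) ->
  (forall v, (forall a : F2, (forall w, dot a (push (cat w) v) = 0) -> a = 0) ->
     forall e : R, 0 < e -> exists2 S, C S & hn (T v - S v) < e) ->
  forall e : R, 0 < e -> exists2 S, C S & exists D : l2 R (Y * seq I)%type,
    (forall j, slice j D = T (slice j x) - S (slice j x)) /\ hn D < e.
Proof.
move=> Tc Cc [S0 CS0] C0 approx e e0.
have [->|x0] := eqVneq x 0.
  exists S0 => //; exists 0; split; last by rewrite hn0.
  move=> j; have -> : slice j (0 : l2 R (Y * seq I)%type) = 0.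
    by apply/l2_ext => u; rewrite sliceE.
  by rewrite C0.
have [V [v [g [Vl Viso xV Vconv vcyc]]]] := wandering_model x0.
have [S CS STe] := approx v vcyc e e0.
exists S => //; exists (V (T v - S v)); split; last by rewrite Viso.
move=> j; have Sl : linear (slice j : l2 R (Y * seq I)%type -> F2) by exact: slice_linear.
rewrite -(model_intertwine j xV Vconv Tc) -(model_intertwine j xV Vconv (Cc _ CS)).
by rewrite (lin_B Vl) (lin_B Sl).
Qed.

End right_commutant.

Section Finf_commutant.
Variables (R : realType) (I : choiceType).
Local Notation F2 := (fock R I).
Implicit Types (S T : op F2).

Lemma creation_push i (x : F2) : creation i x = push (cons i) x.
Proof.
apply/l2_ext => -[|j v].
  by rewrite (push_out (@cons_inj _ i)).
rewrite creationE; have [->|ij] := eqVneq j i.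
  by rewrite mul1r (pushE (@cons_inj _ i)).
rewrite mul0r (push_out (@cons_inj _ i))// => u.
by rewrite eqseq_cons eq_sym (negPf ij).
Qed.

Lemma push_comp (X1 X2 X3 : choiceType) (g : X2 -> X1) (h : X3 -> X2) (x : l2 R X3) :
  injective g -> injective h -> push g (push h x) = push (g \o h) x.
Proof.
move=> gi hi; apply: dot_ext => z.
rewrite (push_dot gi) (push_dot hi) (push_dot (inj_comp gi hi)); congr dot.
by apply/l2_ext => u; rewrite (pullE hi) (pullE gi) (pullE (inj_comp gi hi)).
Qed.

Lemma creation_right_commuting (i : I) : right_commuting (creation i : op F2).
Proof.
move=> j x; rewrite !creation_push /rcreate.
rewrite (push_comp _ (@cons_inj _ i) (@rcons_injl _ j)).
by rewrite (push_comp _ (@rcons_injl _ j) (@cons_inj _ i)).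
Qed.

Lemma rcreate_linear i : linear (@rcreate R I i).
Proof. by have [] := push_bounded R (@rcons_injl I i). Qed.

Lemma subalgebraI (V : innerType R) (A B : set (op V)) :
  subalgebra A -> subalgebra B -> subalgebra (A `&` B).
Proof.
move=> [A1 AZ AM] [B1 BZ BM]; split.
- by split; [exact: A1|exact: B1].
- by move=> a S T [AS BS] [AT BT]; split; [exact: (AZ a S T AS AT)|exact: (BZ a S T BS BT)].
- by move=> S T [AS BS] [AT BT]; split; [exact: (AM S T AS AT)|exact: (BM S T BS BT)].
Qed.

Lemma right_commuting_subalgebra :
  subalgebra [set T : op F2 | right_commuting T].
Proof.
split=> [//|a S T Sr Tr i x|S T Sr Tr i x].
  rewrite -[LHS]/(a *: S (rcreate i x) + T (rcreate i x)) Sr Tr.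
  by rewrite -rcreate_linear.
by rewrite -[LHS]/(S (T (rcreate i x))) Tr Sr.
Qed.

Lemma right_commuting_closed :
  closed ([set T : op F2 | right_commuting T] : set (wot F2)).
Proof.
move=> T /sigma_closureP Tcl i x; apply: dot_ext => z.
pose y := pull (fun u => rcons u i) z.
have yE w : dot (rcreate i w) z = dot w y :> R[i].
  exact: (push_dot (@rcons_injl I i)).
rewrite yE; apply/eqP; rewrite -subr_eq0 -normr_eq0 -nrmE.
rewrite -[0]/(0%:C) (inj_eq (@complexI _)) eq_le nrm_ge0 andbT.
apply/ler_addgt0Pr => e e0; rewrite add0r.
have e2 : 0 < e / 2 by rewrite divr_gt0.
(* Two functionals suffice: one tests [T] after right creation against [z], the other tests [T]
   alone against the right annihilation [y] of [z]. They coincide on every right commuting [S]. *)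
have [||S Sr ST] := Tcl 2%N (fun m (T : op F2) =>
   if m == ord0 then dot (T (rcreate i x)) z else dot (T x) y) (e / 2).
- by move=> m; case: (m == ord0); [exists (rcreate i x), z|exists x, y].
- by [].
have := ST ord0; have := ST (lift ord0 ord0); rewrite /= Sr yE.
set p := dot (T _) z; set q := dot (T x) y; set r := dot (S x) y => h1 h2.
rewrite (_ : p - q = (p - r) + (r - q)); last by rewrite addrA subrK.
rewrite (le_trans (nrmD _ _))// (splitr e) lerD// ltW//.
by move: h1; rewrite /nrm -normrN opprB.
Qed.

Lemma Finf_right_commuting T : T \in @in_Finf R I -> right_commuting T.
Proof.
move=> /in_FinfP/(_ _ right_commuting_subalgebra right_commuting_closed).
by apply=> i; exact: creation_right_commuting.
Qed.

Lemma Finf_conv T : T \in @in_Finf R I -> is_conv T.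
Proof.
move=> /Finf_right_commuting; have [M _ TM] := op_bounded_linear T.
exact: right_commuting_conv TM.
Qed.

Definition word_op (w : seq I) : op F2 := foldr (fun i T => creation i * T) 1 w.

Lemma word_opE w (x : F2) : word_op w x = push (cat w) x.
Proof.
elim: w => [|i w IH].
  apply: dot_ext => z; rewrite (push_dot (@cat_inj _ [::])); congr dot.
  by apply/l2_ext => u; rewrite (pullE (@cat_inj _ [::])).
rewrite -[LHS]/(creation i (word_op w x)) IH creation_push.
by rewrite (push_comp _ (@cons_inj _ i) (@cat_inj _ w)).
Qed.

Lemma word_op_subalgebra (A : set (op F2)) w :
  subalgebra A -> (forall i, A (creation i)) -> A (word_op w).
Proof. by move=> [A1 _ AM] Ac; elim: w => //= i w IH; exact: AM. Qed.

Definition cyclic (v : F2) :=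
  forall a : F2, (forall w, dot a (push (cat w) v) = 0) -> a = 0.

Lemma cyclic_dense (A : set (op F2)) (v : F2) (x : F2) (e : R) :
  subalgebra A -> (forall i, A (creation i)) -> cyclic v -> 0 < e ->
  exists2 S, A S & hn (x - S v) < e.
Proof.
move=> Aa Ac vc e0; have [A1 AZ AM] := Aa.
have sub : lin_subspace [set S v | S in A].
  split.
    exists 0; last by [].
    by have := AZ (-1) _ _ A1 A1; rewrite scaleN1r addNr.
  by move=> a _ _ [S AS <-] [T AT <-]; exists (a *: S + T); [exact: AZ|].
have : closure [set S v | S in A] x.
  apply: (closure_orthoP (@l2_complete R _) sub) => z zM.
  suff -> : z = 0 by rewrite dot0l.
  apply: vc => w; rewrite -word_opE zM//.
  by exists (word_op w) => //; exact: word_op_subalgebra.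
by move=> /closure_hnP/(_ _ e0)[_ [S AS <-] h]; exists S.
Qed.

(** A WOT-neighbourhood of [T] involves finitely many pairs of vectors; their first components form
    one vector of an ampliation, on which [approx_family] approximates [T] by elements of the
    algebra. *)
Lemma right_commuting_Finf T : right_commuting T -> T \in @in_Finf R I.
Proof.
move=> Tr; apply/in_FinfP => A Aa Acl Ac; apply: Acl.
apply/sigma_closureP => n F e FD e0.
have /choice[xy Hxy] (m : 'I_n) : exists p : F2 * F2, F m = (fun T : op F2 => dot (T p.1) p.2).
  by have [x [y FE]] := FD m; exists (x, y).
(* Elements of an arbitrary [A] need not act by convolution; those of this smaller subalgebra do,
   and it still contains the creation operators. *)
pose C : set (op F2) := A `&` [set S | right_commuting S].
have Ca : subalgebra C by exact: subalgebraI right_commuting_subalgebra.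
have Cc i : C (creation i) by split; [exact: Ac|exact: creation_right_commuting].
pose s := \sum_m hn (xy m).2 + 1.
have s0 : 0 < s by rewrite ltr_wpDl// sumr_ge0// => m _; exact: hn_ge0.
have convC (S : op F2) : right_commuting S -> is_conv S.
  by have [M _ SM] := op_bounded_linear S; exact: right_commuting_conv SM.
have [||||||_ [S [AS Sr] <-] [D [Dy De]]] := @approx_family R I 'I_n
  (glue (fun m => (xy m).1)) T [set op_fun S | S in C] _ _ _ _ _ (e / s) _.
- exact: convC.
- by move=> _ [S [_ Sr] <-]; exact: convC.
- by exists (1 : op F2); exists 1 => //; have [] := Ca.
- by move=> _ [S _ <-]; rewrite !linear0 addr0.
- move=> v vc eps eps0.
  have [S CS h] := cyclic_dense (T v) Ca Cc vc eps0.
  by exists S => //; exists S.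
- by rewrite divr_gt0.
exists S => // m; rewrite Hxy -dotBl.
have := Dy m; rewrite slice_glue_fin => <-.
apply: le_lt_trans (nrm_dot _ _) _.
apply: (@le_lt_trans _ _ (hn D * s)); last by rewrite -ltr_pdivlMr.
apply: ler_pM (hn_ge0 _) (hn_ge0 _) (hn_slice _ _) _.
rewrite /s (bigD1 m)//= -addrA lerDl addr_ge0// sumr_ge0// => j _; exact: hn_ge0.
Qed.

End Finf_commutant.

(** * Trace class operators *)

Section dot_slices.
Variables (R : realType) (Y X : choiceType).
Implicit Types (x z : l2 R (Y * X)%type).

Let summ x : csummable (fun y => (hn (slice y x) ^+ 2)%:C).
Proof.
rewrite /csummable /summable.
under eq_esum do rewrite /= nrm_real normr_id (ger0_norm (sqr_ge0 _)).
by rewrite esum_hn_slice ltry.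
Qed.

Let csum_hn x : csum (fun y => (hn (slice y x) ^+ 2)%:C) = (hn x ^+ 2)%:C.
Proof.
rewrite /csum; congr (_ +i* _).
  rewrite rsum_ge0E /=; last 2 first.
  - by move=> y; exact: sqr_ge0.
  - exact: csummable_Re (summ x).
  by rewrite esum_hn_slice.
rewrite rsum_ge0E//=; first by rewrite esum1.
exact: csummable_Im (summ x).
Qed.

Lemma polarization (V : innerType R) (x z : V) :
  dot x z = 4^-1 * ((hn (x + z) ^+ 2)%:C + (-1 * (hn (x - z) ^+ 2)%:C +
     ('i * (hn (x + 'i *: z) ^+ 2)%:C + - 'i * (hn (x - 'i *: z) ^+ 2)%:C))).
Proof.
rewrite -!dot_hn !(dotDl, dotDr, dotNl, dotNr) !dotZl !dotZr conjCi.
set a := dot x x; set b := dot x z; set c := dot z x; set d := dot z z.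
have i2 : 'i * 'i = -1 :> R[i] by rewrite -expr2 sqrCi.
rewrite (_ : _ + _ = 4 * b); first by rewrite mulrA mulVf ?mul1r// pnatr_eq0.
transitivity (2 * (b + c) + 2 * ('i * 'i) * (c - b)); first by ring.
by rewrite i2; ring.
Qed.

Lemma csummableD (f g : Y -> R[i]) : csummable f -> csummable g ->
  csummable (fun y => f y + g y).
Proof.
move=> cf cg.
apply: (@le_summable R Y (fun y => nrm (f y + g y)) (fun y => nrm (f y) + nrm (g y))).
  by move=> y; rewrite !ger0_norm ?addr_ge0 ?nrm_ge0// nrmD.
exact: rsummableD.
Qed.

Lemma csummableZ (a : R[i]) (f : Y -> R[i]) : csummable f ->
  csummable (fun y => a * f y).
Proof.
move=> cf; rewrite /csummable (_ : (fun y => _) = (EFin \o (fun y => nrm a * nrm (f y)))).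
  exact: rsummableZ.
by apply/funext => y /=; rewrite nrmM.
Qed.

Let csum4 (a b c d : R[i]) (f g h k : Y -> R[i]) :
  csummable f -> csummable g -> csummable h -> csummable k ->
  csum (fun y => a * (f y + (b * g y + (c * h y + d * k y)))) =
  a * (csum f + (b * csum g + (c * csum h + d * csum k))).
Proof.
move=> cf cg ch ck.
have cg' := csummableZ b cg; have ch' := csummableZ c ch; have ck' := csummableZ d ck.
have c1 := csummableD ch' ck'; have c2 := csummableD cg' c1; have c3 := csummableD cf c2.
by rewrite (csumZ a c3) (csumD cf c2) (csumD cg' c1) (csumD ch' ck') !csumZ.
Qed.

(** Summation by slices holds for squared norms, being a statement on nonnegative sums; polarization
    carries it over to scalar products. *)
Lemma dot_slices x z : dot x z = csum (fun y => dot (slice y x) (slice y z)).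
Proof.
rewrite polarization -!csum_hn -csum4; try exact: summ.
congr csum; apply/funext => y; rewrite [RHS]polarization.
have Sl : linear (slice y : l2 R (Y * X)%type -> l2 R X) by exact: slice_linear.
by rewrite !(lin_D Sl) !(lin_N Sl) !(lin_Z Sl).
Qed.

End dot_slices.

Section pull_bijective.
Variables (R : realType) (X X' : choiceType) (g : X' -> X) (h : X -> X').
Hypotheses (gK : cancel g h) (hK : cancel h g).

Lemma pull_push_bij (x : l2 R X) : push g (pull g x) = x.
Proof.
have gi := can_inj gK.
by apply/l2_ext => u; rewrite -[u]hK (pushE gi) (pullE gi).
Qed.

Lemma dot_pull_bij (x y : l2 R X) : dot (pull g x) (pull g y) = dot x y.
Proof. by rewrite (pull_dot (can_inj gK)) pull_push_bij. Qed.

End pull_bijective.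

Section positive_forms.
Variables (R : realType) (V : lmodType R[i]).
Implicit Types (B : V -> V -> R[i]).

Definition positive_form B :=
  [/\ forall a x y z, B (a *: x + y) z = a * B x z + B y z,
      forall x y, B x y = Num.conj (B y x) & forall x, 0 <= B x x].

Variable B : V -> V -> R[i].
Hypothesis Bpos : positive_form B.

Let Bl a x y z : B (a *: x + y) z = a * B x z + B y z.
Proof. by have [] := Bpos. Qed.
Let BC x y : B x y = Num.conj (B y x). Proof. by have [] := Bpos. Qed.
Let B_ge0 x : 0 <= B x x. Proof. by have [] := Bpos. Qed.
Let Br a x y z : B z (a *: x + y) = Num.conj a * B z x + B z y.
Proof. by rewrite BC Bl rmorphD rmorphM /= -!BC. Qed.

Let expand a x y : B (a *: y + x) (a *: y + x) =
  a * Num.conj a * B y y + a * B y x + Num.conj a * B x y + B x x.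
Proof. by rewrite Bl !Br; ring. Qed.

Lemma positive_form_null x e : B e e = 0 -> B x e = 0.
Proof.
move=> e0; apply/eqP; rewrite -normr_eq0 -sqrf_eq0 normCK -BC.
have [//|d0] := eqVneq (B x e * B e x) 0.
have dge : 0 <= B x e * B e x by rewrite [B e x]BC -normCK exprn_ge0.
have dp : 0 < B x e * B e x by rewrite lt_def d0.
(* Since [B e e = 0], the form is affine in [t] along this direction; the chosen [t] makes its value
   [- B x x - 2], which is negative. *)
pose t := (B x x + 1) / (B x e * B e x).
have tC : Num.conj t = t.
  apply/CrealP; rewrite realE; apply/orP; left.
  by rewrite /t divr_ge0// addr_ge0.
have := B_ge0 ((- t * B x e) *: e + x); rewrite expand e0 mulr0 add0r.
rewrite rmorphM rmorphN /= tC -BC.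
rewrite (_ : _ + _ + _ = B x x - 2 * (t * (B x e * B e x))); last by ring.
rewrite /t divfK// => h.
have : (0 : R[i]) <= -1 - (B x x + 1).
  by apply: le_trans h _; rewrite (_ : _ - _ = -1 - (B x x + 1))//; ring.
rewrite -opprD oppr_ge0 => h'.
have h2 : (0 : R[i]) < 1 + (B x x + 1) by rewrite ltr_pwDl// addr_ge0.
by have := lt_le_trans h2 h'; rewrite ltxx.
Qed.

(** The new diagonal is that of [B] at [x] minus its [B]-projection on [e]. If [B e e = 0], the
    convention on inverses leaves [B] unchanged, which is right as [B] then vanishes on [e]. *)
Lemma schur_complement_pos e :
  positive_form (fun x y => B x y - B x e / B e e * B e y).
Proof.
split=> [a x y z|x y|x].
- by rewrite !Bl; ring.
- rewrite rmorphB !rmorphM fmorphV /= -!BC.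
  by ring.
have [e0|e0] := eqVneq (B e e) 0; first by rewrite e0 invr0 mulr0 mul0r subr0.
have := B_ge0 ((- (B x e / B e e)) *: e + x); rewrite expand.
rewrite rmorphN rmorphM fmorphV /= -!BC.
by rewrite (_ : _ + _ + _ = B x x - B x e / B e e * B e x)//; field.
Qed.

Lemma schur_complement_null e y : B e y - B e e / B e e * B e y = 0.
Proof.
have [e0|e0] := eqVneq (B e e) 0; last by rewrite divff// mul1r subrr.
by rewrite BC positive_form_null// rmorph0 mulr0 subrr.
Qed.

End positive_forms.

Lemma sum_uniq_le_ord (R : numDomainType) (f : nat -> R) (n : nat) (r : seq nat) :
  (forall k, 0 <= f k) -> (forall k, (n <= k)%N -> f k = 0) -> uniq r ->
  \sum_(k <- r) f k <= \sum_(k < n) f k.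
Proof.
move=> f0 fn ur; rewrite (bigID (fun k => (k < n)%N)) /= addrC big1 ?add0r; last first.
  by move=> k; rewrite -leqNgt => /fn.
rewrite -(big_mkord xpredT f) /index_iota subn0 -big_filter.
rewrite [leLHS](_ : _ = \sum_(k <- iota 0 n | k \in r) f k).
  by rewrite big_mkcond; apply: ler_sum => k _; case: ifP.
rewrite -[RHS]big_filter; apply: perm_big; apply: uniq_perm; rewrite ?filter_uniq ?iota_uniq//.
by move=> k; rewrite !mem_filter mem_iota /= add0n andbC.
Qed.

Lemma dot_sumr (R : realType) (V : innerType R) (J : Type) (r : seq J) (F : J -> V) z :
  dot z (\sum_(j <- r) F j) = \sum_(j <- r) dot z (F j) :> R[i].
Proof. by elim/big_rec2: _ => [|j u v _ <-]; rewrite ?dot0r// dotDr. Qed.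

Lemma l2_finite_support (R : realType) (f : l2 R nat) n :
  (forall k, (n <= k)%N -> f k = 0) -> f = \sum_(k < n) f k *: l2_basis R (k : nat).
Proof.
move=> fn; apply/l2_ext => k; rewrite l2_sumE.
have [kn|nk] := ltnP k n.
  rewrite (bigD1 (Ordinal kn))// big1 ?addr0.
    by rewrite l2_scaleE /= eqxx mulr1 addr0.
  move=> j /andP[_ jk]; rewrite l2_scaleE /=; case: eqP => [kj|]; last by rewrite mulr0.
  by case/eqP: jk; apply: val_inj.
rewrite fn// big1// => j _; rewrite l2_scaleE /=.
by case: eqP nk => [->|_]; rewrite ?mulr0// leqNgt ltn_ord.
Qed.

(** * Cholesky factorization of the modulus *)

Section cholesky.
Variables (R : realType) (X : countType).
Local Notation H := (l2 R X).
Variables (T P : op H).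
Hypothesis P_ge0 : forall x, 0 <= dot (P x) x.
Hypothesis PT : forall x y, dot (P (P x)) y = dot (T x) (T y).

Let Plin : linear P. Proof. exact: op_linear. Qed.
Let Tlin : linear T. Proof. exact: op_linear. Qed.

(** The diagonal of the form is real; its values at [x + y] and [x + 'i *: y] give the two
    components of the identity. *)
Lemma positive_op_hermitian x y : dot (P x) y = Num.conj (dot (P y) x).
Proof.
have real u : complex.Im (dot (P u) u) = 0.
  by have := P_ge0 u; rewrite lecE => /andP[/eqP].
have h1 := real (x + y); have h2 := real (x + 'i *: y).
have rx := real x; have ry := real y.
move: h1 h2; rewrite !(lin_D Plin) (lin_Z Plin) !(dotDl, dotDr) !(dotZl, dotZr) conjCi.
move: rx ry; case: (dot (P x) x) => a1 a2; case: (dot (P y) y) => d1 d2.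
case: (dot (P x) y) => b1 b2; case: (dot (P y) x) => c1 c2 /= -> ->.
move=> h1 h2.
rewrite -[RHS]/(c1 -i* c2); congr (_ +i* _); lra.
Qed.

Let PTn x : hn (P x) = hn (T x).
Proof.
apply/eqP; rewrite -(@eqrXn2 _ 2) ?hn_ge0// !hn_sqr /rdot -PT.
by rewrite (positive_op_hermitian (P x) x) -dotC.
Qed.

Let e (n : nat) : H := if unpickle n is Some w then l2_basis R w else 0.
Let B (Q : H -> H) x y := dot (P (Q x)) y.
Let step (Q : H -> H) n x := Q x - (B Q x (e n) / B Q (e n) (e n)) *: Q (e n).
(* The forms [Bn n] are the successive Schur complements of the form of [P], so that
   [chol n] below is the n-th column of the Cholesky factor of [P]. *)
Fixpoint residual n : H -> H := if n is m.+1 then step (residual m) m else id.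
Let Bn n := B (residual n).

Let BnS n x y : Bn n.+1 x y = Bn n x y - Bn n x (e n) / Bn n (e n) (e n) * Bn n (e n) y.
Proof. by rewrite /Bn {1}/B /= /step (lin_B Plin) (lin_Z Plin) dotBl dotZl. Qed.

Let Bn_pos n : positive_form (Bn n).
Proof.
elim: n => [|n IH].
  split=> [a x y z|x y|x]; rewrite /Bn /B /=; [|exact: positive_op_hermitian|exact: P_ge0].
  by rewrite Plin dot_linearl.
have := schur_complement_pos IH (e n).
by congr positive_form; apply/funext => x; apply/funext => y; rewrite BnS.
Qed.

Let Bn_null n j y : (j < n)%N -> Bn n (e j) y = 0.
Proof.
elim: n y => // n IH y; rewrite ltnS leq_eqVlt => /orP[/eqP ->|jn]; rewrite BnS.
  exact: schur_complement_null (Bn_pos n) _ _.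
by rewrite !IH// !mul0r subr0.
Qed.

Let s n : R[i] := sqrtC (Bn n (e n) (e n)).
Let s2 n : s n * s n = Bn n (e n) (e n).
Proof. by rewrite -expr2 sqrtCK. Qed.
Let sJ n : Num.conj (s n) = s n.
Proof.
apply/CrealP; rewrite realE sqrtC_ge0.
by have [_ _ ->] := Bn_pos n.
Qed.

Definition chol n : H := (s n)^-1 *: P (residual n (e n)).
(** As [T] and [P] have equal norms on every vector, the elimination that expands [P] also expands
    [T]: on basis vectors, [T x] is the sum of the [dot x (chol k) *: chol_image k], and
    [chol_image k] has the norm of [chol k]. A zero pivot gives zero vectors, in agreement with
    [positive_form_null]. *)
Definition chol_image n : H := (s n)^-1 *: T (residual n (e n)).

Arguments chol : simpl never.
Arguments chol_image : simpl never.

Lemma hn_chol n : hn (chol_image n) = hn (chol n).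
Proof. by rewrite !hnZ PTn. Qed.

Let dot_chol n x : dot x (chol n) = (s n)^-1 * Bn n x (e n).
Proof.
rewrite /chol dotZr fmorphV /= sJ; congr (_ * _).
by have [_ -> _] := Bn_pos n; rewrite /Bn /B dotC.
Qed.

Let coefS n x : Bn n x (e n) / Bn n (e n) (e n) = dot x (chol n) * (s n)^-1.
Proof. by rewrite dot_chol -s2 invfM mulrA mulrC mulrA. Qed.

Let decomp (S : op H) n x : S x = S (residual n x) +
  \sum_(k < n) dot x (chol k) *: ((s k)^-1 *: S (residual k (e k))).
Proof.
have Sl : linear S by exact: op_linear.
elim: n => [|n IH]; first by rewrite big_ord0 addr0.
rewrite big_ord_recr /= {1}IH [X in _ = _ + X]addrC addrA; congr (_ + _).
rewrite /step (lin_B Sl) (lin_Z Sl) -/(Bn n) scalerA coefS.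
by rewrite subrK.
Qed.

Let residual_null n j : (j < n)%N -> P (residual n (e j)) = 0.
Proof.
by move=> jn; apply: dot_ext => y; rewrite dot0l; exact: Bn_null jn.
Qed.

Let e_pickle (w : X) : e (pickle w) = l2_basis R w.
Proof. by rewrite /e pickleK. Qed.

(** Triangularity of the factor: for a fixed word only finitely many columns contribute, so the
    expansions below are finite sums. *)
Lemma chol_support k (w : X) : (pickle w < k)%N -> chol k w = 0.
Proof.
move=> wk; rewrite -dot_basis -e_pickle dotC dot_chol.
by rewrite Bn_null// mulr0 rmorph0.
Qed.

Lemma chol_imageE (w : X) n : (pickle w < n)%N -> T (l2_basis R w) =
  \sum_(k < n) Num.conj (chol k w) *: chol_image k.
Proof.
move=> wn; rewrite (decomp T n) -e_pickle (_ : T _ = 0) ?add0r.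
  by apply: eq_bigr => k _; rewrite e_pickle basis_dot.
by apply: hn_eq0; rewrite -PTn residual_null// hn0.
Qed.

(** Summed over [w], this shows that the factor is Hilbert-Schmidt, its squared norm being the trace
    of [P]; so all columns fit into the single vector [chol_glued]. *)
Lemma chol_diag (w : X) n : (pickle w < n)%N ->
  \sum_(k < n) nrm (chol k w) ^+ 2 = complex.Re (dot (P (l2_basis R w)) (l2_basis R w)).
Proof.
move=> wn; rewrite [in RHS](decomp P n) -{1}e_pickle residual_null// add0r.
rewrite dot_suml raddf_sum; apply: eq_bigr => k _.
rewrite -/(chol k) dotZl basis_dot dot_basis mulrC -normCK -nrmE -rmorphXn //.
Qed.

Hypothesis P_tr : (\esum_(w in [set: X])
   (complex.Re (dot (P (l2_basis R w)) (l2_basis R w)))%:E < +oo)%E.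

Let tr w := complex.Re (dot (P (l2_basis R w)) (l2_basis R w)).
Let tr_ge0 w : 0 <= tr w.
Proof. by have := P_ge0 (l2_basis R w); rewrite lecE => /andP[_]. Qed.

Let col (w : X) : l2 R nat := mkl2 (fun k => chol k w).

Let col_sum (w : X) (r : seq nat) : uniq r -> \sum_(k <- r) nrm (chol k w) ^+ 2 <= tr w.
Proof.
move=> ur; rewrite /tr -(@chol_diag w (pickle w).+1)//.
apply: (@sum_uniq_le_ord R (fun k => nrm (chol k w) ^+ 2)) => // k.
  by rewrite sqr_ge0.
by move=> wk; rewrite chol_support// nrm0 expr0n.
Qed.

Let col_summable (w : X) : (fun k => chol k w) \in @square_summable R nat.
Proof. exact: square_summable_seq (col_sum w). Qed.

Let colE w k : col w k = chol k w.
Proof. by rewrite /col (mkl2E (col_summable w)). Qed.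

Let col_bound (r : seq X) : uniq r ->
  \sum_(w <- r) hn (col w) ^+ 2 <= fine (\esum_(w in [set: X]) (tr w)%:E).
Proof.
move=> ur; apply: (@le_trans _ _ (\sum_(w <- r) tr w)).
  apply: ler_sum => w _; apply: hn_sqr_le => q uq.
  by under eq_bigr do rewrite colE; exact: col_sum.
rewrite -lee_fin fineK; first exact: sum_le_esum.
rewrite ge0_fin_numE//; apply: esum_ge0 => w _; rewrite lee_fin//.
Qed.

Let swap (p : X * nat) : nat * X := (p.2, p.1).
Let unswap (p : nat * X) : X * nat := (p.2, p.1).
Let swapK : cancel swap unswap. Proof. by case. Qed.
Let unswapK : cancel unswap swap. Proof. by case. Qed.

Definition chol_glued : l2 R (nat * X)%type := pull unswap (glue col).

Let chol_gluedE k w : chol_glued (k, w) = chol k w.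
Proof. by rewrite /chol_glued (pullE (can_inj unswapK)) (glueE col_bound) colE. Qed.

Let slice_chol k : slice k chol_glued = chol k.
Proof. by apply/l2_ext => w; rewrite sliceE chol_gluedE. Qed.

Lemma chol_image_bound (r : seq nat) : uniq r ->
  \sum_(k <- r) hn (chol_image k) ^+ 2 <= hn chol_glued ^+ 2.
Proof.
move=> ur; apply: le_trans (sum_hn_slice chol_glued ur).
by apply: ler_sum => k _; rewrite slice_chol hn_chol.
Qed.

Lemma chol_trace (phi : op H) (D : l2 R (nat * X)%type) :
  (forall k, slice k D = phi (chol_image k)) ->
  op_trace (phi * T) = dot D chol_glued.
Proof.
(* The scalar product is summed by words rather than by columns: for each word the sum over the
   columns is finite, and no infinite sums are interchanged. *)
move=> DE; rewrite -(dot_pull_bij swapK unswapK) dot_slices /op_trace.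
congr csum; apply/funext => w.
have si := can_inj swapK; set n := (pickle w).+1.
have -> : slice w (pull swap chol_glued) = \sum_(k < n) chol k w *: l2_basis R (k : nat).
  rewrite (_ : slice w _ = col w).
    rewrite {1}(@l2_finite_support R (col w) n) => [|k nk]; last by rewrite colE chol_support.
    by apply: eq_bigr => k _; rewrite colE.
  by apply/l2_ext => k; rewrite sliceE (pullE si) chol_gluedE colE.
have pl : linear phi by exact: op_linear.
rewrite -[(phi * T) _]/(phi (T _)) (@chol_imageE w n)// (lin_sum pl) dot_suml.
rewrite dot_sumr; apply: eq_bigr => k _.
rewrite (lin_Z pl) dotZl dotZr !dot_basis -DE !sliceE.
by rewrite (pullE si).
Qed.

End cholesky.

Section trace_class.
Variables (R : realType) (X : countType).
Local Notation H := (l2 R X).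

Lemma ampliation (Y : choiceType) (phi : op H) (t : l2 R (Y * X)%type) :
  exists D : l2 R (Y * X)%type, forall y, slice y D = phi (slice y t).
Proof.
have [M M0 [_ phiM]] := op_bounded_linear phi.
exists (glue (fun y => phi (slice y t))) => y.
apply: (slice_glue (M := M ^+ 2 * hn t ^+ 2)) => r ur.
apply: le_trans (ler_wpM2l (sqr_ge0 M) (sum_hn_slice t ur)).
rewrite mulr_sumr; apply: ler_sum => k _.
by rewrite -exprMn ler_sqr_hn.
Qed.

(** Every trace functional becomes a vector functional after ampliation to countably many copies:
    [t] collects the vectors to which [phi] is applied, [C] those tested against. *)
Lemma trace_class_glued (T : op H) : trace_class T ->
  exists t C : l2 R (nat * X)%type, forall (phi : op H) (D : l2 R (nat * X)%type),
    (forall k, slice k D = phi (slice k t)) -> op_trace (phi * T) = dot D C.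
Proof.
move=> [P [P0 PT Ptr]].
exists (glue (chol_image T P)), (chol_glued P) => phi D DE.
apply: (chol_trace P0 PT Ptr) => k.
by rewrite DE (slice_glue (chol_image_bound P0 PT Ptr)).
Qed.

Lemma rank_one_trace_class (x y : H) :
  exists2 T : op H, trace_class T & forall phi : op H, op_trace (phi * T) = dot (phi x) y.
Proof.
have bd (u v : H) : (fun z => dot z v *: u) \in @bounded_operator R H.
  apply: (@bounded_linear_op R H (fun z => dot z v *: u) (hn u * hn v)).
  split=> [a z z'|z]; first by rewrite dot_linearl scalerDl scalerA.
  by rewrite hnZ mulrC -mulrA ler_wpM2l ?hn_ge0// mulrC nrm_dot.
exists (Op (bd x y)); last first.
  move=> phi; rewrite /op_trace [RHS]dot_csum; congr csum; apply/funext => w.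
  have pl : linear phi by exact: op_linear.
  rewrite -[(phi * _) _]/(phi (dot (l2_basis R w) y *: x)) (lin_Z pl) dotZl.
  by rewrite basis_dot dot_basis mulrC.
have [y0|y0] := eqVneq (hn y) 0.
  exists 0; split.
  - by move=> z; rewrite -[(0 : op H) z]/(0 : H) dot0l.
  - move=> z z'; rewrite -[(0 : op H) _]/(0 : H) dot0l /= (hn_eq0 y0) !dot0r.
    by rewrite !scale0r dot0l.
  - by rewrite esum1// => w _; rewrite -[(0 : op H) _]/(0 : H) dot0l.
(* The modulus of the operator sending [z] to [dot z y *: x] sends [z] to [(hn x / hn y) * dot z y]
   times [y]. *)
have [r r0 rE] : exists2 r : R, 0 <= r & hn x = r * hn y.
  by exists (hn x / hn y); [rewrite divr_ge0 ?hn_ge0|rewrite divfK].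
have rJ : Num.conj r%:C = r%:C by rewrite -[LHS]/(_ -i* _) oppr0.
exists (r%:C *: Op (bd y y)); split.
- move=> z; rewrite -[(_ *: _ : op H) z]/(r%:C *: (dot z y *: y)) !dotZl.
  rewrite [dot y z]dotC -normCK mulr_ge0 ?lecR// exprn_ge0//.
- move=> z z'; rewrite -[(_ *: _ : op H) (_ z)]/(r%:C *: (dot (r%:C *: (dot z y *: y)) y *: y)).
  rewrite -[op_fun _ z]/(dot z y *: x) -[op_fun _ z']/(dot z' y *: x).
  rewrite !(dotZl, dotZr) -dotC !dot_hn.
  have -> : (hn x ^+ 2)%:C = r%:C * r%:C * (hn y ^+ 2)%:C.
    by rewrite rE exprMn expr2 !rmorphM.
  by ring.
- apply: (@le_lt_trans _ _ ((r * hn y ^+ 2)%:E)); last exact: ltry.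
  under eq_esum => w _.
    rewrite -[(_ *: _ : op H) _]/(r%:C *: (dot (l2_basis R w) y *: y)) !dotZl.
    rewrite basis_dot dot_basis [Num.conj _ * _]mulrC -normCK -nrmE -rmorphXn -rmorphM /=.
    over.
  by rewrite esumZ_ge0 ?esum_hn -?EFinM// => w; rewrite sqr_ge0.
Qed.

End trace_class.

(** * Ideals and compressions *)

Section orthogonal_projection.
Variables (R : realType) (X : choiceType) (A : set (l2 R X)).
Local Notation N := (orthocomp A).
Local Notation Pr := (orthoproj (orthocomp A)).

Lemma orthocomp_closure (z : l2 R X) : closure [set` N] z -> z \in N.
Proof.
move=> zN; apply/orthocompP => y Ay; rewrite dotC (closure_dot0 _ zN) ?rmorph0//.
by move=> m /= /orthocompP mA; rewrite dotC mA// rmorph0.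
Qed.

Lemma orthoprojP x : Pr x \in N /\ forall z, z \in N -> dot (x - Pr x) z = 0.
Proof.
have Nsub : lin_subspace [set` N].
  by split=> [|a u v /= uN vN]; [exact: rpred0|rewrite rpredD// rpredZ].
have [e [Ne eP]] := projection (@l2_complete R X) x Nsub.
apply: (@xgetPex _ 0 [set y | y \in N /\ forall z, z \in N -> dot (x - y) z = 0]).
by exists e; split; [exact: orthocomp_closure|].
Qed.

#[global] Opaque orthoproj.

Lemma orthoproj_mem x : Pr x \in N. Proof. by have [] := orthoprojP x. Qed.

Lemma orthoproj_dot x z : z \in N -> dot (Pr x) z = dot x z.
Proof.
move=> zN; have [_ /(_ _ zN)/eqP] := orthoprojP x.
by rewrite dotBl subr_eq0 eq_sym => /eqP.
Qed.

Lemma orthoproj_unique x y :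
  y \in N -> (forall z, z \in N -> dot y z = dot x z) -> Pr x = y.
Proof.
move=> yN yx; apply/eqP; rewrite -subr_eq0; apply/eqP/hn_eq0/eqP.
have dN : Pr x - y \in N by rewrite rpredB// orthoproj_mem.
by rewrite -sqrf_eq0 hn_sqr /rdot dotBl orthoproj_dot// yx// subrr.
Qed.

Lemma orthoproj_id x : x \in N -> Pr x = x.
Proof. by move=> xN; exact: orthoproj_unique. Qed.

Lemma orthoproj_linear : linear (Pr : l2 R X -> l2 R X).
Proof.
move=> a x y; apply: orthoproj_unique => [|z zN].
  by rewrite rpredD ?rpredZ ?orthoproj_mem.
apply: etrans (dot_linearl _ _ _ _) (etrans _ (esym (dot_linearl _ _ _ _))).
by congr (_ * _ + _); exact: orthoproj_dot.
Qed.

Lemma hn_orthoproj x : hn (Pr x) <= hn x.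
Proof.
have [->|p0] := eqVneq (hn (Pr x)) 0; first exact: hn_ge0.
have pp : 0 < hn (Pr x) by rewrite lt_def p0 hn_ge0.
have h : rdot (Pr x) (Pr x) = rdot x (Pr x).
  by congr complex.Re; exact: (orthoproj_dot x (orthoproj_mem x)).
by rewrite -(ler_pM2r pp) -expr2 hn_sqr h rdot_CS.
Qed.

End orthogonal_projection.

Section perp_theory.
Variables (R : realType) (V : innerType R) (A : set V).

Lemma perp_valZD a (x y : perp A) : val (a *: x + y) = a *: val x + val y.
Proof. by []. Qed.

Lemma perp_ext (x y : perp A) : val x = val y -> x = y.
Proof. exact: val_inj. Qed.

Lemma perp_dot (x y : perp A) : dot x y = dot (val x) (val y).
Proof. by []. Qed.

Lemma hn_perp (x : perp A) : hn x = hn (val x).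
Proof.
by apply/eqP; rewrite -(@eqrXn2 _ 2) ?hn_ge0// !hn_sqr.
Qed.

End perp_theory.

HB.lock Definition perp_proj (R : realType) (X : choiceType) (A : set (l2 R X)) (x : l2 R X) :
  perp A := insubd 0 (orthoproj (orthocomp A) x).

Lemma perp_projE (R : realType) (X : choiceType) (A : set (l2 R X)) (x : l2 R X) :
  val (perp_proj A x) = orthoproj (orthocomp A) x.
Proof. by rewrite perp_proj.unlock insubdK//; exact: orthoproj_mem. Qed.

Section ideal.
Variables (R : realType) (I : countType) (J : zmodClosed (Finf R I)).
Hypothesis J_ideal : two_sided_ideal J.
Local Notation F2 := (fock R I).
Local Notation Fi := (Finf R I).
Local Notation M := (MJ J).
Local Notation N := (orthocomp M).
Local Notation Pr := (orthoproj (orthocomp M)).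
Implicit Types (phi psi : Fi) (x y z : F2).

Lemma ideal_mull phi psi : psi \in J -> phi * psi \in J.
Proof. by move=> /(J_ideal phi)/andP[]. Qed.

Lemma ideal_mulr phi psi : phi \in J -> phi * psi \in J.
Proof. by move=> /(J_ideal psi)/andP[]. Qed.

Lemma Finf_ext phi psi : (forall x, phi x = psi x) -> phi = psi.
Proof. by move=> h; apply/val_inj/op_ext. Qed.

Lemma Finf_mulE phi psi x : (phi * psi) x = phi (psi x).
Proof. by []. Qed.

Lemma ideal_scale (a : R[i]) phi : phi \in J -> a *: phi \in J.
Proof.
move=> pJ; rewrite (_ : a *: phi = (a *: (1 : Fi)) * phi); first exact: ideal_mull.
exact: Finf_ext.
Qed.

Lemma Finf_linear phi : linear (phi : F2 -> F2).
Proof. exact: op_linear. Qed.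

Lemma Finf_is_conv phi : is_conv phi.
Proof. by apply: Finf_conv; exact: valP. Qed.

Lemma creation_Finf i : (creation i : op F2) \in @in_Finf R I.
Proof. by apply/in_FinfP. Qed.

Lemma vacuum_cyclic : @cyclic R I (vacuum R I).
Proof.
move=> a ha; apply/l2_ext => w; rewrite l2_zeroE -dot_basis.
have := ha w; rewrite /vacuum (push_basis R (@cat_inj _ w)) cats0.
exact.
Qed.

Lemma Finf_dense (v x : F2) (e : R) : cyclic v -> 0 < e ->
  exists phi, hn (x - phi v) < e.
Proof.
move=> vc e0.
have [||S SF h] := @cyclic_dense R I [set T | T \in @in_Finf R I] v x e _ _ vc e0.
- split=> [|a S T SF TF|S T SF TF] /=; first exact: rpred1.
    by rewrite rpredD// rpredZ.
  exact: rpredM.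
- exact: creation_Finf.
by exists (MkFinf SF).
Qed.

(** The set of products whose closure is [MJ] is not visibly stable under sums. [J1] is a subspace,
    and it has the same closure. *)
Let J1 : set F2 := [set val phi (vacuum R I) | phi in [set` J]].

Let J1_sub : lin_subspace J1.
Proof.
split.
  by exists 0 => //; exact: rpred0.
move=> a _ _ [phi /= pJ <-] [psi /= qJ <-].
by exists (a *: phi + psi) => //=; rewrite rpredD// ideal_scale.
Qed.

(** A product [phi psi] is approximated by [phi (S v)] with [S v] close to [psi], and [phi * S]
    remains in [J] since [J] is a right ideal. *)
Lemma MJ_approx v x : cyclic v -> M x -> forall e : R, 0 < e ->
  exists2 phi, phi \in J & hn (x - phi v) < e.
Proof.
move=> vc /closure_hnP xM e e0.
have e2 : 0 < e / 2 by rewrite divr_gt0.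
have [_ [phi pJ [psi ->]] h1] := xM _ e2.
have [K K0 [_ Kphi]] := op_bounded_linear (val phi).
have K1 : 0 < K + 1 by rewrite ltr_wpDl.
have [S h2] := Finf_dense psi vc (divr_gt0 e2 K1).
exists (phi * S); first exact: ideal_mulr.
rewrite -[(phi * S) v]/(phi (S v)) (_ : x - phi (S v) = (x - phi psi) + phi (psi - S v)).
  apply: le_lt_trans (hnD _ _) _; rewrite (splitr e) ltrD//.
  apply: le_lt_trans (Kphi _) _.
  rewrite ltr_pdivlMr// in h2; apply: le_lt_trans h2.
  by rewrite mulrC ler_wpM2l ?hn_ge0// lerDl.
by rewrite (lin_B (Finf_linear phi)) addrA subrK.
Qed.

Lemma MJ_closure : M = closure J1.
Proof.
apply/seteqP; split=> x.
  move=> xM; apply/closure_hnP => e e0.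
  have [phi pJ h] := MJ_approx vacuum_cyclic xM e0.
  by exists (phi (vacuum R I)) => //; exists phi.
apply: closure_subset => _ [phi pJ <-].
by exists phi => //; exists (vacuum R I).
Qed.

Lemma MJ_mem phi x : phi \in J -> M (phi x).
Proof. by move=> pJ; apply: subset_closure; exists phi => //; exists x. Qed.

Lemma orthocomp_MJP z :
  (forall phi x, phi \in J -> dot z (phi x) = 0) <-> z \in N.
Proof.
split=> [h|/orthocompP zN phi x pJ]; last by rewrite zN//; exact: MJ_mem.
apply/orthocompP => y; apply: closure_dot0 => _ [phi pJ [psi ->]].
exact: h.
Qed.

Lemma MJ_biortho x : (forall z, z \in N -> dot z x = 0) -> M x.
Proof.
move=> h; rewrite MJ_closure.
apply: (closure_orthoP (@l2_complete R _) J1_sub) => z zJ.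
apply: h; apply/orthocompP => y; rewrite MJ_closure.
exact: closure_dot0.
Qed.

Lemma MJ_invariant phi x : M x -> M (phi x).
Proof.
move=> xM; rewrite /MJ; apply/closure_hnP => e e0.
have [K K0 [_ Kphi]] := op_bounded_linear (val phi).
have K1 : 0 < K + 1 by rewrite ltr_wpDl.
move/closure_hnP : xM => /(_ _ (divr_gt0 e0 K1))[_ [psi qJ [y ->]] h].
exists (phi (psi y)).
  by exists (phi * psi); [exact: ideal_mull|exists y].
rewrite -(lin_B (Finf_linear phi)); apply: le_lt_trans (Kphi _) _.
rewrite ltr_pdivlMr// in h; apply: le_lt_trans h.
by rewrite mulrC ler_wpM2l ?hn_ge0// lerDl.
Qed.

Lemma MJ_orthoproj x : M x <-> Pr x = 0.
Proof.
split=> [xM|Px0].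
  apply: orthoproj_unique => [|z /orthocompP zN]; first exact: rpred0.
  by rewrite dot0l dotC zN ?rmorph0.
apply: MJ_biortho => z zN.
by rewrite dotC -(orthoproj_dot x zN) Px0 dot0l rmorph0.
Qed.

(** [MJ] is invariant under [phi], because [J] is a left ideal; hence the [MJ] component of [x] does
    not contribute. This makes compression multiplicative. *)
Lemma orthoproj_compr phi x : Pr (phi (Pr x)) = Pr (phi x).
Proof.
have : M (x - Pr x).
  apply/MJ_orthoproj; rewrite (lin_B (@orthoproj_linear R _ M)).
  by rewrite [Pr (Pr x)]orthoproj_id ?orthoproj_mem// subrr.
move=> /(@MJ_invariant phi)/MJ_orthoproj.
rewrite (lin_B (Finf_linear phi)) (lin_B (@orthoproj_linear R _ M)).
by move=> /subr0_eq ->.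
Qed.

Definition compress_fun phi (x : NJ J) : NJ J := perp_proj M (phi (val x)).

Lemma compress_funE phi (x : NJ J) : val (compress_fun phi x) = Pr (phi (val x)).
Proof. exact: perp_projE. Qed.

Lemma compress_bounded phi : compress_fun phi \in @bounded_operator R (NJ J).
Proof.
have [K K0 [Kl Kphi]] := op_bounded_linear (val phi).
apply: (@bounded_linear_op R (NJ J) _ K); split=> [a x y|x].
  apply: perp_ext.
  rewrite perp_valZD !compress_funE perp_valZD Kl.
  exact: orthoproj_linear.
rewrite !hn_perp compress_funE; apply: le_trans (hn_orthoproj _ _) _.
exact: Kphi.
Qed.

Definition compress phi : op (NJ J) := Op (compress_bounded phi).

Lemma compressE phi (x : NJ J) : val (compress phi x) = Pr (phi (val x)).
Proof. exact: compress_funE. Qed.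

Lemma compress_dot phi (x y : NJ J) : dot (compress phi x) y = dot (phi (val x)) (val y).
Proof. by rewrite perp_dot compressE orthoproj_dot//; exact: valP. Qed.

Lemma compressZD (a : R[i]) phi psi :
  compress (a *: phi + psi) = a *: compress phi + compress psi.
Proof.
apply: op_ext => x; apply: perp_ext; apply: etrans (compressE _ _) _.
apply: etrans (esym (perp_valZD a (compress phi x) (compress psi x))).
rewrite (compressE phi) (compressE psi).
exact: (@orthoproj_linear R _ M a (phi (val x)) (psi (val x))).
Qed.

Lemma compressM phi psi : compress (phi * psi) = compress phi * compress psi.
Proof.
apply: op_ext => x; apply: perp_ext; apply: etrans (compressE _ _) _.
apply: etrans (esym (compressE phi (compress psi x))).
by rewrite (compressE psi) orthoproj_compr.
Qed.

Lemma compress1 : compress 1 = 1.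
Proof.
by apply: op_ext => x; apply: perp_ext; rewrite compressE orthoproj_id//; exact: valP.
Qed.

Lemma compress_eq0 phi : compress phi = 0 <-> forall x, M (phi x).
Proof.
split=> [p0 x|h].
  apply/MJ_orthoproj; rewrite -orthoproj_compr.
  have := congr1 (fun T : op (NJ J) => val (T (Perp (orthoproj_mem M x)))) p0.
  by rewrite compressE.
apply: op_ext => x; apply: perp_ext; rewrite compressE.
exact/MJ_orthoproj/h.
Qed.

Section wstar_closed.
Hypothesis J_closed : closed ([set` J] : set (Finf_wstar R I)).

Lemma op_trace_family (T : op F2) (t C : l2 R (nat * seq I)%type) (phi psi : Fi)
    (D : l2 R (nat * seq I)%type) :
  (forall (phi : op F2) (D : l2 R (nat * seq I)%type),
    (forall k, slice k D = phi (slice k t)) -> op_trace (phi * T) = dot D C) ->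
  (forall k, slice k D = phi (slice k t) - psi (slice k t)) ->
  op_trace (val phi * T) - op_trace (val psi * T) = dot D C.
Proof.
move=> tC DE.
have [A AE] := ampliation (val phi) t; have [B BE] := ampliation (val psi) t.
rewrite (tC _ _ AE). rewrite (tC _ _ BE).
apply: etrans (esym (dotBl _ _ _)) _.
suff -> : D = A - B by [].
apply: slice_ext => k.
have Sl : linear (slice k : l2 R (nat * seq I)%type -> l2 R (seq I)).
  exact: slice_linear.
by rewrite (lin_B Sl) AE BE DE.
Qed.

Lemma MJ_range_mem phi : (forall x, M (phi x)) -> phi \in J.
Proof.
move=> pM; apply: J_closed; apply/sigma_closureP => n F e FD e0.
have /choice[tC HtC] (m : 'I_n) : exists q : l2 R (nat * seq I)%type * l2 R (nat * seq I)%type,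
    exists T : op F2, F m = (fun phi : Fi => op_trace (val phi * T)) /\
    forall (phi : op F2) (D : l2 R (nat * seq I)%type),
    (forall k, slice k D = phi (slice k q.1)) -> op_trace (phi * T) = dot D q.2.
  have [T /trace_class_glued[t [C tC]] FE] := FD m.
  by exists (t, C), T.
pose assoc (p : 'I_n * nat * seq I) : 'I_n * (nat * seq I) := (p.1.1, (p.1.2, p.2)).
have assoc_inj : injective assoc by move=> [[a b] c] [[a' b'] c'] [-> -> ->].
(* All [n] functionals, with a sequence of test vectors each, are packed into one vector. The
   reindexing gives the index set the form [Y * seq I] on which the factorization operates. *)
pose x : l2 R ('I_n * nat * seq I)%type := pull assoc (glue (fun m => (tC m).1)).
have xE m k : slice (m, k) x = slice k (tC m).1.
  apply/l2_ext => u; rewrite sliceE (pullE assoc_inj) /assoc /= sliceE.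
  by rewrite -(slice_glue_fin (fun m => (tC m).1) m) sliceE.
pose s := \sum_m hn (tC m).2 + 1.
have s0 : 0 < s by rewrite ltr_wpDl// sumr_ge0// => m _; exact: hn_ge0.
have [|||||_ [_ [psi /= qJ <-] <-] [D [DE De]]] := @approx_family R I _ x phi
  [set op_fun S | S in [set val psi | psi in [set` J]]] (Finf_is_conv phi) _ _ _ _ (e / s) _.
- by move=> _ [_ [psi _ <-] <-]; exact: Finf_is_conv.
- by exists (val (0 : Fi)), (val (0 : Fi)) => //; exists 0 => //; exact: rpred0.
- move=> _ [_ [psi _ <-] <-].
  by rewrite (lin_0 (Finf_linear phi)) (lin_0 (Finf_linear psi)) subrr.
- move=> v vc eps eps0; have [psi qJ h] := MJ_approx vc (pM v) eps0.
  by exists (val psi) => //; exists (val psi) => //; exists psi.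
- by rewrite divr_gt0.
exists psi => // m; have [T [-> HT]] := HtC m.
pose pm (p : nat * seq I) : 'I_n * nat * seq I := ((m, p.1), p.2).
have pm_inj : injective pm by move=> [a b] [a' b'] [-> ->].
rewrite (op_trace_family (D := pull pm D) HT); last first.
  move=> k; rewrite -xE -DE; apply/l2_ext => u.
  by rewrite !sliceE (pullE pm_inj).
apply: le_lt_trans (nrm_dot _ _) _.
apply: (@le_lt_trans _ _ (hn D * s)); last by rewrite -ltr_pdivlMr.
apply: ler_pM (hn_ge0 _) (hn_ge0 _) (hn_pull pm_inj _) _.
rewrite /s (bigD1 m)//= -addrA lerDl addr_ge0// sumr_ge0// => j _; exact: hn_ge0.
Qed.

Lemma compress_eq0_mem phi : compress phi = 0 <-> phi \in J.
Proof.
rewrite compress_eq0; split=> [|pJ x]; [exact: MJ_range_mem|exact: MJ_mem].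
Qed.

End wstar_closed.

Lemma preannihilator_compress f : preannihilator J f ->
  exists x y : NJ J, forall phi, f phi = dot (compress phi x) y.
Proof.
move=> [[T /trace_class_glued[t [C tC]] ->] fJ].
have [t0|t0] := eqVneq t 0.
  exists 0, 0 => phi; rewrite dot0r (tC (val phi) 0) ?dot0l// => k.
  by rewrite t0 (lin_0 (@slice_linear R nat _ k)) (lin_0 (Finf_linear phi)).
have [V [v [g [Vl Viso tV Vconv vc]]]] := wandering_model t0.
have Vb : bounded_linear V 1 by split=> // a; rewrite mul1r Viso.
pose z := adj V C.
have fE phi : op_trace (val phi * T) = dot (phi v) z.
  rewrite (tC (val phi) (V (phi v))) ?(adjP Vb)// => k.
  exact: (model_intertwine k tV Vconv (Finf_is_conv phi)).
(* For [phi] in [J], the adjoint of [phi] at [z] is orthogonal to every shift of [v], since [phi]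
   times a word is again in [J] and the functional vanishes there. As [v] is cyclic, this adjoint
   kills [z]. *)
have zN : z \in N.
  apply/orthocomp_MJP => phi x pJ.
  have [K K0 Kphi] := op_bounded_linear (val phi).
  have aP := @adjPr R _ _ (val phi : F2 -> F2) K Kphi.
  rewrite (aP x z) (_ : adj _ z = 0) ?dot0l//.
  apply: vc => w; rewrite -(aP _ z) dotC -word_opE.
  have wF : word_op R w \in @in_Finf R I.
    apply/in_FinfP => A Aa _ Ac; exact: word_op_subalgebra.
  have E : dot (phi (word_op R w v)) z = 0.
    rewrite -(Finf_mulE phi (MkFinf wF)) -fE.
    by apply: fJ; exact: ideal_mulr.
  by rewrite E rmorph0.
exists (Perp (orthoproj_mem M v)), (Perp zN) => phi.
rewrite fE compress_dot /= -(orthoproj_dot _ zN) -orthoproj_compr.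
by rewrite orthoproj_dot.
Qed.

Lemma vector_functional_preannihilator (x y : NJ J) :
  preannihilator J (fun phi => dot (compress phi x) y).
Proof.
split; last first.
  move=> phi pJ; suff -> : compress phi = 0 by rewrite dot0l.
  by apply/compress_eq0 => u; exact: MJ_mem.
have [T Ttc TE] := rank_one_trace_class (val x) (val y).
exists T => //; apply/funext => phi.
by rewrite compress_dot TE.
Qed.

End ideal.

(** * Commutant lifting *)

Section lifting.
Variables (R : realType) (I : choiceType) (k : nat).
Local Notation X := ('I_k * seq I)%type.
Local Notation H := (l2 R X).
Local Notation L := (l2 R (I * X)%type).

Definition right_index (p : I * X) : X := (p.2.1, rcons p.2.2 p.1).

Lemma right_index_inj : injective right_index.
Proof.
move=> [i [j w]] [i' [j' w']] [-> /eqP].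
by rewrite eqseq_rcons => /andP[/eqP -> /eqP ->].
Qed.

Definition right_split (x : H) : L := pull right_index x.
Definition right_annihilate (i : I) (x : H) : H := slice i (right_split x).

Let Si (i : I) : linear (slice i : L -> H). Proof. exact: slice_linear. Qed.
Let Pl : linear right_split. Proof. exact/pull_linear/right_index_inj. Qed.

Lemma right_annihilate_linear i : linear (right_annihilate i).
Proof. by move=> a x y; rewrite /right_annihilate Pl Si. Qed.

Variable M : R.
Hypothesis M0 : 0 <= M.

(** Partially defined operators of norm at most [M] are encoded by their graphs, so that extension
    is inclusion; the norm bound already makes them single-valued. *)
Definition coinvariant_graph (G : set (H * H)) : Prop :=
  [/\ lin_subspace G, forall x z, G (x, z) -> hn z <= M * hn x &
      forall i x z, G (x, z) -> G (right_annihilate i x, right_annihilate i z)].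

Lemma graph_functional G x z z' : coinvariant_graph G -> G (x, z) -> G (x, z') -> z = z'.
Proof.
move=> [Gs Gc _] Gz Gz'; apply/eqP; rewrite -subr_eq0; apply/eqP/hn_eq0/eqP.
rewrite eq_le hn_ge0 andbT.
have := Gc _ _ (lin_subspaceB Gs Gz Gz' : G (x - x, z - z')).
by rewrite subrr hn0 mulr0.
Qed.

Lemma maximal_graph G0 : coinvariant_graph G0 -> exists G,
  [/\ coinvariant_graph G, G0 `<=` G &
    forall G', coinvariant_graph G' -> G `<=` G' -> G' `<=` G].
Proof.
move=> G0g.
pose P (G : set (H * H)) := G = set0 \/ (coinvariant_graph G /\ G0 `<=` G).
have [F FP Ft|G [PG Gmax]] := @Zorn_bigcup _ P.
  have [[G [FG [p Gp]]]|none] := pselect (exists G, F G /\ G !=set0); last first.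
    left; apply/seteqP; split=> // p [G FG Gp]; exfalso; apply: none.
    by exists G; split=> //; exists p.
  have good G' : F G' -> forall p, G' p -> coinvariant_graph G' /\ G0 `<=` G'.
    by move=> /FP[->//|].
  right; split; last first.
    by move=> q /(good _ FG _ Gp).2 Gq; exists G.
  split.
  - split; first by exists G => //; have [[[]]] := good _ FG _ Gp.
    move=> a u v [G1 F1 Gu] [G2 F2 Gv].
    have [le|le] := Ft _ _ F1 F2.
      exists G2 => //; have [[[_ h] _ _] _] := good _ F2 _ Gv.
      by apply: h => //; exact: le.
    exists G1 => //; have [[[_ h] _ _] _] := good _ F1 _ Gu.
    by apply: h => //; exact: le.
  - by move=> x z [G1 F1 Gu]; have [[_ h _] _] := good _ F1 _ Gu; exact: h.
  - move=> i x z [G1 F1 Gu]; exists G1 => //.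
    by have [[_ _ h] _] := good _ F1 _ Gu; exact: h.
have G00 : G0 0 by have [[]] := G0g.
case: PG => [G_eq0|[Gg G0G]].
  exfalso; apply: (Gmax G0); last by right; split.
  by rewrite G_eq0; split=> [p []|h]; exact: (h _ G00).
exists G; split=> // G' G'g GG'; apply: contrapT => G'G.
by apply: (Gmax G'); [split|right; split=> //; exact: subset_trans GG'].
Qed.

Section maximal.
Variable G : set (H * H).
Hypotheses (Gg : coinvariant_graph G)
  (Gmax : forall G', coinvariant_graph G' -> G `<=` G' -> G' `<=` G).

Let Gs : lin_subspace G. Proof. by have [] := Gg. Qed.
Let Gc x z : G (x, z) -> hn z <= M * hn x. Proof. by have [_ h _] := Gg; exact: h. Qed.
Let Ga i x z : G (x, z) -> G (right_annihilate i x, right_annihilate i z).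
Proof. by have [_ _ h] := Gg; exact: h. Qed.

(** The part of [z] supported on empty words, which all right annihilations lose. *)
Let vac (z : H) : H := z - push right_index (right_split z).

Let Pul : linear (push right_index : L -> H).
Proof. exact/push_linear/right_index_inj. Qed.

Let split_push (Z : L) : right_split (push right_index Z) = Z.
Proof. exact/pushK/right_index_inj. Qed.

Let split_vac z : right_split (vac z) = 0.
Proof. by rewrite /vac (lin_B Pl) split_push subrr. Qed.

Let vac_linear : linear vac.
Proof. by move=> a u v; rewrite /vac Pl Pul scalerBr opprD addrACA. Qed.

Let hn_split x : hn (right_split x) <= hn x.
Proof. exact/hn_pull/right_index_inj. Qed.

Let hn_ortho (Z : L) (e : H) : right_split e = 0 ->
  hn (push right_index Z + e) ^+ 2 = hn Z ^+ 2 + hn e ^+ 2.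
Proof.
move=> e0; rewrite dot_eq0_pythag ?(hn_push right_index_inj)//.
by rewrite (push_dot right_index_inj) -/(right_split e) e0 dot0r.
Qed.

Let hn_vac z : hn z ^+ 2 = hn (right_split z) ^+ 2 + hn (vac z) ^+ 2.
Proof. by rewrite -(hn_ortho _ (split_vac z)) /vac addrC subrK. Qed.

Let family_le (y : H) (Z : L) : (forall i, G (right_annihilate i y, slice i Z)) ->
  hn Z ^+ 2 <= M ^+ 2 * hn y ^+ 2.
Proof.
move=> yZ.
have bd s : uniq s -> \sum_(i <- s) hn (slice i Z) ^+ 2 <= M ^+ 2 * hn y ^+ 2.
  move=> us; apply: (@le_trans _ _ (M ^+ 2 * \sum_(i <- s) hn (right_annihilate i y) ^+ 2)).
    rewrite mulr_sumr; apply: ler_sum => i _; rewrite -exprMn.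
    exact/ler_sqr_hn/Gc/yZ.
  rewrite ler_wpM2l ?sqr_ge0//; apply: le_trans (sum_hn_slice (right_split y) us) _.
  exact/ler_sqr_hn/hn_split.
have <- : glue (fun i => slice i Z) = Z.
  by apply: slice_ext => i; rewrite (slice_glue bd).
exact: hn_glue bd.
Qed.

(* One-step extension: a vector [y] all of whose right annihilations are in the
   domain of [G] only lacks the vacuum component of its image, which is provided
   by [contraction_extension] for the defect form [M^2 |x|^2 - |Z|^2]. *)
Lemma graph_step (y : H) : (forall i, exists z, G (right_annihilate i y, z)) ->
  exists z, G (y, z).
Proof.
move=> /choice[c cG].
pose Z : L := glue c.
have cb s : uniq s -> \sum_(i <- s) hn (c i) ^+ 2 <= M ^+ 2 * hn y ^+ 2.
  move=> us; apply: (@le_trans _ _ (M ^+ 2 * \sum_(i <- s) hn (right_annihilate i y) ^+ 2)).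
    rewrite mulr_sumr; apply: ler_sum => i _; rewrite -exprMn.
    exact/ler_sqr_hn/Gc/cG.
  rewrite ler_wpM2l ?sqr_ge0//; apply: le_trans (sum_hn_slice (right_split y) us) _.
  exact/ler_sqr_hn/hn_split.
have ZG i : G (right_annihilate i y, slice i Z) by rewrite (slice_glue cb).
pose B (p q : H * L) := M ^+ 2 * rdot p.1 q.1 - rdot p.2 q.2.
pose E : set (H * L * H) :=
  [set u | exists x z, G (x, z) /\ u = ((x, right_split z), vac z)].
have [|||||||e [He eB]] := @contraction_extension R (H * L)%type H (@l2_complete R _) B
   _ _ _ E _ _ _ (y, Z) _.
- by move=> p q; rewrite /B rdotC [rdot p.2 _]rdotC.
- by move=> p q r; rewrite /B /= !rdotDl; ring.
- by move=> t p q; rewrite /B /= !rdotZl; ring.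
- exists 0, 0; split; first by have [] := Gs.
  by rewrite (lin_0 Pl) (lin_0 vac_linear).
- move=> a _ _ [x [z [Gxz ->]]] [x' [z' [Gxz' ->]]].
  exists (a *: x + x'), (a *: z + z'); split.
    by have [_ h] := Gs; exact: (h a _ _ Gxz Gxz').
  by rewrite Pl vac_linear.
(* The squared norm of [z] splits into those of its annihilations and of its vacuum part, so this
   bound is the contractivity of [G] rewritten. *)
- move=> _ _ [x [z [Gxz [-> ->]]]]; rewrite /B /= -!hn_sqr.
  have := ler_sqr_hn (Gc Gxz); rewrite exprMn hn_vac; lra.
- move=> _ _ [x [z [Gxz [-> _]]]]; rewrite /B /= -!hn_sqr subr_ge0.
  apply: family_le => i.
  rewrite (lin_B (Si i)) (lin_B (right_annihilate_linear i)).
  exact: (lin_subspaceB Gs (ZG i) (Ga i Gxz)).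
have e0 : right_split e = 0.
  apply/hn_eq0/eqP; rewrite eq_le hn_ge0 andbT.
  apply/ler_addgt0Pr => eps /He[_ [[x [z [_ ->]]] /= h]]; rewrite add0r.
  apply: le_trans (ltW h); apply: le_trans (hn_split _).
  by rewrite (lin_B Pl) split_vac subr0.
have {}eB x z : G (x, z) ->
    hn (e - vac z) ^+ 2 <= M ^+ 2 * hn (y - x) ^+ 2 - hn (Z - right_split z) ^+ 2.
  move=> Gxz; rewrite (hn_sqr (y - x)) (hn_sqr (Z - _)).
  by apply: (eB (x, right_split z) (vac z)); exists x, z.
(* The image of [y] has the prescribed annihilations [Z] and the vacuum part [e]. *)
pose y0 : H := push right_index Z + e.
pose G' : set (H * H) := [set u | exists (l : R[i]) x z,
  G (x, z) /\ u = (x + l *: y, z + l *: y0)].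
have GG' : G `<=` G'.
  by move=> [x z] Gxz; exists 0, x, z; split=> //; rewrite !scale0r !addr0.
have y0P x z : G (x, z) -> hn (y0 - z) ^+ 2 <= M ^+ 2 * hn (y - x) ^+ 2.
  move=> Gxz; have -> : y0 - z = push right_index (Z - right_split z) + (e - vac z).
    by rewrite (lin_B Pul) /y0 /vac opprB addrACA; congr (_ + _); rewrite addrA addNr sub0r.
  rewrite hn_ortho; last by rewrite (lin_B Pl) split_vac e0 subr0.
  by have := eB _ _ Gxz; lra.
exists y0; apply: (Gmax (G' := G')) => //; last first.
  by exists 1, 0, 0; split; [have [] := Gs|rewrite !scale1r !add0r].
split.
- split; first by apply: GG'; have [] := Gs.
  move=> a _ _ [l [x [z [Gxz ->]]]] [l' [x' [z' [Gxz' ->]]]].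
  exists (a * l + l'), (a *: x + x'), (a *: z + z'); split.
    by have [_ h] := Gs; exact: (h a _ _ Gxz Gxz').
  by congr (_, _); rewrite /= scalerDr scalerA scalerDl addrACA.
- move=> _ _ [l [x [z [Gxz [-> ->]]]]].
  have [->|l0] := eqVneq l 0; first by rewrite !scale0r !addr0; exact: Gc.
  have Gl : G ((- l^-1) *: x, (- l^-1) *: z) by exact: (lin_subspaceZ (- l^-1) Gs Gxz).
  have eqn (u v : H) : u + l *: v = l *: (v - (- l^-1) *: u).
    by rewrite scaleNr opprK scalerDr scalerA divff// scale1r addrC.
  rewrite !eqn !hnZ mulrCA ler_wpM2l ?nrm_ge0//.
  rewrite -(@ler_pXn2r _ 2)// ?nnegrE ?mulr_ge0 ?hn_ge0//.
  by rewrite exprMn; exact: y0P.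
(* Annihilation of a letter sends [y] into the domain of [G], so the result lies in [G] itself. *)
- move=> i _ _ [l [x [z [Gxz [-> ->]]]]]; apply: GG'.
  rewrite !(lin_D (right_annihilate_linear i)) !(lin_Z (right_annihilate_linear i)).
  have -> : right_annihilate i y0 = slice i Z.
    by rewrite /right_annihilate /y0 (lin_D Pl) e0 addr0 split_push.
  have := Ga i Gxz; have := lin_subspaceZ l Gs (ZG i) => h1 h2.
  by have [_ h] := Gs; have := h 1 _ _ h2 h1; rewrite scale1r.
Qed.

Lemma right_annihilate_basis i (j : 'I_k) w i' :
  right_annihilate i (l2_basis R (j, rcons w i')) = (i == i')%:R *: l2_basis R (j, w).
Proof.
apply/l2_ext => -[j' u]; rewrite sliceE (pullE right_index_inj) l2_scaleE !l2_basisE.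
rewrite /right_index /= !xpair_eqE eqseq_rcons.
case: (i == i'); rewrite ?andbF ?mul0r ?mul1r ?andbT//.
Qed.

Lemma right_annihilate_vacuum i (j : 'I_k) :
  right_annihilate i (l2_basis R (j, [::])) = 0.
Proof.
apply/l2_ext => -[j' u]; rewrite sliceE (pullE right_index_inj) l2_basisE.
by rewrite /right_index /= xpair_eqE -size_eq0 size_rcons andbF.
Qed.

(** By [graph_step], induction on the last letter: every right annihilation of a basis vector is
    zero or a basis vector at a shorter word. *)
Lemma maximal_graph_basis b : exists z, G (l2_basis R b, z).
Proof.
have G0 : G (0, 0) by have [] := Gs.
case: b => j w; elim/last_ind: w => [|w i [z Gz]]; apply: graph_step => i'.
  by exists 0; rewrite right_annihilate_vacuum.
exists ((i' == i)%:R *: z); rewrite right_annihilate_basis.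
exact: (lin_subspaceZ _ Gs Gz).
Qed.

(** The values [c b] of the maximal graph on the basis have the frame bound [M], so the adjoint of
    the extended operator can be defined directly by [frame_coef]. Invariance under annihilations
    dualizes to commutation with right creations. *)
Lemma maximal_graph_adjoint : exists T : H -> H,
  [/\ bounded_linear T M,
      forall i x, T (push (fun b => right_index (i, b)) x) =
                  push (fun b => right_index (i, b)) (T x) &
      forall x z, G (x, z) -> forall u, dot (T u) x = dot u z].
Proof.
have /choice[c cG] := maximal_graph_basis.
have sumG (a : X -> R[i]) s :
    G (\sum_(b <- s) a b *: l2_basis R b, \sum_(b <- s) a b *: c b).
  elim: s => [|b s IH]; first by rewrite !big_nil; have [] := Gs.
  by rewrite !big_cons; have [_ h] := Gs; exact: (h (a b) _ _ (cG b) IH).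
have cM : upper_frame c M.
  move=> a s us; rewrite -(hn_finite a us) -exprMn.
  exact/ler_sqr_hn/Gc/sumG.
pose T := frame_coef c; have TE x b : T x b = dot x (c b) by exact: (frame_coefE cM).
have Tb : bounded_linear T M by exact: frame_coef_bounded.
have ri_inj i : injective (fun b : X => right_index (i, b)).
  by move=> b b' /right_index_inj[].
exists T; split=> //.
- move=> i x; apply/l2_ext => b; rewrite TE (push_dot (ri_inj i)).
  have annE y : pull (fun b => right_index (i, b)) y = right_annihilate i y.
    apply/l2_ext => b'; rewrite (pullE (ri_inj i)) sliceE.
    by rewrite (pullE right_index_inj).
  have [[b' <-]|nb] := pselect (exists b', right_index (i, b') = b).
    rewrite (pushE (ri_inj i)) TE; congr (dot x _).
    apply: (graph_functional Gg (x := l2_basis R b')); last exact: cG.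
    have := Ga i (cG (right_index (i, b'))).
    by rewrite -!annE (pull_basis R (ri_inj i)).
  have nb' b' : right_index (i, b') != b by apply/eqP => h; apply: nb; exists b'.
  rewrite (push_out (ri_inj i))// (_ : pull _ _ = 0) ?dot0r//.
  apply: (graph_functional Gg (x := 0)); last by have [] := Gs.
  have := Ga i (cG b).
  by rewrite -!annE (pull_basis_out R (ri_inj i)).
(* The duality relation holds on basis vectors; it passes to all of [G] because these are total and
   because [G] is contractive. *)
- pose D : set H := [set x | exists z, G (x, z) /\ forall u, dot (T u) x = dot u z].
  have Ds : lin_subspace D.
    split; first by exists 0; split; [have [] := Gs|move=> u; rewrite !dot0r].
    move=> a x x' [z [Gz hz]] [z' [Gz' hz']].
    exists (a *: z + z'); split; first by have [_ h] := Gs; exact: (h a _ _ Gz Gz').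
    by move=> u; rewrite !dotDr !dotZr hz hz'.
  have Ddense x : closure D x.
    apply: (closure_orthoP (@l2_complete R _) Ds) => z zD.
    rewrite (_ : z = 0) ?dot0l//; apply/l2_ext => b.
    rewrite l2_zeroE -dot_basis zD//; exists (c b); split=> // u.
    by rewrite dot_basis TE.
  move=> x z Gxz u; apply/eqP; rewrite -subr_eq0 -normr_eq0 -nrmE.
  rewrite -[0]/(0%:C) (inj_eq (@complexI _)) eq_le nrm_ge0 andbT.
  apply/ler_addgt0Pr => eps eps0; rewrite add0r.
  pose K := hn (T u) + hn u * M + 1.
  have K0 : 0 < K by rewrite ltr_wpDl// addr_ge0 ?mulr_ge0 ?hn_ge0.
  have /closure_hnP/(_ _ (divr_gt0 eps0 K0))[x' [z' [Gz' hz']] h] := Ddense x.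
  have -> : dot (T u) x - dot u z = dot (T u) (x - x') - dot u (z - z').
    by rewrite !dotBr hz' opprB subrKA.
  have zz : hn (z - z') <= M * hn (x - x').
    exact: (Gc (lin_subspaceB Gs Gxz Gz')).
  rewrite (le_trans (nrmD _ _))//.
  have -> : nrm (- dot u (z - z')) = nrm (dot u (z - z')) by rewrite /nrm normrN.
  apply: (@le_trans _ _ (hn (T u) * hn (x - x') + hn u * (M * hn (x - x')))).
    rewrite lerD ?nrm_dot//; apply: le_trans (nrm_dot _ _) _.
    by rewrite ler_wpM2l ?hn_ge0.
  rewrite ltr_pdivlMr// in h; apply: le_trans (ltW h).
  rewrite mulrA -mulrDl mulrC ler_wpM2l ?hn_ge0// /K lerDl//.
Qed.

End maximal.

(* Commutant lifting, for the adjoints: a contractive graph that is invariant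
   under the right annihilation operators extends to the whole space. *)
Lemma commutant_lifting G0 : coinvariant_graph G0 -> exists T : H -> H,
  [/\ bounded_linear T M,
      forall i x, T (push (fun b => right_index (i, b)) x) =
                  push (fun b => right_index (i, b)) (T x) &
      forall x z, G0 (x, z) -> forall u, dot (T u) x = dot u z].
Proof.
move=> /maximal_graph[G [Gg G0G Gmax]].
have [T [Tb Tr TG]] := maximal_graph_adjoint Gg Gmax.
by exists T; split=> // x z /G0G; exact: TG.
Qed.

End lifting.

(** * Matrix norms and the quotient *)

Section matrix_norm.
Variables (R : realType) (V : innerType R) (k : nat).
Implicit Types (x : 'I_k -> V) (T : 'M[op V]_k).

Definition tuple_norm x : R := Num.sqrt (\sum_j hn (x j) ^+ 2).
Definition mx_apply T x : 'I_k -> V := fun i => \sum_j T i j (x j).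

Lemma mxnormE T :
  mxnorm T = sup [set tuple_norm (mx_apply T x) | x in [set x | tuple_norm x <= 1]].
Proof. by []. Qed.

Lemma tuple_norm_ge0 x : 0 <= tuple_norm x. Proof. exact: sqrtr_ge0. Qed.

Lemma tuple_norm_sqr x : tuple_norm x ^+ 2 = \sum_j hn (x j) ^+ 2.
Proof. by rewrite sqr_sqrtr// sumr_ge0// => j _; exact: sqr_ge0. Qed.

Lemma tuple_norm_le x (M : R) : 0 <= M ->
  (tuple_norm x <= M) = (\sum_j hn (x j) ^+ 2 <= M ^+ 2).
Proof. by move=> M0; rewrite -tuple_norm_sqr ler_pXn2r ?nnegrE ?tuple_norm_ge0. Qed.

Lemma hn_le_tuple_norm x j : hn (x j) <= tuple_norm x.
Proof.
rewrite -(@ler_pXn2r _ 2) ?nnegrE ?hn_ge0 ?tuple_norm_ge0// tuple_norm_sqr.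
by rewrite (bigD1 j)//= lerDl sumr_ge0// => i _; exact: sqr_ge0.
Qed.

Lemma tuple_normZ (a : R[i]) x : tuple_norm (fun j => a *: x j) = nrm a * tuple_norm x.
Proof.
apply/eqP; rewrite -(@eqrXn2 _ 2) ?mulr_ge0 ?tuple_norm_ge0 ?nrm_ge0//.
rewrite exprMn !tuple_norm_sqr mulr_sumr; apply/eqP/eq_bigr => j _.
by rewrite hnZ exprMn.
Qed.

Lemma tuple_norm0 : tuple_norm (fun=> 0 : V) = 0.
Proof.
apply/eqP; rewrite -sqrf_eq0 tuple_norm_sqr big1// => j _.
by rewrite hn0 expr0n.
Qed.

Lemma tuple_norm_eq0 x : tuple_norm x = 0 -> x = fun=> 0.
Proof.
move=> x0; apply/funext => j; apply: hn_eq0; apply/eqP; rewrite eq_le hn_ge0 andbT.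
by rewrite -x0 hn_le_tuple_norm.
Qed.

Lemma mx_applyZ T (a : R[i]) x :
  mx_apply T (fun j => a *: x j) = fun i => a *: mx_apply T x i.
Proof.
apply/funext => i; rewrite /mx_apply scaler_sumr; apply: eq_bigr => j _.
exact: (lin_Z (@op_linear R V (T i j))).
Qed.

Lemma mx_apply_bounded T : exists2 K : R, 0 <= K &
  forall x, tuple_norm (mx_apply T x) <= K * tuple_norm x.
Proof.
have /choice[K HK] (p : 'I_k * 'I_k) : exists K : R,
    0 <= K /\ forall u : V, hn (T p.1 p.2 u) <= K * hn u.
  by have [K K0 [_ h]] := op_bounded_linear (T p.1 p.2); exists K.
pose Ki i := \sum_j K (i, j).
have Ki0 i : 0 <= Ki i by apply: sumr_ge0 => j _; have [] := HK (i, j).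
exists (Num.sqrt (\sum_i Ki i ^+ 2)); first exact: sqrtr_ge0.
move=> x; rewrite tuple_norm_le ?mulr_ge0 ?sqrtr_ge0 ?tuple_norm_ge0//.
rewrite exprMn sqr_sqrtr; last by apply: sumr_ge0 => i _; exact: sqr_ge0.
rewrite mulr_suml; apply: ler_sum => i _; rewrite -exprMn.
apply: ler_sqr_hn; rewrite /mx_apply /Ki mulr_suml.
elim/big_rec2: _ => [|j a b _ h]; first by rewrite hn0.
apply: le_trans (hnD _ _) _; rewrite lerD//.
have [K0 HKj] := HK (i, j).
by apply: le_trans (HKj _) _; rewrite ler_wpM2l// hn_le_tuple_norm.
Qed.

Let S T := [set tuple_norm (mx_apply T x) | x in [set x | tuple_norm x <= 1]].

Let S_sup T : has_sup (S T).
Proof.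
split.
  by exists (tuple_norm (mx_apply T (fun=> 0))), (fun=> 0) => //=; rewrite tuple_norm0.
have [K K0 HK] := mx_apply_bounded T; exists K => _ [x /= x1 <-].
by apply: le_trans (HK x) _; rewrite -[leRHS]mulr1 ler_wpM2l.
Qed.

Lemma mxnorm_ge0 T : 0 <= mxnorm T.
Proof.
rewrite mxnormE; apply: (@le_trans _ _ (tuple_norm (mx_apply T (fun=> 0)))).
  exact: tuple_norm_ge0.
by apply: sup_ubound; [have [] := S_sup T|exists (fun=> 0) => //=; rewrite tuple_norm0].
Qed.

Lemma mxnorm_le T (M : R) :
  0 <= M -> (forall x, tuple_norm (mx_apply T x) <= M * tuple_norm x) -> mxnorm T <= M.
Proof.
move=> M0 TM; rewrite mxnormE; apply: ge_sup; first by have [] := S_sup T.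
move=> _ [x /= x1 <-]; apply: le_trans (TM x) _.
by rewrite -[leRHS]mulr1 ler_wpM2l.
Qed.

Lemma le_mxnorm T x : tuple_norm (mx_apply T x) <= mxnorm T * tuple_norm x.
Proof.
have [x0|x0] := eqVneq (tuple_norm x) 0.
  have -> : mx_apply T x = fun=> 0.
    apply/funext => i; rewrite /mx_apply big1// => j _.
    by rewrite (tuple_norm_eq0 x0); exact: (lin_0 (@op_linear R V (T i j))).
  by rewrite tuple_norm0 mulr_ge0 ?mxnorm_ge0 ?tuple_norm_ge0.
have xp : 0 < tuple_norm x by rewrite lt_def x0 tuple_norm_ge0.
pose a : R[i] := ((tuple_norm x)^-1)%:C.
have na : nrm a = (tuple_norm x)^-1 by rewrite nrm_real ger0_norm ?invr_ge0 ?tuple_norm_ge0.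
rewrite -ler_pdivrMr// mulrC -na -tuple_normZ -mx_applyZ mxnormE.
apply: sup_ubound; first by have [] := S_sup T.
by exists (fun j => a *: x j) => //=; rewrite tuple_normZ na mulVf.
Qed.

End matrix_norm.

Section tuples_l2.
Variables (R : realType) (k : nat) (X : choiceType).
Local Notation H := (l2 R ('I_k * X)%type).

Lemma tuple_norm_slice (x : H) : tuple_norm (fun j => slice j x) = hn x.
Proof. by rewrite /tuple_norm -hn_slices_fin sqrtr_sqr ger0_norm ?hn_ge0. Qed.

Lemma tuple_norm_glue (x : 'I_k -> l2 R X) : tuple_norm x = hn (glue x).
Proof.
by rewrite -tuple_norm_slice; congr tuple_norm; apply/funext => j; rewrite slice_glue_fin.
Qed.

Lemma dot_slices_fin (x z : H) : dot x z = \sum_j dot (slice j x) (slice j z).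
Proof.
have P (u : H) : (hn u ^+ 2)%:C = \sum_j (hn (slice j u) ^+ 2)%:C :> R[i].
  by rewrite hn_slices_fin rmorph_sum.
rewrite polarization !P !mulr_sumr -!big_split /= mulr_sumr; apply: eq_bigr => j _.
rewrite [RHS]polarization.
have Sl : linear (slice j : H -> l2 R X) by exact: slice_linear.
by rewrite !(lin_D Sl) !(lin_N Sl) !(lin_Z Sl).
Qed.

Definition inject (j : 'I_k) (u : l2 R X) : H := push (pair j) u.

Lemma inject_bounded j : bounded_linear (inject j) 1.
Proof. exact/push_bounded/pair_inj. Qed.

Lemma slice_inject i j u : slice i (inject j u) = (i == j)%:R *: u.
Proof.
apply/l2_ext => v; rewrite sliceE l2_scaleE /inject; have [->|ij] := eqVneq i j.
  by rewrite (pushE (@pair_inj _ _ j)) mul1r.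
rewrite (push_out (@pair_inj _ _ j)) ?mul0r// => v'.
by rewrite xpair_eqE eq_sym (negPf ij).
Qed.

Lemma dot_inject j u (x : H) : dot (inject j u) x = dot u (slice j x).
Proof. exact: (push_dot (@pair_inj _ _ j)). Qed.

Lemma sum_inject (x : 'I_k -> l2 R X) : \sum_j inject j (x j) = glue x.
Proof.
apply: slice_ext => i; rewrite slice_glue_fin.
have Sl : linear (slice i : H -> l2 R X) by exact: slice_linear.
rewrite (lin_sum Sl) (bigD1 i)//= big1 ?addr0; first by rewrite slice_inject eqxx scale1r.
by move=> j ji; rewrite slice_inject eq_sym (negPf ji) scale0r.
Qed.

End tuples_l2.

(** * Lifting a matrix of compressions without increasing the norm *)

Section lift_representative.
Variables (R : realType) (I : countType) (J : zmodClosed (Finf R I)) (k : nat).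
Hypothesis J_ideal : two_sided_ideal J.
Hypothesis J_closed : closed ([set` J] : set (Finf_wstar R I)).
Local Notation F2 := (l2 R (seq I)).
Local Notation H := (l2 R ('I_k * seq I)%type).
Local Notation N := (orthocomp (MJ J)).
Variable phi : 'M[Finf R I]_k.
Implicit Types (i j : 'I_k) (x z u : F2).

Let ad i j : F2 -> F2 := adj (phi i j : F2 -> F2).

Let ad_props i j : linear (ad i j) /\ forall z u, dot (ad i j z) u = dot z (phi i j u).
Proof.
have [K K0 Kp] := op_bounded_linear (val (phi i j)).
by split; [have [] := adj_bounded Kp K0|move=> z u; rewrite (adjPr Kp)].
Qed.
Let adl i j : linear (ad i j). Proof. by have [] := ad_props i j. Qed.
Let adP i j z u : dot (ad i j z) u = dot z (phi i j u).
Proof. by have [_] := ad_props i j. Qed.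

Let ad_mem i j z : z \in N -> ad i j z \in N.
Proof.
move=> /(orthocomp_MJP J z) zN; apply/orthocomp_MJP => psi x qJ.
rewrite adP; have := zN (phi i j * psi) x (ideal_mull J_ideal (phi i j) qJ).
by rewrite Finf_mulE.
Qed.

Let rann (a : I) : F2 -> F2 := pull (fun w : seq I => rcons w a).

Let rann_dot a z u : dot (rann a z) u = dot z (rcreate a u).
Proof. exact: (pull_dot (@rcons_injl I a)). Qed.

Let rann_linear a : linear (rann a).
Proof. exact/pull_linear/rcons_injl. Qed.

Let Finf_rcreate (psi : Finf R I) a x : psi (rcreate a x) = rcreate a (psi x).
Proof. by apply: Finf_right_commuting; exact: valP. Qed.

Let rann_mem a z : z \in N -> rann a z \in N.
Proof.
move=> /(orthocomp_MJP J z) zN; apply/orthocomp_MJP => psi x qJ.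
by rewrite rann_dot -Finf_rcreate zN.
Qed.

Let rann_ad a i j z : ad i j (rann a z) = rann a (ad i j z).
Proof.
apply: dot_ext => u; apply: etrans (adP _ _ _ _) _; apply: etrans (rann_dot _ _ _) _.
rewrite -Finf_rcreate; apply: etrans (esym (adP _ _ _ _)) _.
exact: esym (rann_dot _ _ _).
Qed.

Let slice_rann a j (x : H) : slice j (right_annihilate a x) = rann a (slice j x).
Proof.
apply/l2_ext => w; rewrite !sliceE (pullE (@right_index_inj I k)).
by rewrite (pullE (@rcons_injl I a)) sliceE.
Qed.

Let Sl j : linear (slice j : H -> F2). Proof. exact: slice_linear. Qed.

Let C : 'M[op (NJ J)]_k := map_mx (@compress R I J) phi.
Let M := mxnorm C.

(** The graph on [N^k] of the adjoint of the matrix [C] of compressions: since [N] is invariant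
    under the adjoints [ad i j], no projection appears. *)
Let G0 : set (H * H) := [set p | (forall j, slice j p.1 \in N) /\
  forall j, slice j p.2 = \sum_i ad i j (slice i p.1)].

Let G0_le (x z : H) : G0 (x, z) -> hn z <= M * hn x.
Proof.
move=> [/= xN zE].
have zN j : slice j z \in N by rewrite zE rpred_sum// => i _; exact: ad_mem.
pose xi j : NJ J := Perp (xN j); pose zi j : NJ J := Perp (zN j).
have nx : tuple_norm xi = hn x.
  by rewrite -tuple_norm_slice /tuple_norm; congr Num.sqrt; apply: eq_bigr => j _; rewrite hn_perp.
have nz : tuple_norm zi = hn z.
  by rewrite -tuple_norm_slice /tuple_norm; congr Num.sqrt; apply: eq_bigr => j _; rewrite hn_perp.
pose w : H := glue (fun i => val (mx_apply C zi i)).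
have nw : hn w = tuple_norm (mx_apply C zi).
  rewrite -tuple_norm_slice /tuple_norm; congr Num.sqrt; apply: eq_bigr => j _.
  by rewrite slice_glue_fin hn_perp.
(* The vector [z] is in [N^k], so [C] can be applied to it: the squared norm of [z] equals the
   product of [C z] with [x], which transfers the bound [M] from [C] to its adjoint. *)
have zw : dot z z = dot w x.
  rewrite !dot_slices_fin.
  transitivity (\sum_j \sum_i dot (slice j z) (ad i j (slice i x))).
    by apply: eq_bigr => j _; rewrite {2}zE dot_sumr.
  rewrite exchange_big; apply: eq_bigr => i _ /=.
  rewrite slice_glue_fin -(perp_dot (mx_apply C zi i) (xi i)) /mx_apply dot_suml.
  apply: eq_bigr => j _; rewrite mxE compress_dot /=.
  by rewrite dotC adP -dotC.
have [->|z0] := eqVneq (hn z) 0; first by rewrite mulr_ge0 ?mxnorm_ge0 ?hn_ge0.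
have zp : 0 < hn z by rewrite lt_def z0 hn_ge0.
rewrite -(ler_pM2l zp) -expr2 hn_sqr /rdot zw.
apply: le_trans (rdot_CS w x) _.
rewrite mulrCA mulrA ler_wpM2r ?hn_ge0// nw -nz; exact: le_mxnorm.
Qed.

Let G0_coinvariant : coinvariant_graph M G0.
Proof.
split.
- split.
    split=> j; first by rewrite (lin_0 (Sl j)) rpred0.
    by rewrite (lin_0 (Sl j)) big1// => i _; rewrite (lin_0 (Sl i)) (lin_0 (adl i j)).
  move=> a [x z] [x' z'] [/= xN zE] [/= xN' zE']; split=> j /=.
    by rewrite Sl rpredD// rpredZ.
  rewrite Sl zE zE' scaler_sumr -big_split; apply: eq_bigr => i _ /=.
  by rewrite Sl adl.
- exact: G0_le.
- move=> a x z [/= xN zE]; split=> j /=; first by rewrite slice_rann rann_mem.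
  rewrite slice_rann zE (lin_sum (rann_linear a)); apply: eq_bigr => i _.
  by rewrite slice_rann rann_ad.
Qed.

Lemma lift_representative : exists theta : 'M[Finf R I]_k,
  (forall i j, theta i j - phi i j \in J) /\ mxnorm (map_mx val theta) <= M.
Proof.
have [T [[Tl Tb] Tr TG]] := commutant_lifting (mxnorm_ge0 C) G0_coinvariant.
pose th i j : F2 -> F2 := fun u => slice i (T (inject j u)).
have injl j : linear (inject j : F2 -> H) by have [] := @inject_bounded R k (seq I) j.
have thb i j : bounded_linear (th i j) M.
  split=> [a u v|u]; first by rewrite /th injl Tl Sl.
  apply: le_trans (hn_slice _ _) _; apply: le_trans (Tb _) _.
  rewrite ler_wpM2l ?mxnorm_ge0//; have [_ h] := @inject_bounded R k (seq I) j.
  by rewrite -[leRHS]mul1r.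
pose Th i j : op (fock R I) := Op (@bounded_linear_op R (fock R I) _ _ (thb i j)).
have ri_inj a : injective (fun b : 'I_k * seq I => right_index (a, b)).
  by move=> b b' /right_index_inj[].
have ThF i j : Th i j \in @in_Finf R I.
  apply: right_commuting_Finf => a u.
  rewrite -[LHS]/(slice i (T (inject j (rcreate a u)))).
  rewrite -[X in _ = rcreate a X]/(slice i (T (inject j u))).
  have -> : inject j (rcreate a u) = push (fun b => right_index (a, b)) (inject j u).
    rewrite /inject /rcreate (push_comp _ (@pair_inj _ _ j) (@rcons_injl I a)).
    by rewrite (push_comp _ (ri_inj a) (@pair_inj _ _ j)).
  rewrite Tr; move: (T _) => y; apply/l2_ext => w; rewrite sliceE.
  have [[w' <-]|nw] := pselect (exists w', rcons w' a = w).
    rewrite /rcreate (pushE (@rcons_injl I a)) sliceE.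
    by rewrite -[(i, rcons w' a)]/(right_index (a, (i, w'))) (pushE (ri_inj a)).
  rewrite /rcreate (push_out (@rcons_injl I a)); last first.
    by move=> w'; apply/eqP => h; apply: nw; exists w'.
  rewrite (push_out (ri_inj a))// => -[i' w']; apply/eqP => -[_ h].
  by apply: nw; exists w'.
pose theta : 'M[Finf R I]_k := \matrix_(i, j) MkFinf (ThF i j).
exists theta; split.
(* The lifted and the given entries have the same products with every [z] in [N], since the adjoint
   of the lift extends [G0]. Their difference thus has its range in [MJ], and it belongs to [J]. *)
- move=> i j; rewrite mxE; apply: (MJ_range_mem J_ideal J_closed) => u.
  apply: (MJ_biortho J_ideal) => z zN.
  pose x : H := inject i z.
  pose z' : H := glue (fun j => ad i j z).
  have Gx : G0 (x, z').
    split=> l /=; first by rewrite /x slice_inject rpredZ.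
    rewrite slice_glue_fin (bigD1 i)//= big1 ?addr0.
      by rewrite /x slice_inject eqxx scale1r.
    move=> m mi; rewrite /x slice_inject (negPf mi) scale0r.
    exact: (lin_0 (adl m l)).
  have := TG _ _ Gx (inject j u).
  rewrite dot_inject slice_glue_fin dotC dot_inject => E.
  have E2 : dot z (th i j u) = dot z (phi i j u).
    apply: (@can_inj _ _ _ _ (@conjCK R[i])); rewrite E.
    by rewrite -adP -dotC.
  rewrite (_ : (MkFinf (ThF i j) - phi i j) u = th i j u - phi i j u)//.
  by rewrite dotBr E2 subrr.
- apply: mxnorm_le (mxnorm_ge0 C) _ => x.
  have -> : tuple_norm (mx_apply (map_mx val theta) x) = hn (T (glue x)).
    rewrite -tuple_norm_slice; congr tuple_norm; apply/funext => i.
    rewrite -sum_inject (lin_sum Tl) (lin_sum (Sl i)) /mx_apply.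
    by apply: eq_bigr => j _; rewrite !mxE.
  by rewrite tuple_norm_glue.
Qed.

End lift_representative.

(** * The representation of the quotient *)

Section quotient_representation.
Variables (R : realType) (I : countType) (J : zmodClosed (Finf R I)).
Hypothesis J_ideal : two_sided_ideal J.
Hypothesis J_closed : closed ([set` J] : set (Finf_wstar R I)).

Definition represent (q : quotFinf J) : op (NJ J) :=
  compress J (repr (q : Quotient.quot J)).

Let Cl : linear (@compress R I J).
Proof. by move=> a phi psi; exact: compressZD. Qed.

Lemma represent_pi phi : represent (qpi J phi) = compress J phi.
Proof.
apply/eqP; rewrite -subr_eq0 /represent -(lin_B Cl); apply/eqP.
apply/(compress_eq0_mem J_ideal J_closed).
by rewrite Quotient.idealrBE /qpi reprK.
Qed.

Lemma represent_inj : injective represent.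
Proof.
move=> q q'; rewrite -[q]reprK -[q']reprK -!/(qpi J _) !represent_pi => h.
apply/eqP; rewrite /qpi -Quotient.idealrBE.
by apply/(compress_eq0_mem J_ideal J_closed); rewrite (lin_B Cl) h subrr.
Qed.

Lemma compress_compression (phi : Finf R I) : is_compression (val phi) (compress J phi).
Proof. by move=> x; rewrite compressE. Qed.

Lemma range_represent : range represent = compressions J.
Proof.
apply/seteqP; split=> [_ [q _ <-]|T [phi Tphi]].
  exists (repr (q : Quotient.quot J)); exact: compress_compression.
exists (qpi J phi) => //; rewrite represent_pi; apply: op_ext => x; apply: perp_ext.
by rewrite compress_compression Tphi.
Qed.

(** Compression does not increase the norm of any representative, which gives one inequality; the
    lift [theta] is a representative that attains the infimum. *)
Lemma mxnorm_represent k (q : 'M[quotFinf J]_k) :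
  mxnorm (map_mx represent q) = quotient_mxnorm q.
Proof.
pose phi : 'M[Finf R I]_k := map_mx (fun p : quotFinf J => repr (p : Quotient.quot J)) q.
have phiE : map_mx (qpi J) phi = q.
  by apply/matrixP => i j; rewrite !mxE /qpi reprK.
have rE (psi : 'M[Finf R I]_k) : map_mx (qpi J) psi = q ->
    map_mx represent q = map_mx (@compress R I J) psi.
  by move=> <-; apply/matrixP => i j; rewrite !mxE represent_pi.
have lower (psi : 'M[Finf R I]_k) : map_mx (qpi J) psi = q ->
    mxnorm (map_mx represent q) <= mxnorm (map_mx val psi).
  move=> /rE ->; apply: mxnorm_le (mxnorm_ge0 _) _ => x.
  pose y (j : 'I_k) : fock R I := val (x j).
  have -> : tuple_norm x = tuple_norm y.
    by rewrite /tuple_norm; congr Num.sqrt; apply: eq_bigr => j _; rewrite hn_perp.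
  apply: le_trans (le_mxnorm (map_mx val psi) y).
  rewrite tuple_norm_le ?tuple_norm_ge0// tuple_norm_sqr; apply: ler_sum => i _.
  apply: ler_sqr_hn; rewrite hn_perp.
  apply: le_trans (hn_orthoproj (MJ J) (mx_apply (map_mx val psi) y i)).
  suff -> : val (mx_apply (map_mx (@compress R I J) psi) x i) =
     orthoproj (orthocomp (MJ J)) (mx_apply (map_mx val psi) y i) by [].
  have vl : linear (val : NJ J -> fock R I) by move=> a u v; exact: perp_valZD.
  rewrite /mx_apply (lin_sum vl) (lin_sum (@orthoproj_linear R _ (MJ J))).
  by apply: eq_bigr => j _; rewrite !mxE compressE.
apply/eqP; rewrite eq_le; apply/andP; split.
  apply: lb_le_inf; first by exists (mxnorm (map_mx val phi)), phi.
  by move=> _ [psi /= psiq <-]; exact: lower.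
have [theta [thJ thle]] := lift_representative J_ideal J_closed phi.
have thq : map_mx (qpi J) theta = q.
  rewrite -phiE; apply/matrixP => i j; rewrite !mxE; apply/eqP.
  by rewrite /qpi -Quotient.idealrBE; have := thJ i j; rewrite !mxE.
apply: (@le_trans _ _ (mxnorm (map_mx val theta))); last by rewrite (rE _ phiE).
apply: ge_inf; last by exists theta.
by exists 0 => _ [psi _ <-]; exact: mxnorm_ge0.
Qed.

Lemma represent_homeomorphism :
  homeomorphism_onto (represent : quotient_wstar J -> wot (NJ J)) (compressions J).
Proof.
split.
- split.
  + by move=> q _; rewrite -range_represent; exists q.
  + by move=> q q' _ _; exact: represent_inj.
  + by rewrite -range_represent => T [q _ <-]; exists q.
- apply: sigma_continuous => _ [x [y ->]].
  apply: sigma_functional_continuous.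
  exists (fun phi => dot (compress J phi x) y).
    exact: vector_functional_preannihilator.
  by apply/funext => phi; rewrite -represent_pi.
(* The default value is taken only off the compressions, where no continuity is claimed. *)
pose g (T : op (NJ J)) : quotFinf J := xget 0 [set q | represent q = T].
have gK : cancel represent g.
  move=> q; apply: represent_inj.
  by rewrite /g; apply: (@xgetPex _ 0 [set p | represent p = represent q]); exists q.
exists g => //.
apply: (@sigma_continuous R (quotFinf J) _ (subspace (compressions J : set (wot (NJ J)))) g).
move=> f [h hJ hf].
have [x [y hE]] := preannihilator_compress J_ideal hJ.
pose l (T : op (NJ J)) : R[i] := dot (T x) y.
(* On the compressions, a w*-continuous functional of the quotient composed with the inverse is a
   vector functional, hence WOT-continuous. *)
have lE : {in (compressions J : set (wot (NJ J))), l =1 f \o g}.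
  move=> T /set_mem; rewrite -range_represent => -[q _ <-].
  rewrite /= gK -[q]reprK -/(qpi J _) represent_pi /l -hE.
  by rewrite hf.
have lc : {within (compressions J : set (wot (NJ J))), continuous (l : wot (NJ J) -> R[i]^o)}.
  apply: continuous_subspaceT; apply: sigma_functional_continuous.
  by exists x, y.
exact: (@subspace_eq_continuous (wot (NJ J)) (compressions J) R[i]^o l (f \o g) lE lc).
Qed.

End quotient_representation.

Theorem theorem4p1 (R : realType) (I : countType) (I_neq0 : [set: I] !=set0)
    (J : zmodClosed (Finf R I)) (J_ideal : two_sided_ideal J)
    (J_closed : closed ([set` J] : set (Finf_wstar R I))) :
  exists Psi : quotFinf J -> op (NJ J),
    [/\ forall phi : Finf R I, is_compression (val phi) (Psi (qpi J phi)),
        [/\ forall (a : R[i]) (phi psi : Finf R I),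
              Psi (qpi J (a *: phi + psi)) =
              a *: Psi (qpi J phi) + Psi (qpi J psi),
            forall phi psi : Finf R I,
              Psi (qpi J (phi * psi)) = Psi (qpi J phi) * Psi (qpi J psi) &
            Psi (qpi J 1) = 1],
        range Psi = compressions J,
        forall (k : nat) (q : 'M[quotFinf J]_k),
          mxnorm (map_mx Psi q) = quotient_mxnorm q &
        homeomorphism_onto (Psi : quotient_wstar J -> wot (NJ J))
          (compressions J)].
Proof.
have pi := represent_pi J_ideal J_closed.
exists (@represent R I J); split.
- by move=> phi; rewrite pi; exact: compress_compression.
- split=> [a phi psi|phi psi|].
  + by rewrite !pi compressZD.
  + by rewrite !pi (compressM J_ideal).
  + by rewrite pi compress1.
- exact: range_represent.
- exact: mxnorm_represent.
- exact: represent_homeomorphism.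
Qed.
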